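(* Let $\mathbb{F}$ be an arbitrary field and let $E$ be the natural $2$-dimensional representation of $\mathrm{SL}_2(\mathbb{F})$. Let $m,n,d\in\mathbb{N}$ with $m\le n$ and $m\le d$. Then the $\mathrm{SL}_2(\mathbb{F})$-module $\Delta^{(n,m)}\mathrm{Sym}^d E$ has a filtration with the following layers, listed from top layer to bottom layer: $$\mathrm{Sym}_{n+m}\mathrm{Sym}^{d-k}E\otimes\Delta^{(n-k,\,m-k)}\mathrm{Sym}^{k}E,\qquad k=m,\,m-1,\,\ldots,\,2,\,1.$$ That is, there is a chain of $\mathrm{SL}_2(\mathbb{F})$-submodules $$0=M_m\le M_{m-1}\le\cdots\le M_1\le M_0=\Delta^{(n,m)}\mathrm{Sym}^dE$$ such that for each $i\in\{0,1,\ldots,m-1\}$, setting $k=m-i$, there is an isomorphism of $\mathrm{SL}_2(\mathbb{F})$-modules $$M_i/M_{i+1}\;\cong\;\mathrm{Sym}_{n+m}\mathrm{Sym}^{d-k}E\otimes\Delta^{(n-k,\,m-k)}\mathrm{Sym}^{k}E .$$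
   Context: For an $\mathbb{F}$-vector space $V$: $\mathrm{Sym}^rV$ is the quotient of $V^{\otimes r}$ identifying tensors that differ by swapping factors (the usual symmetric power, coinvariants), and $\mathrm{Sym}_rV=(V^{\otimes r})^{\mathfrak{S}_r}$ is the space of symmetric tensors (invariants). The exterior power $\bigwedge^rV$ is the quotient of $V^{\otimes r}$ by the span of tensors with two equal adjacent factors. $\mathrm{Sym}^0V=\mathrm{Sym}_0V=\mathbb{F}$. For a partition $\lambda$ with conjugate $\lambda'$, the Weyl module $\Delta^\lambda V$ is the image of the composite $$\psi_\lambda:\ \mathrm{Sym}_{\lambda_1}V\otimes\cdots\otimes\mathrm{Sym}_{\lambda_\ell}V\hookrightarrow V^{\otimes|\lambda|}\twoheadrightarrow\textstyle\bigwedge^{\lambda_1'}V\otimes\cdots\otimes\bigwedge^{\lambda'_{\lambda_1}}V,$$ where the tensor factors of $V^{\otimes|\lambda|}$ are indexed by the boxes of the Young diagram of $\lambda$, the first map is the inclusion of symmetric tensors along each row, and the second is the canonical quotient map (exterior product) along each column. In particular $\Delta^{(r,0)}V=\Delta^{(r)}V=\mathrm{Sym}_rV$ (and $\Delta^{\varnothing}V=\mathbb{F}$). All these constructions are functorial in $V$, so if $V$ is a representation of $\mathrm{SL}_2(\mathbb{F})$, they are representations of $\mathrm{SL}_2(\mathbb{F})$. *)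

(* Defs.v *)
From HB Require Import structures.
From mathcomp Require Import all_boot all_order all_algebra all_fingroup.
From mathcomp Require Import boolp.

Set Implicit Arguments.
Unset Strict Implicit.
Unset Printing Implicit Defensive.

Import GRing.Theory.
Local Open Scope ring_scope.

Section Span.
Context {F : fieldType} {V : vectType F}.
Implicit Types (S : V -> Prop) (U W : {vspace V}).

Lemma spanset_subproof S : exists U,
  (forall v, S v -> v \in U) /\
  (forall W, (forall v, S v -> v \in W) -> (U <= W)%VS).
Proof.
pose P k := `[< exists2 X : seq V, (forall x, x \in X -> S x) &
                 \dim <<X>> = k >].
have P0 : exists k, P k.
  by exists 0%N; apply/asboolP; exists [::]; rewrite // span_nil dimv0.
have Pmax k : P k -> (k <= \dim {:V})%N.
  by move=> /asboolP[X _ <-]; apply: dimvS; apply: subvf.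
case: (ex_maxnP P0 Pmax) => k /asboolP[X SX dX] kmax.
exists <<X>>%VS; split => [v Sv | W SW]; last first.
  by apply/span_subvP => x /SX /SW.
have /kmax : P (\dim <<v :: X>>).
  apply/asboolP; exists (v :: X) => // x.
  by rewrite inE => /orP[/eqP-> // | /SX].
rewrite -dX => le_dim.
have sub : (<<X>> <= <<v :: X>>)%VS by rewrite span_cons addvSr.
have /eqP -> : (<<X>> == <<v :: X>>)%VS by rewrite eqEdim sub le_dim.
by rewrite memv_span // mem_head.
Qed.

Definition spanset S : {vspace V} := projT1 (cid (spanset_subproof S)).

Lemma mem_spanset S v : S v -> v \in spanset S.
Proof. by rewrite /spanset; case: cid => U /= [SU _]; apply: SU. Qed.

Lemma spanset_min S W : (forall v, S v -> v \in W) -> (spanset S <= W)%VS.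
Proof. by rewrite /spanset; case: cid => U /= [_ minU]; apply: minU. Qed.

End Span.

Section Quotient.
Context {F : fieldType} {V : vectType F} (U : {vspace V}).

(* V / U is modelled on the library's chosen complement of U, the projection
   being taken along U; [lker_qproj] and [limg_qproj] say that this is
   a quotient of V by U. *)
Definition quotv : vectType F := subvs_of (U^C)%VS.

Definition qproj : 'Hom(V, quotv) :=
  (linfun (vsproj (U^C)%VS) \o daddv_pi (U^C)%VS U)%VF.

Lemma vsval_qproj v : vsval (qproj v) = daddv_pi (U^C)%VS U v.
Proof. by rewrite /qproj comp_lfunE lfunE /= vsprojK ?memv_pi. Qed.

Lemma lker_qproj : lker qproj = U.
Proof.
have dxC : (U^C :&: U = 0)%VS by rewrite capvC capv_compl.
apply/vspaceP => v; rewrite memv_ker; apply/eqP/idP => [qv0 | Uv].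
  have := daddv_pi_add dxC (w := v); rewrite addvC addv_complf => /(_ (memvf v)).
  by rewrite -vsval_qproj qv0 linear0 add0r => <-; apply: memv_pi.
have := daddv_pi_add dxC (w := v); rewrite addvC addv_complf => /(_ (memvf v)).
rewrite (daddv_pi_id (capv_compl U) Uv) => /eqP.
rewrite -subr_eq0 addrK => /eqP pv0.
by apply: val_inj; rewrite /= vsval_qproj pv0.
Qed.

Lemma qproj_eq0 v : (qproj v == 0) = (v \in U).
Proof. by rewrite -memv_ker lker_qproj. Qed.

Lemma limg_qproj : limg qproj = fullv.
Proof.
apply/eqP; rewrite eqEsubv subvf; apply/subvP => x _.
have -> : x = qproj (vsval x); last exact/memv_img/memvf.
apply: val_inj; rewrite /= vsval_qproj daddv_pi_id ?subvsP //.
by rewrite capvC capv_compl.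
Qed.

Lemma qproj_surj (x : quotv) : exists v, x = qproj v.
Proof.
have: x \in limg qproj by rewrite limg_qproj memvf.
by case/memv_imgP => v _ ->; exists v.
Qed.

End Quotient.

Section Multilinear.
Context {F : fieldType} {I : finType} {V : I -> vectType F} {W : lmodType F}.

Definition multilinear (phi : (forall i, V i) -> W) :=
  forall (v : forall i, V i) (i : I), linear (fun x : V i => phi (dfwith v x)).

End Multilinear.

Section Tensor.
Context {F : fieldType} {I : finType}.

(* The tensor product of the V i, in coordinates: a tensor is a family of
   scalars indexed by the tuples of basis vectors (one in each V i). It is
   characterised by [tlift_pure] and [tens_ext]. *)
Definition tens (V : I -> vectType F) : vectType F :=
  {ffun {dffun forall i : I, 'I_(\dim {:V i})} -> F^o}.

Section Defs.
Context {V : I -> vectType F}.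

Definition pure (v : forall i, V i) : tens V :=
  [ffun s : {dffun forall i : I, 'I_(\dim {:V i})} =>
     \prod_i coord (vbasis {:V i}) (s i) (v i)].

Context {W : vectType F}.

Definition tlift_fun (phi : (forall i, V i) -> W) (t : tens V) : W :=
  \sum_(s : {dffun forall i : I, 'I_(\dim {:V i})})
     (t s : F) *: phi (fun i => (vbasis {:V i})`_(s i)).

Fact tlift_linear phi : linear (tlift_fun phi).
Proof.
move=> a t u; rewrite scaler_sumr -big_split; apply: eq_bigr => s _ /=.
by rewrite !ffunE scalerDl scalerA.
Qed.

HB.instance Definition _ phi :=
  GRing.isLinear.Build F (tens V) W _ (tlift_fun phi) (tlift_linear phi).

(* The linear map sending [pure v] to [phi v], for a multilinear phi. *)
Definition tlift (phi : (forall i, V i) -> W) : 'Hom(tens V, W) :=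
  linfun (tlift_fun phi).

End Defs.

Section Theory.
Context {V : I -> vectType F} {W : vectType F}.

Lemma dfwith_id (v : forall i, V i) i : dfwith v (v i) = v.
Proof. by apply: functional_extensionality_dep => j; case: dfwithP. Qed.

Lemma multilinear_span_ext (B : forall i, V i -> Prop)
    (phi psi : (forall i, V i) -> W) :
  (forall i x, exists (K : finType) (c : K -> F) (b : K -> V i),
     (forall k, B i (b k)) /\ x = \sum_k c k *: b k) ->
  multilinear phi -> multilinear psi ->
  (forall v, (forall i, B i (v i)) -> phi v = psi v) -> phi = psi.
Proof.
move=> spanB lphi lpsi ext; apply: funext => v.
have: forall i, i \notin enum I -> B i (v i) by move=> i; rewrite mem_enum.
elim: (enum I) v => [|i r IHr] v vP; first by apply: ext => i; apply: vP.
have [K [c [b [Bb vE]]]] := spanB i (v i).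
have sumE (f : (forall i, V i) -> W) : multilinear f ->
    f v = \sum_k c k *: f (dfwith v (b k)).
  move=> lf; rewrite -[in LHS](dfwith_id v i) [X in dfwith v X]vE.
  pose g := GRing.isLinear.Build F (V i) W _ _ (lf v i).
  pose h : {linear V i -> W} := HB.pack (fun x : V i => f (dfwith v x)) g.
  rewrite -[LHS]/(h _) linear_sum; apply: eq_bigr => k _.
  by rewrite linearZ.
rewrite (sumE _ lphi) (sumE _ lpsi); apply: eq_bigr => k _; congr (_ *: _).
apply: IHr => j jr; move: jr; case: dfwithP => [|{}j ij] jr; first exact: Bb.
by apply: vP; rewrite inE negb_or eq_sym ij.
Qed.

Lemma multilinear_ext (phi psi : (forall i, V i) -> W) :
  multilinear phi -> multilinear psi ->
  (forall s : {dffun forall i : I, 'I_(\dim {:V i})},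
     phi (fun i => (vbasis {:V i})`_(s i)) =
     psi (fun i => (vbasis {:V i})`_(s i))) ->
  phi = psi.
Proof.
move=> lphi lpsi ext.
pose B i x := exists k : 'I_(\dim {:V i}), x = (vbasis {:V i})`_k.
apply: (@multilinear_span_ext B) => // [i x | v Bv].
  exists 'I_(\dim {:V i}), (fun k => coord (vbasis {:V i}) k x).
  exists (fun k : 'I_(\dim {:V i}) => (vbasis {:V i})`_k); split=> [k|]; first by exists k.
  exact/coord_vbasis/memvf.
have vE i := cid (Bv i).
pose s : {dffun forall i : I, 'I_(\dim {:V i})} :=
  finfun (fun i => projT1 (vE i)).
have -> : v = fun i => (vbasis {:V i})`_(s i).
  apply: functional_extensionality_dep => i.
  by rewrite ffunE; case: (vE i).
exact: ext.
Qed.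

Lemma pure_multilinear : multilinear (@pure V).
Proof.
move=> v i a x y; apply/ffunP => s; rewrite !ffunE.
rewrite !(bigD1 (P := xpredT) i) //=.
rewrite !dfwith_in linearD linearZ /= mulrDl -mulrA.
congr (a * (_ * _) + _ * _); apply: eq_bigr => j ji;
  by rewrite !dfwith_out // eq_sym.
Qed.

Lemma multilinear_comp (f : 'Hom(tens V, W)) : multilinear (fun v => f (pure v)).
Proof. by move=> v i a x y; rewrite pure_multilinear linearP. Qed.

Lemma pure_basis (s s' : {dffun forall i : I, 'I_(\dim {:V i})}) :
  pure (fun i => (vbasis {:V i})`_(s i)) s' = (s' == s)%:R.
Proof.
rewrite ffunE; case: eqP => [-> | ne].
  by rewrite big1 // => i _; rewrite coord_free ?eqxx ?(basis_free (vbasisP _)).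
have [i ne_i] : exists i, s' i != s i.
  apply/existsP; apply: contra_notT ne; rewrite negb_exists => /forallP e.
  by apply/ffunP => i; apply/eqP; have := e i; rewrite negbK.
rewrite (bigD1 i) //= coord_free ?(basis_free (vbasisP _)) //.
by rewrite eq_sym (negPf ne_i) mul0r.
Qed.

Lemma tlift_basis phi (s : {dffun forall i : I, 'I_(\dim {:V i})}) :
  tlift phi (pure (fun i => (vbasis {:V i})`_(s i))) =
  phi (fun i => (vbasis {:V i})`_(s i)) :> W.
Proof.
rewrite lfunE /= /tlift_fun (bigD1 s) //= pure_basis eqxx scale1r.
by rewrite big1 ?addr0 // => s' ne; rewrite pure_basis (negPf ne) scale0r.
Qed.

Lemma tlift_pure (phi : (forall i, V i) -> W) (v : forall i, V i) :
  multilinear phi -> tlift phi (pure v) = phi v.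
Proof.
move=> lphi; suff e : (fun v => tlift phi (pure v)) = phi by rewrite -[in RHS]e.
apply: multilinear_ext => [||s] //; first exact: multilinear_comp.
exact: tlift_basis.
Qed.

Lemma tens_sum_basis (t : tens V) :
  t = \sum_(s : {dffun forall i : I, 'I_(\dim {:V i})})
        (t s : F) *: pure (fun i => (vbasis {:V i})`_(s i)).
Proof.
apply/ffunP => s; rewrite sum_ffunE (bigD1 s) //= ffunE pure_basis eqxx.
rewrite [_ *: _]mulr1 big1 ?addr0 // => s' ne.
by rewrite ffunE pure_basis eq_sym (negPf ne) scaler0.
Qed.

Lemma tens_ext (f g : 'Hom(tens V, W)) :
  (forall v, f (pure v) = g (pure v)) -> f = g.
Proof.
move=> fg; apply/lfunP => t; rewrite (tens_sum_basis t) !linear_sum.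
by apply: eq_bigr => s _; rewrite !linearZ /= fg.
Qed.

End Theory.

Definition tmap {V W : I -> vectType F} (f : forall i, 'Hom(V i, W i)) :
  'Hom(tens V, tens W) := tlift (fun v => pure (fun i => f i (v i))).

Lemma dfwith_map {V W : I -> vectType F} (f : forall i, V i -> W i) v i x :
  (fun j => f j (@dfwith I V v i x j)) = dfwith (fun j => f j (v j)) (f i x).
Proof.
apply: functional_extensionality_dep => j.
by case: (dfwithP v x j) => [|{}j ij]; rewrite ?dfwith_in ?dfwith_out.
Qed.

Lemma tmap_pure {V W : I -> vectType F} (f : forall i, 'Hom(V i, W i)) v :
  tmap f (pure v) = pure (fun i => f i (v i)).
Proof.
rewrite tlift_pure // => {}v i a x y.
by rewrite !(dfwith_map f) linearP pure_multilinear.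
Qed.

Lemma tmap_id {V : I -> vectType F} :
  tmap (fun i => \1%VF : 'End(V i)) = \1%VF.
Proof.
apply: tens_ext => v; rewrite tmap_pure id_lfunE; congr pure.
by apply: functional_extensionality_dep => i; rewrite id_lfunE.
Qed.

Lemma tmap_comp {U V W : I -> vectType F} (f : forall i, 'Hom(V i, W i))
    (g : forall i, 'Hom(U i, V i)) :
  tmap (fun i => f i \o g i)%VF = (tmap f \o tmap g)%VF.
Proof.
apply: tens_ext => v; rewrite comp_lfunE !tmap_pure; congr pure.
by apply: functional_extensionality_dep => i; rewrite comp_lfunE.
Qed.

End Tensor.

Section Powers.
Context {F : fieldType}.

Definition tpow (I : finType) (V : vectType F) : vectType F :=
  tens (fun _ : I => V).

Section Perm.
Context {I : finType} {V : vectType F}.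

Definition tshuffle (s : {perm I}) : 'End(tpow I V) :=
  tlift (fun v : I -> V => pure (fun i => v (s i))).

Lemma tshuffle_pure s (v : I -> V) :
  tshuffle s (pure v) = pure (fun i => v (s i)).
Proof.
rewrite /tshuffle tlift_pure // => {}v i a x y.
suff E z : (fun j => @dfwith I (fun=> V) v i z (s j)) =
    @dfwith I (fun=> V) (fun j => v (s j)) (s^-1%g i) z.
  by rewrite !E pure_multilinear.
apply: funext => j.
have [<-|ne] := eqVneq (s^-1%g i) j; first by rewrite permKV !dfwith_in.
by rewrite !dfwith_out //; apply: contra_neq ne => ->; rewrite permK.
Qed.

End Perm.

Variable (r : nat) (V : vectType F).

(* Sym^r V, the coinvariants: [sympow] is the quotient by [sympow_rel]. *)
Definition sympow_rel : {vspace tpow 'I_r V} :=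
  (\sum_(s : 'S_r) limg (tshuffle s - \1%VF))%VS.

Definition sympow : vectType F := quotv sympow_rel.

(* Sym_r V, the invariants. *)
Definition symtens_space : {vspace tpow 'I_r V} :=
  (\bigcap_(s : 'S_r) fixedSpace (tshuffle s))%VS.

Definition symtens : vectType F := subvs_of symtens_space.

Definition extpow_rel : {vspace tpow 'I_r V} :=
  spanset (fun t => exists (v : 'I_r -> V) (i j : 'I_r),
    [/\ j = i.+1 :> nat, v i = v j & t = pure v]).

Definition extpow : vectType F := quotv extpow_rel.

End Powers.

Section Merge.
Context {F : fieldType} {I : finType} {J : I -> finType} {V : vectType F}.

Definition merge_fun (t : forall i, tpow (J i) V) : tpow {i & J i} V :=
  [ffun s : {dffun forall p : {i & J i}, 'I_(\dim {:V})} =>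
     \prod_i (t i [ffun j : J i => s (Tagged J j)] : F)].

(* The identification of the iterated tensor power with the tensor power
   indexed by the pairs; see [merge_pure]. *)
Definition merge :
  'Hom(tens (fun i => tpow (J i) V), tpow {i & J i} V) := tlift merge_fun.

Lemma merge_fun_multilinear : multilinear merge_fun.
Proof.
move=> t i a x y; apply/ffunP => s; rewrite !ffunE.
rewrite !(bigD1 (P := xpredT) i) //=.
rewrite !dfwith_in !ffunE mulrDl -mulrA.
congr (a * (_ * _) + _ * _); apply: eq_bigr => j ji;
  by rewrite !dfwith_out // eq_sym.
Qed.

Lemma merge_pure (v : {i & J i} -> V) :
  merge (pure (fun i => pure (fun j : J i => v (Tagged J j)))) = pure v.
Proof.
rewrite /merge tlift_pure; last exact: merge_fun_multilinear.
apply/ffunP => s; rewrite !ffunE.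
under eq_bigr => i _.
  rewrite ffunE; under eq_bigr => j _ do rewrite ffunE.
  over.
by rewrite sig_big_dep /=; apply: eq_bigr => -[].
Qed.

Lemma merge_tmap (f : 'End(V)) :
  (merge \o tmap (fun i => tmap (fun _ : J i => f)) =
   tmap (fun=> f) \o merge)%VF.
Proof.
apply: tens_ext => t0; pose mf := tmap (fun i => tmap (fun _ : J i => f)).
suff /(congr1 (fun phi => phi t0)) :
    (fun t => (merge \o mf)%VF (pure t)) =
    (fun t => (tmap (fun=> f) \o merge)%VF (pure t)) by [].
pose B i (x : tpow (J i) V) := exists v, x = pure v.
apply: (@multilinear_span_ext _ _ _ _ B) => [i x|||t Bt].
- exists {dffun forall j : J i, 'I_(\dim {:V})}, (fun s => x s : F).
  exists (fun s : {dffun forall j : J i, 'I_(\dim {:V})} =>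
            pure (fun j : J i => (vbasis {:V})`_(s j))).
  by split=> [k|]; [eexists | exact: tens_sum_basis].
- exact: multilinear_comp.
- exact: multilinear_comp.
have tE i := cid (Bt i).
pose v (p : {i & J i}) := projT1 (tE (tag p)) (tagged p).
have -> : t = fun i => pure (fun j : J i => v (Tagged J j)).
  by apply: functional_extensionality_dep => i; rewrite /v /=; case: (tE i).
rewrite !comp_lfunE merge_pure /mf !tmap_pure -merge_pure; congr (merge (pure _)).
by apply: functional_extensionality_dep => i; rewrite tmap_pure.
Qed.

End Merge.

Section Weyl.
Context {F : fieldType}.
Variables (la : seq nat) (V : vectType F).

(* The Young diagram of la, as the pairs (row, position in the row). Only
   partitions are of interest, possibly with zero parts, but no hypothesis
   on la is needed. *)
Notation row i := 'I_(nth 0%N la i).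
Definition box : finType := {i : 'I_(size la) & row i}.

(* The largest part, that is the first one if [la] is a partition. *)
Definition ncols : nat := \max_(i < size la) nth 0%N la i.

(* The rows meeting column j; their number is the j-th part of the conjugate
   partition. *)
Definition col (j : 'I_ncols) : {set 'I_(size la)} :=
  [set i : 'I_(size la) | (j < nth 0 la i)%N].

(* The a-th box of column j, counted from the top. *)
Lemma col_box_subproof (j : 'I_ncols) (a : 'I_#|col j|) :
  (j < nth 0 la (enum_val a))%N.
Proof. by have := enum_valP a; rewrite inE. Qed.

Definition col_box (j : 'I_ncols) (a : 'I_#|col j|) : box :=
  Tagged (fun i : 'I_(size la) => row i) (Ordinal (col_box_subproof a)).

Definition rows : vectType F :=
  tens (fun i : 'I_(size la) => symtens (nth 0%N la i) V).

Definition cols : vectType F :=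
  tens (fun j : 'I_ncols => extpow #|col j| V).

Definition row_incl : 'Hom(rows, tpow box V) :=
  (merge \o tmap (fun i : 'I_(size la) =>
     linfun (vsval : symtens (nth 0%N la i) V -> tpow (row i) V)))%VF.

Definition col_proj : 'Hom(tpow box V, cols) :=
  tlift (fun v : box -> V =>
    pure (fun j => qproj (extpow_rel #|col j| V)
                     (pure (fun a => v (col_box a))))).

Definition weyl_map : 'Hom(rows, cols) := (col_proj \o row_incl)%VF.

Definition weyl : vectType F := subvs_of (limg weyl_map).

Lemma box_eq (p q : box) :
  tag p = tag q -> tagged p = tagged q :> nat -> p = q.
Proof.
case: p q => [i k] [i' k'] /= e; case: _ / e k' => k' kk'.
by congr existT; apply: val_inj.
Qed.

Lemma col_proj_pure (v : box -> V) :
  col_proj (pure v) =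
  pure (fun j => qproj (extpow_rel #|col j| V)
                   (pure (fun a => v (col_box a)))).
Proof.
rewrite /col_proj tlift_pure // => {}v [i k] c x y.
have lt_k : (k < ncols)%N.
  apply: leq_trans (ltn_ord k) _.
  exact: (leq_bigmax (F := fun i : 'I_(size la) => nth 0%N la i) i).
pose j0 := Ordinal lt_k.
have ij0 : i \in col j0 by rewrite inE; apply: ltn_ord k.
pose a0 := enum_rank_in ij0 i.
have a0E : enum_val a0 = i by apply: enum_rankK_in.
set p := existT _ i k.
have pE : col_box a0 = p by apply: box_eq.
pose w j := qproj (extpow_rel #|col j| V) (pure (fun a => v (col_box a))).
pose h z := qproj (extpow_rel #|col j0| V)
  (pure (@dfwith _ (fun=> V) (fun a => v (col_box a)) a0 z)).
suff E z : (fun j => qproj (extpow_rel #|col j| V) (pure (fun a =>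
      @dfwith box (fun=> V) v p z (col_box a)))) = dfwith w (h z).
  rewrite !E /h pure_multilinear linearP; exact: pure_multilinear.
apply: functional_extensionality_dep => j; case: dfwithP => [|{}j ne].
  congr (qproj _ (pure _)); apply: funext => a.
  have [<-|ne] := eqVneq a0 a; first by rewrite pE !dfwith_in.
  rewrite !dfwith_out //; apply: contra_neq ne; rewrite -pE => e.
  by apply/enum_val_inj; have := congr1 tag e.
congr (qproj _ (pure _)); apply: funext => a.
rewrite dfwith_out //; apply: contra_neq ne => e; apply/val_inj => /=.
by have := congr1 (fun q : box => val (tagged q)) e.
Qed.

End Weyl.

Section Representations.
Context {G : groupType} {F : fieldType}.
Implicit Types V W : vectType F.

Record rep V := Rep {
  ract :> G -> 'End(V);
  ract1 : ract 1%g = \1%VF;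
  ractM : forall g h, ract (g * h)%g = (ract g \o ract h)%VF
}.

Record submodule V (rV : rep V) := Submodule {
  subm_space :> {vspace V};
  subm_stable : forall g v, v \in subm_space -> rV g v \in subm_space
}.

Definition rep_iso V W (rV : rep V) (rW : rep W) : Prop :=
  exists2 f : 'Hom(V, W),
    bijective f & forall g v, f (rV g v) = rW g (f v).

Section SubRep.
Context {V : vectType F} {rV : rep V} (U : submodule rV).

Definition sub_act (g : G) : 'End(subvs_of U) :=
  (linfun (vsproj U) \o rV g \o linfun vsval)%VF.

Lemma vsval_sub_act g u : vsval (sub_act g u) = rV g (vsval u).
Proof.
by rewrite /sub_act !comp_lfunE !lfunE /= vsprojK // subm_stable ?subvsP.
Qed.

Fact sub_act1 : sub_act 1%g = \1%VF.
Proof.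
by apply/lfunP => u; apply: val_inj; rewrite /= vsval_sub_act ract1 !id_lfunE.
Qed.

Fact sub_actM g h : sub_act (g * h)%g = (sub_act g \o sub_act h)%VF.
Proof.
apply/lfunP => u; apply: val_inj.
by rewrite /= comp_lfunE !vsval_sub_act ractM comp_lfunE.
Qed.

Definition sub_rep : rep (subvs_of U) := Rep sub_act1 sub_actM.

(* The map induced on the quotient: any preimage under the projection may be
   used to compute it, see [quot_act_qproj]. *)
Definition quot_act (g : G) : 'End(quotv U) :=
  (qproj U \o rV g \o (qproj U)^-1)%VF.

Lemma quot_act_qproj g v : quot_act g (qproj U v) = qproj U (rV g v).
Proof.
pose w := (qproj U)^-1%VF (qproj U v).
have Uvw : w - v \in U.
  by rewrite -qproj_eq0 linearB /= limg_lfunVK ?subrr // limg_qproj memvf.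
have := subm_stable g Uvw.
rewrite -qproj_eq0 !linearB /= subr_eq0 => /eqP <-.
by rewrite /quot_act !comp_lfunE.
Qed.

Fact quot_act1 : quot_act 1%g = \1%VF.
Proof.
apply/lfunP => x; have [v ->] := qproj_surj x.
by rewrite quot_act_qproj ract1 !id_lfunE.
Qed.

Fact quot_actM g h : quot_act (g * h)%g = (quot_act g \o quot_act h)%VF.
Proof.
apply/lfunP => x; have [v ->] := qproj_surj x.
by rewrite comp_lfunE !quot_act_qproj ractM comp_lfunE.
Qed.

Definition quot_rep : rep (quotv U) := Rep quot_act1 quot_actM.

End SubRep.

Section Subquotient.
Context {V : vectType F} {rV : rep V} (U W : submodule rV).

Definition res_space : {vspace subvs_of U} :=
  (linfun (vsval : subvs_of U -> V) @^-1: W)%VS.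

Lemma mem_res_space u : (u \in res_space) = (vsval u \in W).
Proof. by rewrite -memv_preim lfunE. Qed.

Fact res_stable g u : u \in res_space -> sub_rep U g u \in res_space.
Proof.
by rewrite !mem_res_space vsval_sub_act; apply: subm_stable.
Qed.

(* W, or rather its intersection with U, as a submodule of U. *)
Definition res_submodule : submodule (sub_rep U) := Submodule res_stable.

(* This is U / W when W is contained in U. *)
Definition subquot_rep : rep (quotv res_space) := quot_rep res_submodule.

End Subquotient.

Section TensorRep.
Context {I : finType} {V : I -> vectType F} (rV : forall i, rep (V i)).

Definition tens_act (g : G) : 'End(tens V) := tmap (fun i => rV i g).

Fact tens_act1 : tens_act 1%g = \1%VF.
Proof.
rewrite -tmap_id; congr tmap.
by apply: functional_extensionality_dep => i; apply: ract1.
Qed.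

Fact tens_actM g h : tens_act (g * h)%g = (tens_act g \o tens_act h)%VF.
Proof.
rewrite -tmap_comp; congr tmap.
by apply: functional_extensionality_dep => i; apply: ractM.
Qed.

Definition tens_rep : rep (tens V) := Rep tens_act1 tens_actM.

Lemma tens_rep_pure g v : tens_rep g (pure v) = pure (fun i => rV i g (v i)).
Proof. exact: tmap_pure. Qed.

End TensorRep.

Definition tens2 V W : vectType F := tens (fun b : bool => if b then V else W).

Definition tens2_rep V W (rV : rep V) (rW : rep W) : rep (tens2 V W) :=
  tens_rep (fun b : bool =>
    if b return rep (if b then V else W) then rV else rW).

Section PowerReps.
Context (r : nat) {V : vectType F} (rV : rep V).

Definition tpow_rep (I : finType) : rep (tpow I V) := tens_rep (fun _ : I => rV).

Lemma tshuffle_act (s : 'S_r) g t :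
  tshuffle s (tpow_rep 'I_r g t) = tpow_rep 'I_r g (tshuffle s t).
Proof.
rewrite -!comp_lfunE; congr (fun_of_lfun _ _).
by apply: tens_ext => v; rewrite !comp_lfunE tmap_pure !tshuffle_pure tmap_pure.
Qed.

Fact sympow_rel_stable g t :
  t \in sympow_rel r V -> tpow_rep 'I_r g t \in sympow_rel r V.
Proof.
case/memv_sumP => u uP ->; rewrite linear_sum; apply: memv_sumr => s _.
have /memv_imgP[x _ ->] := uP s isT.
apply/memv_imgP; exists (tpow_rep 'I_r g x); first exact: memvf.
by rewrite !add_lfunE !opp_lfunE !id_lfunE tshuffle_act linearB.
Qed.

Definition sympow_rel_submodule : submodule (tpow_rep 'I_r) :=
  Submodule sympow_rel_stable.

Definition sympow_rep : rep (sympow r V) := quot_rep sympow_rel_submodule.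

Lemma sympow_rep_qproj g t :
  sympow_rep g (qproj (sympow_rel r V) t) =
  qproj (sympow_rel r V) (tpow_rep 'I_r g t).
Proof. exact: (quot_act_qproj sympow_rel_submodule). Qed.

Fact symtens_stable g t :
  t \in symtens_space r V -> tpow_rep 'I_r g t \in symtens_space r V.
Proof.
rewrite !memvE => /subv_bigcapP tP; apply/subv_bigcapP => s _.
apply/fixedSpaceP; rewrite tshuffle_act; congr (fun_of_lfun _ _).
by apply/fixedSpaceP; apply: tP.
Qed.

Definition symtens_submodule : submodule (tpow_rep 'I_r) :=
  Submodule symtens_stable.

Definition symtens_rep : rep (symtens r V) := sub_rep symtens_submodule.

Lemma vsval_symtens_rep g (t : symtens r V) :
  vsval (symtens_rep g t) = tpow_rep 'I_r g (vsval t).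
Proof. exact: (vsval_sub_act (U := symtens_submodule)). Qed.

Fact extpow_rel_stable g t :
  t \in extpow_rel r V -> tpow_rep 'I_r g t \in extpow_rel r V.
Proof.
rewrite [X in _ -> is_true X]memv_preim.
apply/subvP/spanset_min => _ [v [i [j [ij vij ->]]]].
rewrite -memv_preim; apply: mem_spanset.
exists (fun i => rV g (v i)), i, j; rewrite vij.
by split => //; apply: tmap_pure.
Qed.

Definition extpow_rel_submodule : submodule (tpow_rep 'I_r) :=
  Submodule extpow_rel_stable.

Definition extpow_rep : rep (extpow r V) := quot_rep extpow_rel_submodule.

Lemma extpow_rep_qproj g t :
  extpow_rep g (qproj (extpow_rel r V) t) =
  qproj (extpow_rel r V) (tpow_rep 'I_r g t).
Proof. exact: (quot_act_qproj extpow_rel_submodule). Qed.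

End PowerReps.

Section WeylRep.
Context (la : seq nat) {V : vectType F} (rV : rep V).

Definition rows_rep : rep (rows la V) :=
  tens_rep (fun i : 'I_(size la) => symtens_rep (nth 0%N la i) rV).

Definition cols_rep : rep (cols la V) :=
  tens_rep (fun j : 'I_(ncols la) => extpow_rep #|col j| rV).

Lemma row_incl_act g :
  (row_incl la V \o rows_rep g = tpow_rep rV (box la) g \o row_incl la V)%VF.
Proof.
rewrite comp_lfunA -merge_tmap -!comp_lfunA; congr (_ \o _)%VF.
rewrite -!tmap_comp; congr tmap; apply: functional_extensionality_dep => i.
apply/lfunP => t; rewrite [LHS]comp_lfunE [RHS]comp_lfunE.
rewrite [LHS]lfunE [X in _ = _ X]lfunE; exact: vsval_symtens_rep.
Qed.

Lemma col_proj_act g :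
  (col_proj la V \o tpow_rep rV (box la) g = cols_rep g \o col_proj la V)%VF.
Proof.
apply: tens_ext => v.
rewrite !comp_lfunE tens_rep_pure !col_proj_pure tens_rep_pure; congr pure.
apply: functional_extensionality_dep => j.
by rewrite extpow_rep_qproj /tpow_rep tens_rep_pure.
Qed.

Lemma weyl_map_act g :
  (weyl_map la V \o rows_rep g = cols_rep g \o weyl_map la V)%VF.
Proof. by rewrite -comp_lfunA row_incl_act !comp_lfunA col_proj_act. Qed.

Fact weyl_stable g y :
  y \in limg (weyl_map la V) -> cols_rep g y \in limg (weyl_map la V).
Proof.
case/memv_imgP => x _ ->; rewrite -[cols_rep g _]comp_lfunE -weyl_map_act.
by rewrite comp_lfunE; apply: memv_img; apply: memvf.
Qed.

Definition weyl_submodule : submodule cols_rep := Submodule weyl_stable.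

Definition weyl_rep : rep (weyl la V) := sub_rep weyl_submodule.

Lemma vsval_weyl_rep g (x : weyl la V) :
  vsval (weyl_rep g x) = cols_rep g (vsval x).
Proof. exact: (vsval_sub_act (U := weyl_submodule)). Qed.

End WeylRep.

End Representations.

Arguments rep G {F} V.

Section SL2.
Variable F : fieldType.

Record SL2 := SL2Elt { SL2_mx :> 'M[F]_2; SL2P : \det SL2_mx == 1 }.

HB.instance Definition _ := [isSub for SL2_mx].
HB.instance Definition _ := [Choice of SL2 by <:].

Fact SL2_one_subproof : \det (1%:M : 'M[F]_2) == 1.
Proof. by rewrite det1. Qed.

Fact SL2_mul_subproof (g h : SL2) : \det (SL2_mx g *m SL2_mx h) == 1.
Proof. by rewrite det_mulmx (eqP (SL2P g)) (eqP (SL2P h)) mulr1. Qed.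

Fact SL2_inv_subproof (g : SL2) : \det (invmx (SL2_mx g)) == 1.
Proof. by rewrite det_inv (eqP (SL2P g)) invr1. Qed.

Definition SL2_one := SL2Elt SL2_one_subproof.
Definition SL2_mul g h := SL2Elt (SL2_mul_subproof g h).
Definition SL2_inv g := SL2Elt (SL2_inv_subproof g).

Fact SL2_unit (g : SL2) : SL2_mx g \in unitmx.
Proof. by rewrite unitmxE (eqP (SL2P g)) unitr1. Qed.

Fact SL2_mulA : associative SL2_mul.
Proof. by move=> g h k; apply: val_inj; apply: mulmxA. Qed.
Fact SL2_mul1 : left_id SL2_one SL2_mul.
Proof. by move=> g; apply: val_inj; apply: mul1mx. Qed.
Fact SL2_mulr1 : right_id SL2_one SL2_mul.
Proof. by move=> g; apply: val_inj; apply: mulmx1. Qed.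
Fact SL2_mulV : left_inverse SL2_one SL2_inv SL2_mul.
Proof. by move=> g; apply: val_inj; apply: mulVmx (SL2_unit g). Qed.
Fact SL2_mulrV : right_inverse SL2_one SL2_inv SL2_mul.
Proof. by move=> g; apply: val_inj; apply: mulmxV (SL2_unit g). Qed.

HB.instance Definition _ := isGroup.Build SL2
  SL2_mulA SL2_mul1 SL2_mulr1 SL2_mulV SL2_mulrV.

Definition nat_act (g : SL2) : 'End('cV[F]_2) :=
  linfun (mulmx (SL2_mx g)).

Fact nat_act1 : nat_act 1%g = \1%VF.
Proof. by apply/lfunP => v; rewrite lfunE id_lfunE /= mul1mx. Qed.

Fact nat_actM g h : nat_act (g * h)%g = (nat_act g \o nat_act h)%VF.
Proof. by apply/lfunP => v; rewrite comp_lfunE !lfunE /= mulmxA. Qed.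

Definition nat_rep : rep SL2 'cV[F]_2 := Rep nat_act1 nat_actM.

End SL2.

(* Main.v *)
(* The proof is dual and works with polynomial functions. A linear functional on
   the Weyl module of shape (n, m) of V is the same as a polynomial function
   E(f, g) of two vectors of V, bihomogeneous of degree (n, m) and invariant
   under (f, g) -> (f, g + t f): such functions are combinations of products of
   2 x 2 minors and coordinates of f ([shift_invariants]), over any field and
   even over any domain. When V = Sym^d E, the vectors are binary forms of
   degree d, written as polynomials in one variable.

   Let D_k be the space of the functionals whose E vanishes at (u f, u g) as soon
   as f and g have degree at most j, for every j < k, so that D_1 is everything.
   If E is in D_k, then (f, g) |-> E(u f, u g), for f and g of degree k and u of
   degree d - k, vanishes when f and g have a common factor, so it is
   Res(f, g) chi(u; f, g), where chi has degree n + m in u and is a shift invariant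
   of degree (n - k, m - k) in (f, g): chi is a functional on the k-th layer. As
   the resultant is SL_2-invariant, this embeds D_k / D_(k+1) equivariantly in the
   dual of the k-th layer, and D_(m+1) = 0 by degree.

   The embeddings are onto because the dimensions add up. The coefficients of
   E(f, g + t f), for E symmetric in each row but not shift-invariant, give
   dim Sym_n dim Sym_m <= sum_i dim Delta^(n+m-i, i); together with the upper
   bounds coming from the embeddings and the identity [binom_product], this
   forces equality everywhere. Annihilators of the D_k are the required
   submodules. *)
From HB Require Import structures.
Require Import Defs.
From mathcomp Require Import all_boot all_order all_algebra all_fingroup.
From mathcomp Require Import mpoly zify ring.
From mathcomp Require boolp.
Import Defs.

Set Implicit Arguments.
Unset Strict Implicit.
Unset Printing Implicit Defensive.

Import GRing.Theory.
Local Open Scope ring_scope.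

(** * Polynomial functions of two vectors *)

(** The field may be finite, so values on F do not determine a polynomial. Identities between
    polynomial functions therefore quantify over all integral domains A with a ring morphism F -> A;
    they are proved at a generic pair, whose coordinates are indeterminates, and then specialised.
    Working in domains allows resultants and indeterminates to be cancelled there. The results on
    invariants and resultants are stated over a domain because they are applied with u generic, over
    the polynomial ring in the coefficients of u; the coefficients of chi are then polynomials in u,
    and only their homogeneous parts of degree n + m are kept. No preimage of a given chi is ever
    constructed: surjectivity comes from the comparison of dimensions alone. Since the k-th layer
    involves Delta^(n-k, m-k) Sym^k E, where k may be smaller than m - k, the count has to run over
    all degrees d, including d < m, where only min(m, d) layers occur. *)

Fact polyX_nz (R : nzRingType) : 'X != 0 :> {poly R}.
Proof. by rewrite -size_poly_eq0 size_polyX. Qed.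

Section Substitution.
Context {R A : idomainType}.

Fact mulrC_rmorph (h : {rmorphism R -> A}) (a : A) : commr_rmorph h a.
Proof. by move=> x; apply: mulrC. Qed.

Definition psubst (h : {rmorphism R -> A}) (a : A) : {rmorphism {poly R} -> A} :=
  horner_morph (mulrC_rmorph h a).

Lemma psubstC h a c : psubst h a c%:P = h c.
Proof. exact: horner_morphC. Qed.

Lemma psubstX h a : psubst h a 'X = a.
Proof. exact: horner_morphX. Qed.

Lemma psubstE h a (p : {poly R}) n : (size p <= n)%N ->
  psubst h a p = \sum_(i < n) h p`_i * a ^+ i.
Proof.
move=> le; rewrite -[LHS]/((map_poly h p).[a]) (@horner_coef_wide _ n).
  by apply: eq_bigr => i _; rewrite coef_map.
exact: leq_trans (size_poly _ _) le.
Qed.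

End Substitution.

Section Points.
Context {F : idomainType} {N : nat}.
Implicit Types (A B : idomainType) (phi psi : {mpoly F[N + N]}).

Definition ppt A (f g : {poly A}) (i : 'I_(N + N)) : A :=
  match split i with inl j => f`_j | inr j => g`_j end.

(* The value of phi at the pair of vectors whose coordinates are the
   coefficients of f and g. *)
Definition pev A (io : {rmorphism F -> A}) (f g : {poly A}) :
  {rmorphism {mpoly F[N + N]} -> A} := mmap io (ppt f g).

Lemma pevC A (io : {rmorphism F -> A}) f g c : pev io f g c%:MP = io c.
Proof. exact: mmapC. Qed.

Lemma pev_x A (io : {rmorphism F -> A}) f g i :
  pev io f g 'X_(lshift N i) = f`_i.
Proof.
rewrite [LHS]mmapX mmap1U /ppt.
by case: splitP => j /= e; [congr nth | have := ltn_ord i; rewrite e; lia].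
Qed.

Lemma pev_y A (io : {rmorphism F -> A}) f g i :
  pev io f g 'X_(rshift N i) = g`_i.
Proof.
rewrite [LHS]mmapX mmap1U /ppt.
case: splitP => j /= e; first by have := ltn_ord j; rewrite -e; lia.
by congr nth; apply/eqP; rewrite -(eqn_add2l N) e.
Qed.

Lemma pev_nat A B (io : {rmorphism F -> A}) (io' : {rmorphism F -> B})
    (h : {rmorphism A -> B}) (f g : {poly A}) (f' g' : {poly B}) phi :
  (forall c, h (io c) = io' c) ->
  (forall i, (i < N)%N -> h f`_i = f'`_i) ->
  (forall i, (i < N)%N -> h g`_i = g'`_i) ->
  h (pev io f g phi) = pev io' f' g' phi.
Proof.
move=> hio hf hg; rewrite /pev /= /mmap rmorph_sum; apply: eq_bigr => m _.
rewrite rmorphM hio; congr (_ * _); rewrite /mmap1 rmorph_prod.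
apply: eq_bigr => i _; rewrite rmorphXn /ppt; congr (_ ^+ _).
by case: split => j; [apply: hf | apply: hg].
Qed.

Definition gx K : {poly {mpoly F[N + N]}} :=
  \poly_(i < K) (if insub i is Some j then 'X_(lshift N j) else 0).
Definition gy K : {poly {mpoly F[N + N]}} :=
  \poly_(i < K) (if insub i is Some j then 'X_(rshift N j) else 0).

Lemma size_gx K : (size (gx K) <= K)%N. Proof. exact: size_poly. Qed.
Lemma size_gy K : (size (gy K) <= K)%N. Proof. exact: size_poly. Qed.

Lemma pev_gx A (io : {rmorphism F -> A}) (f g : {poly A}) K i :
  (size f <= K)%N -> (i < N)%N -> pev io f g (gx K)`_i = f`_i.
Proof.
move=> sf iN; rewrite coef_poly; case: ltnP => [iK | Ki].
  by rewrite insubT pev_x.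
by rewrite rmorph0 nth_default // (leq_trans sf).
Qed.

Lemma pev_gy A (io : {rmorphism F -> A}) (f g : {poly A}) K i :
  (size g <= K)%N -> (i < N)%N -> pev io f g (gy K)`_i = g`_i.
Proof.
move=> sf iN; rewrite coef_poly; case: ltnP => [iK | Ki].
  by rewrite insubT pev_y.
by rewrite rmorph0 nth_default // (leq_trans sf).
Qed.

Definition gen : {rmorphism F -> {mpoly F[N + N]}} := @mpolyC (N + N) F.

(* phi with the coordinates of rank at least K (resp. L) set to 0 *)
Definition trunc K L : {rmorphism {mpoly F[N + N]} -> {mpoly F[N + N]}} :=
  pev gen (gx K) (gy L).

Lemma pev_trunc A (io : {rmorphism F -> A}) (f g : {poly A}) K L phi :
  (size f <= K)%N -> (size g <= L)%N ->
  pev io f g (trunc K L phi) = pev io f g phi.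
Proof.
move=> sf sg; apply: pev_nat => [c | i iN | i iN]; first exact: pevC.
  exact: pev_gx.
exact: pev_gy.
Qed.

(** Vanishing over every domain is vanishing as a polynomial in the remaining coordinates; vanishing
    at the [F]-points alone would say less over a finite field. *)
Definition law0 K L phi := forall A (io : {rmorphism F -> A}) (f g : {poly A}),
  (size f <= K)%N -> (size g <= L)%N -> pev io f g phi = 0.

Lemma law0P K L phi : law0 K L phi <-> trunc K L phi = 0.
Proof.
split=> [/(_ _ gen _ _ (size_gx K) (size_gy L)) // | e A io f g sf sg].
by rewrite -(pev_trunc io phi sf sg) e rmorph0.
Qed.

(* homogeneity of degree n for the action of s by (s^i, s^j) *)
Definition hom K L i j n phi := forall A (io : {rmorphism F -> A}) s (f g : {poly A}),
  (size f <= K)%N -> (size g <= L)%N ->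
  pev io (s ^+ i *: f) (s ^+ j *: g) phi = s ^+ n * pev io f g phi.

(** The identity is tested at the generic pair scaled by an indeterminate. If [e] exceeds [n],
    cancelling ['X ^+ n] and setting ['X] to 0 kills the truncation; otherwise ['X ^+ e] is
    cancelled and ['X] is specialised to [s]. *)
Lemma hom_cancel_gen K L i j n e phi :
  'X ^+ e * pev (polyC \o gen) ('X ^+ i *: map_poly polyC (gx K))
    ('X ^+ j *: map_poly polyC (gy L)) phi = 'X ^+ n * (trunc K L phi)%:P ->
  law0 K L phi \/ (e <= n)%N /\ hom K L i j (n - e) phi.
Proof.
pose P := {mpoly F[N + N]}; set Q := pev _ _ _ _.
have [en | ne] := leqP e n; last first.
  move=> E; left; apply/law0P; apply: polyC_inj.
  have : 'X ^+ n * ('X ^+ (e - n) * Q) = 'X ^+ n * (trunc K L phi)%:P :> {poly P}.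
    by rewrite mulrA -exprD subnKC // ltnW.
  move/(mulfI (expf_neq0 _ (polyX_nz _))).
  move/(congr1 (fun p : {poly P} => (p.[0])%:P)); rewrite hornerC => <-.
  by rewrite hornerM hornerXn expr0n subn_eq0 leqNgt ne mul0r.
move=> E; right; split=> // A io s f g sf sg.
have {}E : Q = 'X ^+ (n - e) * (trunc K L phi)%:P.
  apply: (mulfI (expf_neq0 e (polyX_nz _))).
  by rewrite mulrA -exprD subnKC.
pose h := psubst (pev io f g) s.
have <- : h Q = pev io (s ^+ i *: f) (s ^+ j *: g) phi.
  apply: pev_nat => [c | k kN | k kN]; first by rewrite /h psubstC /= pevC.
    rewrite !coefZ coef_map rmorphM rmorphXn /= [in h 'X]/h psubstX.
    by rewrite [h _]psubstC pev_gx.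
  rewrite !coefZ coef_map rmorphM rmorphXn /= [in h 'X]/h psubstX.
  by rewrite [h _]psubstC pev_gy.
by rewrite E rmorphM rmorphXn [h 'X]psubstX [h _%:P]psubstC pev_trunc.
Qed.

Lemma pev_polyC A (io : {rmorphism F -> A}) (f g : {poly A}) phi :
  pev (polyC \o io) (map_poly polyC f) (map_poly polyC g) phi =
  (pev io f g phi)%:P.
Proof. by symmetry; apply: pev_nat => [c|i _|i _] //=; rewrite coef_map. Qed.

Lemma hom_cancel K L i j n e phi :
  (forall A (io : {rmorphism F -> A}) s (f g : {poly A}),
    (size f <= K)%N -> (size g <= L)%N ->
    s ^+ e * pev io (s ^+ i *: f) (s ^+ j *: g) phi = s ^+ n * pev io f g phi) ->
  law0 K L phi \/ (e <= n)%N /\ hom K L i j (n - e) phi.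
Proof.
move=> H; apply: hom_cancel_gen; rewrite H ?pev_polyC //.
  exact: leq_trans (size_poly _ _) (size_gx _).
exact: leq_trans (size_poly _ _) (size_gy _).
Qed.

Lemma hom0 K L i j n phi : law0 K L phi -> hom K L i j n phi.
Proof.
move=> z A io s f g sf sg; rewrite !z ?mulr0 //.
  by apply: leq_trans sf; apply: size_scale_leq.
by apply: leq_trans sg; apply: size_scale_leq.
Qed.

Lemma homB K L i j n phi psi :
  hom K L i j n phi -> hom K L i j n psi -> hom K L i j n (phi - psi).
Proof. by move=> H H' A io s f g sf sg; rewrite !rmorphB H ?H' // mulrBr. Qed.

Definition shinv K phi := forall A (io : {rmorphism F -> A}) t (f g : {poly A}),
  (size f <= K)%N -> (size g <= K)%N ->
  pev io f (g + t *: f) phi = pev io f g phi.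

End Points.

#[global] Opaque pev psubst.
Arguments hom {F N} K L i j n phi.
Arguments gen {F N}.

Section MorePoly.

Lemma coef_psubst_scale (R B : idomainType) (h : {rmorphism R -> B}) (u : B)
    (q : {poly R}) e :
  (psubst (polyC \o h) (u *: 'X) q)`_e = u ^+ e * h q`_e.
Proof.
rewrite (@psubstE _ _ _ _ _ (maxn (size q) e.+1)) ?leq_maxl // coef_sum.
have lt_e : (e < maxn (size q) e.+1)%N by rewrite leq_maxr.
rewrite (bigD1 (Ordinal lt_e)) //= big1 => [|i ne].
  by rewrite addr0 coefCM exprZn coefZ coefXn eqxx mulr1 mulrC.
rewrite coefCM exprZn coefZ coefXn; case: eqP => [ei | _]; last by rewrite !mulr0.
by case/eqP: ne; apply: val_inj.
Qed.

Lemma coef_sumX (B : idomainType) J (c : B) (G : nat -> B) j : (j < J)%N ->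
  (\sum_(i < J) (c *: 'X) ^+ i * (G i)%:P)`_j = c ^+ j * G j.
Proof.
move=> jJ; rewrite coef_sum (bigD1 (Ordinal jJ)) //= big1 => [|i ne].
  by rewrite addr0 coefMC exprZn coefZ coefXn eqxx mulr1.
rewrite coefMC exprZn coefZ coefXn; case: eqP => [ji|_]; last by rewrite mulr0 mul0r.
by case/eqP: ne; apply: val_inj.
Qed.

Lemma size_map_polyC (B : idomainType) M (p : {poly B}) :
  (size p <= M)%N -> (size (map_poly polyC p) <= M)%N.
Proof. by apply: leq_trans; apply: size_poly. Qed.

Lemma size_addZ (B : idomainType) M t (p q : {poly B}) :
  (size p <= M)%N -> (size q <= M)%N -> (size (p + t *: q)%R <= M)%N.
Proof.
move=> sp sq; apply: leq_trans (size_polyD _ _) _; rewrite geq_max sp.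
by apply: leq_trans sq; apply: size_scale_leq.
Qed.

Lemma size_addZXn (B : idomainType) K (a : B) (p : {poly B}) :
  (size p <= K)%N -> (size (p + a *: 'X^K)%R <= K.+1)%N.
Proof.
move=> sp; apply: leq_trans (size_polyD _ _) _; rewrite geq_max.
rewrite (leq_trans sp) //; apply: leq_trans (size_scale_leq _ _) _.
by rewrite size_polyXn.
Qed.

End MorePoly.

Section Expansion.
Context {F : idomainType} {N : nat}.
Implicit Types (A B : idomainType) (phi psi : {mpoly F[N + N]}).
Local Notation P := {mpoly F[N + N]}.

(** With t an indeterminate over [A] the sum is a polynomial in t, all of whose coefficients vanish;
    [A] itself may have too few elements for this. *)
Lemma sum_coef0 K L J (psi_ : nat -> P) :
  (forall A (io : {rmorphism F -> A}) t (f g : {poly A}),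
    (size f <= K)%N -> (size g <= L)%N ->
    \sum_(j < J) t ^+ j * pev io f g (psi_ j) = 0) ->
  forall j, (j < J)%N -> law0 K L (psi_ j).
Proof.
move=> H j jJ A io f g sf sg.
have := H _ (polyC \o io : {rmorphism F -> {poly A}}) 'X _ _
  (size_map_polyC sf) (size_map_polyC sg).
move/(congr1 (fun p : {poly A} => p`_j)); rewrite coef0 coef_sum.
rewrite (bigD1 (Ordinal jJ)) //= big1 => [|i ne].
  by rewrite addr0 pev_polyC coefMC coefXn eqxx mul1r.
rewrite pev_polyC coefMC coefXn; case: eqP => [ji | _]; last by rewrite mul0r.
by case/eqP: ne; apply: val_inj.
Qed.

Lemma psubst_ex (R B : idomainType) (h : {rmorphism R -> B}) (u : B) :
  exists H : {rmorphism {poly R} -> {poly B}},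
  [/\ forall c, H c%:P = (h c)%:P, H 'X = u *: 'X &
      forall q e, (H q)`_e = u ^+ e * h q`_e].
Proof.
exists (psubst (polyC \o h) (u *: 'X)); split=> [c||q e].
- exact: psubstC.
- exact: psubstX.
- exact: coef_psubst_scale.
Qed.

(** Introduce a second indeterminate b. Homogeneity of degree p in the first argument gives psi(a b
    f - b g, g) = b^p psi(a f - g, g). The coefficient of a^i in psi(a f - g, g), times b^p, is thus
    divisible by b^i; as it does not involve b, it vanishes for i > p. *)
Lemma hom_deg K p psi (B : idomainType) (io : {rmorphism F -> B}) (f g : {poly B}) :
  hom K K 1 0 p psi -> (size f <= K)%N -> (size g <= K)%N ->
  (size (pev (polyC \o io) ('X *: map_poly polyC f - map_poly polyC g)%R
     (map_poly polyC g) psi) <= p.+1)%N.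
Proof.
move=> hp sf sg; set R := pev _ _ _ _.
apply/leq_sizeP => i lt_pi.
pose io2 : {rmorphism F -> {poly {poly B}}} := polyC \o (polyC \o io).
have [f' f'E sf'] : exists2 f' : {poly {poly {poly B}}},
    (forall i, f'`_i = (f`_i)%:P%:P) & (size f' <= K)%N.
  exists (map_poly polyC (map_poly polyC f)); last by rewrite !size_map_polyC.
  by move=> j; rewrite !coef_map.
have [g' g'E sg'] : exists2 g' : {poly {poly {poly B}}},
    (forall i, g'`_i = (g`_i)%:P%:P) & (size g' <= K)%N.
  exists (map_poly polyC (map_poly polyC g)); last by rewrite !size_map_polyC.
  by move=> j; rewrite !coef_map.
pose T : {poly {poly B}} := pev io2 ('X *: f' - 'X%:P *: g') g' psi.
have [H [HC HX Hc]] := psubst_ex (idfun : {rmorphism {poly B} -> {poly B}}) 'X.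
have [H2 [H2C H2X H2c]] := psubst_ex (polyC : {rmorphism B -> {poly B}}) 1.
have E : H T = 'X%:P ^+ p * H2 R.
  transitivity (pev io2 (('X%:P) ^+ 1 *: ('X *: f' - g')) (('X%:P) ^+ 0 *: g') psi).
    apply: pev_nat => [c | k kN | k kN]; first exact: HC.
      rewrite expr1 [RHS]coefZ !coefB !coefZ rmorphB !rmorphM f'E g'E !HC HX /=.
      by rewrite -mul_polyC mulrBr mulrA.
    by rewrite expr0 scale1r g'E HC.
  rewrite hp //; last first.
    apply: leq_trans (size_polyD _ _) _; rewrite size_polyN geq_max sg'.
    by rewrite (leq_trans (size_scale_leq _ _)).
  congr (_ * _); symmetry; apply: pev_nat => [c|k kN|k kN].
  - exact: H2C.
  - rewrite !coefB !coefZ !coef_map rmorphB rmorphM /= H2X !H2C f'E g'E.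
    by rewrite scale1r.
  - by rewrite coef_map /= H2C g'E.
move/(congr1 (fun q : {poly {poly B}} => q`_i)): E.
rewrite Hc -rmorphXn coefCM H2c expr1n mul1r /= => E.
have {}E : 'X ^+ (i - p) * T`_i = (R`_i)%:P.
  apply: (mulfI (expf_neq0 p (polyX_nz _))).
  by rewrite mulrA -exprD subnKC // ltnW.
have := congr1 (fun q : {poly B} => q.[0]) E; rewrite hornerC => <-.
by rewrite hornerM hornerXn expr0n subn_eq0 leqNgt lt_pi mul0r.
Qed.

(* If psi(f, g + t f) has small degree in t, then psi(a f - g, g), written as
   the value of psi at (a f - g, a f - (a f - g)), is divisible by a high power
   of a, while homogeneity bounds its degree in a. *)
Lemma shift_deg K p q J psi (psi_ : nat -> P) :
  hom K K 1 0 p psi -> hom K K 0 1 q psi ->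
  (forall A (io : {rmorphism F -> A}) t (f g : {poly A}),
    (size f <= K)%N -> (size g <= K)%N ->
    pev io f (g + t *: f) psi = \sum_(j < J) t ^+ j * pev io f g (psi_ j)) ->
  (J + p <= q)%N -> law0 K K psi.
Proof.
move=> hp hq H le_q.
(* Expanding psi(f, s (g + t f)) in powers of t in two ways gives s^j psi_j(f, s g) = s^q psi_j(f,
   g). *)
have hpsi_ j : (j < J)%N -> law0 K K (psi_ j) \/ (j <= q)%N /\ hom K K 0 1 (q - j) (psi_ j).
  move=> jJ; apply: hom_cancel => A io s f g sf sg.
  rewrite expr0 expr1 scale1r.
  pose io1 : {rmorphism F -> {poly A}} := polyC \o io.
  pose up (q : {poly A}) : {poly {poly A}} := map_poly polyC q.
  have sf1 : (size (up f) <= K)%N by apply: size_map_polyC.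
  have sg1 : (size (up g) <= K)%N by apply: size_map_polyC.
  have := hq _ io1 s%:P (up f) (up g + 'X *: up f) sf1 (size_addZ _ sg1 sf1).
  rewrite expr0 expr1 scale1r H // scalerDr scalerA H //; last first.
    by rewrite (leq_trans (size_scale_leq _ _)).
  have -> : s%:P *: up g = up (s *: g) by rewrite /up map_polyZ.
  rewrite mul_polyC -rmorphXn mul_polyC.
  under eq_bigr do rewrite pev_polyC.
  under [in RHS]eq_bigr do rewrite pev_polyC -['X]scale1r.
  move/(congr1 (fun p : {poly A} => p`_j)).
  rewrite coefZ (coef_sumX _ (fun i => pev io f (s *: g) (psi_ i))) //.
  by rewrite (coef_sumX _ (fun i => pev io f g (psi_ i))) // expr1n mul1r.
(* With f = f0 + g, the value of psi(a f - g, g) at a = 1 is psi(f0, g): it is enough that [R]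
   vanishes as a polynomial in a. *)
move=> A io f0 g sf0 sg; pose f := f0 + g.
have sf : (size f <= K)%N.
  by apply: leq_trans (size_polyD _ _) _; rewrite geq_max sf0.
pose up (q : {poly A}) : {poly {poly A}} := map_poly polyC q.
pose io1 : {rmorphism F -> {poly A}} := polyC \o io.
pose f1 := 'X *: up f - up g.
pose R := pev io1 f1 (up g) psi.
have sx : (size (up f) <= K)%N by rewrite size_map_polyC.
have sy : (size (up g) <= K)%N by rewrite size_map_polyC.
have sf1 : (size f1 <= K)%N.
  apply: leq_trans (size_polyD _ _) _; rewrite size_polyN geq_max sy.
  by rewrite (leq_trans (size_scale_leq _ _)).
have R0 : R = 0.
  apply/polyP => i; rewrite coef0.
  have [le_ip | lt_pi] := leqP i p.
    have -> : R = pev io1 f1 ('X *: up f + (-1) *: f1) psi.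
      by rewrite scaleN1r /f1 subKr.
    rewrite H //; last by rewrite (leq_trans (size_scale_leq _ _)).
    rewrite coef_sum big1 // => j _.
    have [z | [jq h]] := hpsi_ j (ltn_ord j).
      by rewrite z ?mulr0 ?coef0 // (leq_trans (size_scale_leq _ _)).
    have := h _ io1 'X f1 _ sf1 sx; rewrite expr0 expr1 scale1r => ->.
    rewrite mulrA [X in X * _]mulrC -mulrA coefXnM ifT //.
    by have := ltn_ord j; lia.
  by have /leq_sizeP := hom_deg io hp sf sg; apply.
have <- : psubst idfun 1 R = pev io f0 g psi.
  apply: pev_nat => [c|i iN|i iN].
  - exact: psubstC.
  - rewrite coefB coefZ !coef_map rmorphB rmorphM psubstX /=.
    by rewrite !psubstC mul1r coefD /= addrK.
  - by rewrite coef_map psubstC.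
by rewrite R0 rmorph0.
Qed.

End Expansion.

(** * Shift invariants of two vectors *)

Section Tableaux.
Context {F : idomainType}.
(** Bideterminants of two-row shape, without any standardness condition: each pair in [T.1] is a
    column of length 2, each index in [T.2] a column of length 1. *)
Definition tabv (A : idomainType) (f g : {poly A}) (T : seq (nat * nat) * seq nat) : A :=
  \prod_(p <- T.1) (f`_p.1 * g`_p.2 - f`_p.2 * g`_p.1) * \prod_(q <- T.2) f`_q.

Definition tabok K n m (T : seq (nat * nat) * seq nat) :=
  [&& size T.1 == m, size T.2 == (n - m)%N,
      all (fun p => (p.1 < K) && (p.2 < K))%N T.1 & all (fun q => q < K)%N T.2].

Definition tabval (A : idomainType) (io : {rmorphism F -> A}) (f g : {poly A})
  (L : seq (F * (seq (nat * nat) * seq nat))) : A :=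
  \sum_(c <- L) io c.1 * tabv f g c.2.

Lemma tabv_nat (A B : idomainType) (h : {rmorphism A -> B}) (f g : {poly A}) (f' g' : {poly B}) T :
  (forall i, h f`_i = f'`_i) -> (forall i, h g`_i = g'`_i) ->
  h (tabv f g T) = tabv f' g' T.
Proof.
move=> hf hg; rewrite /tabv rmorphM !rmorph_prod; congr (_ * _).
  by apply: eq_bigr => p _; rewrite rmorphB !rmorphM !hf !hg.
by apply: eq_bigr => q _; rewrite hf.
Qed.

Lemma tabval_nat (A B : idomainType) (h : {rmorphism A -> B})
    (io : {rmorphism F -> A}) (io' : {rmorphism F -> B}) (f g : {poly A}) (f' g' : {poly B}) L :
  (forall c, h (io c) = io' c) ->
  (forall i, h f`_i = f'`_i) -> (forall i, h g`_i = g'`_i) ->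
  h (tabval io f g L) = tabval io' f' g' L.
Proof.
move=> hio hf hg; rewrite /tabval rmorph_sum; apply: eq_bigr => c _.
by rewrite rmorphM hio (tabv_nat _ hf hg).
Qed.

Lemma tabval_cat (A : idomainType) (io : {rmorphism F -> A}) (f g : {poly A}) L L' :
  tabval io f g (L ++ L') = tabval io f g L + tabval io f g L'.
Proof. by rewrite /tabval big_cat. Qed.

Context {N : nat}.
Local Notation P := {mpoly F[N + N]}.

Definition tabpoly L : P := tabval gen (gx N) (gy N) L.

Lemma pev_tabpoly (A : idomainType) (io : {rmorphism F -> A}) (f g : {poly A}) L :
  (size f <= N)%N -> (size g <= N)%N ->
  pev io f g (tabpoly L) = tabval io f g L.
Proof.
move=> sf sg; apply: tabval_nat => [c|i|i]; first exact: pevC.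
  have [iN | Ni] := ltnP i N; first exact: pev_gx.
  by rewrite coef_poly ltnNge Ni rmorph0 nth_default // (leq_trans sf).
have [iN | Ni] := ltnP i N; first exact: pev_gy.
by rewrite coef_poly ltnNge Ni rmorph0 nth_default // (leq_trans sg).
Qed.

Definition tabspan K n m (phi : P) :=
  exists2 L, all (fun c => tabok K n m c.2) L &
    forall (A : idomainType) (io : {rmorphism F -> A}) (f g : {poly A}),
      (size f <= K)%N -> (size g <= K)%N -> pev io f g phi = tabval io f g L.

Lemma tabv_scale (A : idomainType) K n m s t (f g : {poly A}) T :
  tabok K n m T -> (m <= n)%N ->
  tabv (s *: f) (t *: g) T = s ^+ n * t ^+ m * tabv f g T.
Proof.
case/and4P => /eqP s1 /eqP s2 _ _ le_mn; rewrite /tabv.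
under eq_bigr do rewrite !coefZ.
rewrite (eq_bigr (fun p => (s * t) * (f`_p.1 * g`_p.2 - f`_p.2 * g`_p.1))); last first.
  by move=> p _; ring.
rewrite !big_split /= !big_const_seq !iter_mulr_1 !count_predT.
under [X in _ * X]eq_bigr do rewrite coefZ.
rewrite big_split /= big_const_seq iter_mulr_1 count_predT s1 s2.
by rewrite -[in s ^+ n](subnKC le_mn) exprD; ring.
Qed.

Lemma tabv_shift (A : idomainType) t (f g : {poly A}) T :
  tabv f (g + t *: f) T = tabv f g T.
Proof.
rewrite /tabv; congr (_ * _); apply: eq_bigr => p _; rewrite !coefD !coefZ.
by ring.
Qed.

Lemma tabval_hom (A : idomainType) (io : {rmorphism F -> A}) K n m s t (f g : {poly A}) L :
  all (fun c => tabok K n m c.2) L -> (m <= n)%N ->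
  tabval io (s *: f) (t *: g) L = s ^+ n * t ^+ m * tabval io f g L.
Proof.
move=> /allP okL le_mn; rewrite /tabval mulr_sumr big_seq [in RHS]big_seq.
apply: eq_bigr => c cL; rewrite (tabv_scale _ _ _ _ (okL _ cL)) //.
by rewrite mulrCA.
Qed.

End Tableaux.

Section Lift.
Context {F : idomainType} (K e n m I : nat).
(* I of the factors of T become minors with the index K, and e further factors
   of index K are added. *)
Definition tab_lift (T : seq (nat * nat) * seq nat) : seq (nat * nat) * seq nat :=
  (T.1 ++ [seq (q, K) | q <- take I T.2], drop I T.2 ++ nseq e K).

Lemma tab_lift_ok T : (I <= m)%N -> (m + e <= n)%N -> 
  tabok K (n - e)%N (m - I)%N T -> tabok K.+1 n m (tab_lift T).
Proof.
move=> Im le /and4P[/eqP s1 /eqP s2 /allP a1 /allP a2].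
rewrite /tabok /tab_lift /= !size_cat size_map size_take size_drop size_nseq s1 s2.
apply/and4P; split.
- by case: ltnP => ?; apply/eqP; lia.
- by apply/eqP; lia.
- rewrite all_cat; apply/andP; split.
    by apply/allP => p /a1 /andP[? ?]; apply/andP; split; apply: leqW.
  apply/allP => _ /mapP[q /mem_take /a2 qK ->] /=.
  by rewrite ltnSn andbT; apply: leqW.
- rewrite all_cat all_nseq ltnSn orbT andbT.
  by apply/allP => q /mem_drop /a2 qK; apply: leqW.
Qed.

(** The minor on the indices [q] and [K] becomes f_q ['X] - a g_q, whose leading coefficient in ['X]
    is f_q. Lifting a tableau thus multiplies it by a^e ['X^I], up to terms of lower degree in
    ['X]. *)
Lemma tab_lift_val (B : idomainType) (f g : {poly B}) (a : B) T :
  (size f <= K)%N -> (size g <= K)%N -> (I <= size T.2)%N ->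
  all (fun p => (p.1 < K) && (p.2 < K))%N T.1 -> all (fun q => q < K)%N T.2 ->
  exists2 r : {poly B}, (size r <= I)%N &
  tabv (map_poly polyC f + a%:P *: 'X^K) (map_poly polyC g + 'X *: 'X^K) (tab_lift T) =
  (a ^+ e * tabv f g T) *: 'X^I + r.
Proof.
move=> sf sg le_I /allP a1 /allP a2.
set f1 := (_ + a%:P *: _); set g1 := (_ + _).
have f1l q : (q < K)%N -> f1`_q = (f`_q)%:P.
  by move=> qK; rewrite coefD coefZ coefXn coef_map ltn_eqF // mulr0 addr0.
have g1l q : (q < K)%N -> g1`_q = (g`_q)%:P.
  by move=> qK; rewrite coefD coefZ coefXn coef_map ltn_eqF // mulr0 addr0.
have f1K : f1`_K = a%:P.
  by rewrite coefD coefZ coefXn coef_map eqxx mulr1 /= nth_default ?rmorph0 ?add0r.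
have g1K : g1`_K = 'X.
  by rewrite coefD coefZ coefXn coef_map eqxx mulr1 /= nth_default ?rmorph0 ?add0r.
have key : forall s, {subset s <= T.2} -> exists2 r : {poly B}, (size r <= size s)%N &
    \prod_(p <- [seq (q, K) | q <- s]) (f1`_p.1 * g1`_p.2 - f1`_p.2 * g1`_p.1) =
    (\prod_(q <- s) f`_q) *: 'X^(size s) + r.
  elim=> [|q s IHs] sT.
    by exists 0; rewrite ?size_poly0 // !big_nil scale1r addr0 expr0.
  have [|r sr E] := IHs; first by move=> x xs; apply: sT; rewrite inE xs orbT.
  rewrite /= !big_cons E /= f1K g1K f1l ?g1l ?a2 ?sT ?mem_head //.
  exists ((f`_q)%:P * 'X * r - (a * g`_q)%:P * ((\prod_(q <- s) f`_q) *: 'X^(size s) + r)).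
    apply: leq_trans (size_polyD _ _) _; rewrite size_polyN geq_max !mul_polyC.
    rewrite -scalerAl; apply/andP; split.
      apply: leq_trans (size_scale_leq _ _) _; rewrite mulrC.
      by apply: leq_trans (size_polyMleq _ _) _; rewrite size_polyX addnS addn1 ltnS.
    apply: leq_trans (size_scale_leq _ _) _; apply: leq_trans (size_polyD _ _) _.
    rewrite geq_max (leq_trans sr) // andbT (leq_trans (size_scale_leq _ _)) //.
    by rewrite size_polyXn.
  by rewrite -!mul_polyC !rmorphM exprS; ring.
have [|r sr E] := key (take I T.2); first by move=> x /mem_take.
rewrite size_take_min (minn_idPl le_I) in sr E.
rewrite /tabv /tab_lift /= !big_cat /= E.
pose c1 := \prod_(p <- T.1) (f`_p.1 * g`_p.2 - f`_p.2 * g`_p.1).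
have -> : \prod_(p <- T.1) (f1`_p.1 * g1`_p.2 - f1`_p.2 * g1`_p.1) = c1%:P.
  rewrite rmorph_prod big_seq [RHS]big_seq; apply: eq_bigr => p /a1/andP[p1 p2].
  by rewrite !f1l ?g1l // rmorphB !rmorphM.
pose c2 := \prod_(q <- drop I T.2) f`_q.
have -> : \prod_(q <- drop I T.2) f1`_q = c2%:P.
  rewrite rmorph_prod big_seq [RHS]big_seq; apply: eq_bigr => q /mem_drop/a2 qK.
  by rewrite f1l.
rewrite big_nseq f1K iter_mulr_1.
exists ((c1 * c2 * a ^+ e) *: r); first by rewrite (leq_trans (size_scale_leq _ _)).
have -> : \prod_(q <- T.2) f`_q = \prod_(q <- take I T.2) f`_q * c2.
  by rewrite -big_cat cat_take_drop.
rewrite -/c1.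
by rewrite -!mul_polyC !rmorphM rmorphXn; ring.
Qed.
End Lift.

(** * Expansion in the top coordinates of the two vectors *)

Section DoubleCoef.

Definition coef2 (B : idomainType) (q : {poly {poly B}}) i e : B := (q`_i)`_e.

Lemma coef2C (B : idomainType) (c : B) q i e : coef2 (c%:P%:P * q) i e = c * coef2 q i e.
Proof. by rewrite /coef2 !coefCM. Qed.

Lemma coef_shift (B : idomainType) (w : B) (p : {poly B}) J :
  (size p <= J.+1)%N -> (p \Po ('X + w%:P))`_J = p`_J.
Proof.
have s2 : size ('X + w%:P) = 2%N by rewrite size_XaddC.
rewrite leq_eqVlt => /orP[/eqP sp | lt]; last first.
  by rewrite !nth_default // size_comp_poly2.
have := lead_coef_comp p (q := 'X + w%:P).
rewrite s2 lead_coefXaddC expr1n mulr1 => /(_ isT).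
by rewrite /lead_coef size_comp_poly2 // sp.
Qed.

Lemma coef2_shift (B : idomainType) w (q : {poly {poly B}}) J e :
  (size q <= J.+1)%N -> coef2 (q \Po ('X + w%:P)) J e = coef2 q J e.
Proof. by move=> sq; rewrite /coef2 coef_shift. Qed.

Lemma coef2_horner0 (B : idomainType) (q : {poly {poly B}}) e :
  (q.[0])`_e = coef2 q 0 e.
Proof. by rewrite horner_coef0. Qed.

Lemma coef2_horner (B : idomainType) (t : B) (q : {poly {poly B}}) J e :
  (size q <= J.+1)%N ->
  (q.[- t *: 'X])`_e =
  \sum_(j < J.+1) (if (j <= e)%N then (- t) ^+ j * coef2 q j (e - j) else 0).
Proof.
move=> sq; rewrite (horner_coef_wide _ sq) coef_sum; apply: eq_bigr => j _.
rewrite exprZn -scalerAr coefZ coefMXn ltnNge.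
by case: leqP => _ //=; rewrite mulr0.
Qed.

Lemma map2_ex (R B : idomainType) (h : {rmorphism R -> B}) :
  exists H : {rmorphism {poly {poly R}} -> {poly {poly B}}},
  [/\ forall c, H c%:P%:P = (h c)%:P%:P, H 'X%:P = 'X%:P, H 'X = 'X &
      forall q i e, coef2 (H q) i e = h (coef2 q i e)].
Proof.
exists (map_poly (map_poly h)); split=> [c|||q i e] /=.
- by rewrite map_polyC /= map_polyC.
- by rewrite map_polyC /= map_polyX.
- by rewrite map_polyX.
- by rewrite /coef2 !coef_map.
Qed.

Lemma psubst2_ex (B : idomainType) (u v : B) :
  exists H : {rmorphism {poly {poly B}} -> {poly {poly B}}},
  [/\ forall c, H c%:P%:P = c%:P%:P, H 'X%:P = (u *: 'X)%:P, H 'X = v%:P *: 'X &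
      forall q i e, coef2 (H q) i e = v ^+ i * u ^+ e * coef2 q i e].
Proof.
have [h [hC hX hc]] := psubst_ex (idfun : {rmorphism B -> B}) u.
have [H [HC HX Hc]] := psubst_ex h v%:P.
exists H; split=> [c||//|q i e]; first by rewrite HC hC.
  by rewrite HC hX.
by rewrite /coef2 Hc -rmorphXn coefCM hc mulrA.
Qed.

Lemma comp2_ex (B : idomainType) (w : {poly B}) :
  exists H : {rmorphism {poly {poly B}} -> {poly {poly B}}},
  [/\ forall c, H c%:P = c%:P, H 'X = 'X + w%:P &
      forall (q : {poly {poly B}}) J e, (size q <= J.+1)%N -> coef2 (H q) J e = coef2 q J e].
Proof.
exists (comp_poly ('X + w%:P)); split=> [c||q J e sq] /=.
- exact: comp_polyC.
- exact: comp_polyX.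
- exact: coef2_shift.
Qed.

Lemma horner_ex (B : idomainType) (w : B) :
  exists H : {rmorphism {poly B} -> B},
  [/\ forall c, H c%:P = c, H 'X = w & forall q : {poly B}, H q = q.[w]].
Proof.
exists (horner_eval w); split=> [c||q] //=; rewrite /horner_eval.
  exact: hornerC.
exact: hornerX.
Qed.

End DoubleCoef.

Section TopExpansion.
Context {F : idomainType} {N : nat} (K : nat) (ltKN : (K < N)%N).
Implicit Types (A B : idomainType) (phi psi : {mpoly F[N + N]}).
Local Notation P := {mpoly F[N + N]}.

Definition addtop B (f : {poly B}) (a : {poly {poly B}}) : {poly {poly {poly B}}} :=
  map_poly polyC (map_poly polyC f) + a *: 'X^K.

Lemma coef_addtop B (f : {poly B}) a i :
  (addtop f a)`_i = (f`_i)%:P%:P + a * (i == K)%:R.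
Proof. by rewrite coefD coefZ coefXn !coef_map. Qed.

Lemma size_addtop B (f : {poly B}) a : (size f <= K)%N -> (size (addtop f a) <= K.+1)%N.
Proof. by move=> sf; apply: size_addZXn; rewrite !size_map_polyC. Qed.

(** Write x for the inner and y for the outer indeterminate: this is phi at (f + x X^K, g + y X^K),
    and [coef2] with indices i, e extracts the coefficient of y^i x^e. *)
Definition topexp B (io : {rmorphism F -> B}) (f g : {poly B}) :
  {rmorphism {mpoly F[N + N]} -> {poly {poly B}}} :=
  pev (polyC \o (polyC \o io)) (addtop f 'X%:P) (addtop g 'X).

Lemma topexp_nat B A (io : {rmorphism F -> B}) (f g : {poly B})
    (io' : {rmorphism F -> A}) (f' g' : {poly A}) (H : {rmorphism {poly {poly B}} -> A}) phi :
  (forall c, H (io c)%:P%:P = io' c) ->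
  (forall i, (i < N)%N -> H (f`_i)%:P%:P + H 'X%:P * (i == K)%:R = f'`_i) ->
  (forall i, (i < N)%N -> H (g`_i)%:P%:P + H 'X * (i == K)%:R = g'`_i) ->
  H (topexp io f g phi) = pev io' f' g' phi.
Proof.
move=> hio hf hg; apply: pev_nat => [c|i iN|i iN]; first exact: hio.
  by rewrite coef_addtop rmorphD rmorphM rmorph_nat hf.
by rewrite coef_addtop rmorphD rmorphM rmorph_nat hg.
Qed.

#[local] Opaque topexp.

Definition tcoef phi i e : P := coef2 (topexp gen (gx K) (gy K) phi) i e.

Lemma tcoefE phi i e : tcoef phi i e = coef2 (topexp gen (gx K) (gy K) phi) i e.
Proof. by []. Qed.

Lemma topexp_coef B (io : {rmorphism F -> B}) (f g : {poly B}) phi i e :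
  (size f <= K)%N -> (size g <= K)%N ->
  coef2 (topexp io f g phi) i e = pev io f g (tcoef phi i e).
Proof.
move=> sf sg; have [H [HC HaX HX Hc]] := map2_ex (@pev F N _ io f g).
rewrite -Hc; suff -> : H (topexp gen (gx K) (gy K) phi) = topexp io f g phi by [].
apply: topexp_nat => [c|i0 iN|i0 iN].
- by rewrite HC pevC.
- by rewrite coef_addtop HC HaX pev_gx.
- by rewrite coef_addtop HC HX pev_gy.
Qed.

Lemma tcoef_hom phi i0 j0 n i e : hom K.+1 K.+1 i0 j0 n phi ->
  law0 K K (tcoef phi i e) \/
  (i0 * e + j0 * i <= n)%N /\ hom K K i0 j0 (n - (i0 * e + j0 * i)) (tcoef phi i e).
Proof.
move=> hphi; apply: hom_cancel => B io s f g sf sg.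
have [H [HC HaX HX Hc]] := psubst2_ex (s ^+ i0) (s ^+ j0).
have sf' : (size (s ^+ i0 *: f) <= K)%N by apply: leq_trans sf; apply: size_scale_leq.
have sg' : (size (s ^+ j0 *: g) <= K)%N by apply: leq_trans sg; apply: size_scale_leq.
have E : H (topexp io (s ^+ i0 *: f) (s ^+ j0 *: g) phi) = s%:P%:P ^+ n * topexp io f g phi.
  rewrite -hphi ?size_addtop //; apply: topexp_nat => [c|i1 _|i1 _].
  - exact: HC.
  - by rewrite HC HaX !coefZ coef_addtop -mul_polyC !rmorphM !rmorphXn; ring.
  - by rewrite HC HX !coefZ coef_addtop -mul_polyC !rmorphM !rmorphXn; ring.
have := congr1 (fun q : {poly {poly B}} => coef2 q i e) E.
rewrite Hc -!rmorphXn coef2C (topexp_coef _ _ _ _ sf' sg') (topexp_coef _ _ _ _ sf sg) => <-.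
by rewrite -!exprM -exprD [(j0 * i + _)%N]addnC.
Qed.

#[local] Opaque tcoef.

Section Induction.
Variables (phi : P) (J : nat).
Hypothesis inv : shinv K.+1 phi.
Hypothesis szJ : forall B (io : {rmorphism F -> B}) (f g : {poly B}),
  (size f <= K)%N -> (size g <= K)%N -> (size (topexp io f g phi) <= J.+1)%N.

(** The shift sends the top coordinates (x, y) to (x, y + t x), and the substitution y -> y + t x
    leaves the coefficient of the highest power of y unchanged. *)
Lemma tcoef_top_inv e : shinv K (tcoef phi J e).
Proof.
move=> B io t f g sf sg.
have sgt : (size (g + t *: f)%R <= K)%N by apply: size_addZ.
rewrite -(topexp_coef io phi J e sf sgt) -(topexp_coef io phi J e sf sg).
pose w : {poly B} := t *: 'X.
have [H [HC HX Hc]] := comp2_ex w.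
suff E : H (topexp io f (g + t *: f) phi) = topexp io f g phi.
  by rewrite -(Hc _ _ _ (szJ io sf sgt)) E.
have <- : pev (polyC \o (polyC \o io)) (addtop f 'X%:P)
   (addtop g 'X + t%:P%:P *: addtop f 'X%:P) phi = topexp io f g phi.
  exact: inv (size_addtop _ sf) (size_addtop _ sg).
apply: topexp_nat => [c|i _|i _].
- exact: HC.
- by rewrite !HC coef_addtop.
- rewrite HC HX coefD [in RHS]coefD [in RHS]coefZ !coef_addtop coefZ.
  by rewrite /w -mul_polyC !rmorphD !rmorphM; ring.
Qed.

(** At y = 0 the shifted pair (f + x X^K, g + t f) is the shift by t of (f + x X^K, g - t x X^K).
    Its value is therefore the expansion of phi at y = - t x, a polynomial in t of degree at most
    J. *)
Lemma tcoef_shift_expand e A (io : {rmorphism F -> A}) t (f g : {poly A}) :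
  (size f <= K)%N -> (size g <= K)%N ->
  pev io f (g + t *: f) (tcoef phi 0 e) =
  \sum_(j < J.+1) t ^+ j *
    pev io f g (if (j <= e)%N then (-1) ^+ j * tcoef phi j (e - j) else 0).
Proof.
move=> sf sg; have sgt : (size (g + t *: f)%R <= K)%N by apply: size_addZ.
pose w : {poly A} := - t *: 'X.
have [H0 [H0C H0X H0E]] := horner_ex (0 : {poly A}).
have [H [HC HX HE]] := horner_ex w.
have sfC : (size (map_poly polyC f + 'X *: 'X^K)%R <= K.+1)%N.
  by rewrite size_addZXn ?size_map_polyC.
have sgC : (size (map_poly polyC g + w *: 'X^K)%R <= K.+1)%N.
  by rewrite size_addZXn ?size_map_polyC.
have E : H0 (topexp io f (g + t *: f) phi) = H (topexp io f g phi).
  transitivity (pev (polyC \o io) (map_poly polyC f + 'X *: 'X^K)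
     (map_poly polyC g + w *: 'X^K + t%:P *: (map_poly polyC f + 'X *: 'X^K)) phi).
    apply: topexp_nat => [c|i _|i _].
    - exact: H0C.
    - by rewrite !H0C coefD coefZ coefXn coef_map.
    - rewrite H0C H0X mul0r addr0 !coefD !coefZ coefD !coefZ coefXn.
      by rewrite !coef_map /= /w -mul_polyC rmorphD rmorphM rmorphN; ring.
  rewrite (inv _ _ sfC sgC); symmetry.
  apply: topexp_nat => [c|i _|i _].
  - exact: HC.
  - by rewrite !HC coefD coefZ coefXn coef_map.
  - by rewrite HC HX coefD coefZ coefXn coef_map.
rewrite H0E HE in E.
have := congr1 (fun q : {poly A} => q`_e) E.
rewrite coef2_horner0 (topexp_coef _ _ _ _ sf sgt) => ->.
rewrite (coef2_horner _ _ (szJ io sf sg)); apply: eq_bigr => j _.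
case: leqP => _ /=; last by rewrite rmorph0 mulr0.
by rewrite (topexp_coef _ _ _ _ sf sg) rmorphM rmorphXn rmorphN1 exprNn; ring.
Qed.

End Induction.

End TopExpansion.

#[local] Opaque topexp tcoef.

(** * Shift invariants: induction on the number of coordinates *)

Section FFT.
Context {F : idomainType} {N : nat}.
Implicit Types (A B : idomainType) (phi psi : {mpoly F[N + N]}).
Local Notation P := {mpoly F[N + N]}.

Section Step.
Variables (K n m : nat) (ltKN : (K < N)%N) (le_mn : (m <= n)%N).
Hypothesis IH : forall n' m' psi, (m' <= n')%N ->
  hom K K 1 0 n' psi -> hom K K 0 1 m' psi -> shinv K psi -> tabspan K n' m' psi.

Lemma pev_addtop A (io : {rmorphism F -> A}) (f g : {poly A}) phi :
  (size f <= K.+1)%N -> (size g <= K.+1)%N ->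
  exists (H : {rmorphism {poly {poly A}} -> A}) (f' g' : {poly A}),
    [/\ (size f' <= K)%N, (size g' <= K)%N &
        H (topexp K io f' g' phi) = pev io f g phi].
Proof.
move=> sf sg; exists (psubst (psubst idfun f`_K) g`_K), (take_poly K f), (take_poly K g).
split; [exact: size_take_poly | exact: size_take_poly |].
have tE (h : {poly A}) i : (size h <= K.+1)%N ->
    (take_poly K h)`_i + h`_K * (i == K)%:R = h`_i.
  move=> sh; rewrite coef_take_poly; case: ltngtP => [_ | Ki | ->].
  - by rewrite mulr0 addr0.
  - by rewrite mulr0 addr0 nth_default // (leq_trans sh).
  - by rewrite mulr1 add0r.
apply: topexp_nat => [c|i _|i _]; first by rewrite !psubstC.
  by rewrite !psubstC psubstX tE.
by rewrite !psubstC psubstX tE.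
Qed.

Section Top.
Variables (phi : P) (J : nat).
Hypothesis homx : hom K.+1 K.+1 1 0 n phi.
Hypothesis homy : hom K.+1 K.+1 0 1 m phi.
Hypothesis inv : shinv K.+1 phi.
Hypothesis szJ : forall B (io : {rmorphism F -> B}) (f g : {poly B}),
  (size f <= K)%N -> (size g <= K)%N -> (size (topexp K io f g phi) <= J.+1)%N.

(** The coefficient of y^0 x^(e + J) has degree (n - e - J, m), and its expansion under the shift
    has J + 1 terms. As (J + 1) + (n - e - J) <= m, it vanishes by [shift_deg]; the coefficient of
    y^J x^e is, up to sign, its term in t^J. *)
Lemma tcoef_small e : (n < m + e)%N -> law0 K K (tcoef K phi J e).
Proof.
move=> lt_nme.
pose psi_ j := if (j <= e + J)%N then (-1) ^+ j * tcoef K phi j (e + J - j) else 0.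
have ex A (io : {rmorphism F -> A}) t (f g : {poly A}) : (size f <= K)%N -> (size g <= K)%N ->
    pev io f (g + t *: f) (tcoef K phi 0 (e + J)) = \sum_(j < J.+1) t ^+ j * pev io f g (psi_ j).
  exact: (tcoef_shift_expand inv szJ).
have z : law0 K K (tcoef K phi 0 (e + J)).
  have [// | [le_n hx]] := tcoef_hom 0 (e + J) homx.
  have [// | [_ hy]] := tcoef_hom 0 (e + J) homy.
  rewrite !mul0n !mul1n ?addn0 ?subn0 in le_n hx hy.
  by apply: shift_deg hx hy ex _; lia.
have := sum_coef0 (K := K) (L := K) (J := J.+1) (psi_ := psi_).
move=> /(_ _ J (ltnSn J)) z'.
have {}z' : law0 K K (psi_ J).
  apply: z' => A io t f g sf sg.
  by rewrite -(ex _ io t f g sf sg) z // size_addZ.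
move=> A io f g sf sg; have := z' _ io _ _ sf sg.
rewrite /psi_ leq_addl addnK rmorphM rmorphXn rmorphN1 => /eqP.
by rewrite mulf_eq0 signr_eq0 => /eqP.
Qed.

(** The coefficient of y^J x^e is a shift invariant of degree (n - e, m - J) in K coordinates, hence
    a combination of tableaux, and their lifts have this coefficient in front of y^J x^e. The lifted
    shape makes sense only if m + e <= n, which [tcoef_small] guarantees for nonzero
    coefficients. *)
Lemma tcoef_lift e : exists2 L, all (fun c => tabok K.+1 n m c.2) L &
  forall B (io : {rmorphism F -> B}) (f g : {poly B}),
    (size f <= K)%N -> (size g <= K)%N ->
    exists2 r : {poly {poly B}}, (size r <= J)%N &
      tabval (polyC \o (polyC \o io)) (addtop K f 'X%:P) (addtop K g 'X) L =
      ('X ^+ e * (pev io f g (tcoef K phi J e))%:P) *: 'X^J + r.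
Proof.
have triv : law0 K K (tcoef K phi J e) -> exists2 L, all (fun c => tabok K.+1 n m c.2) L &
  forall B (io : {rmorphism F -> B}) (f g : {poly B}),
    (size f <= K)%N -> (size g <= K)%N ->
    exists2 r : {poly {poly B}}, (size r <= J)%N &
      tabval (polyC \o (polyC \o io)) (addtop K f 'X%:P) (addtop K g 'X) L =
      ('X ^+ e * (pev io f g (tcoef K phi J e))%:P) *: 'X^J + r.
  move=> z; exists [::] => // B io f g sf sg; exists 0; first by rewrite size_poly0.
  by rewrite /tabval big_nil z // mulr0 scale0r addr0.
have [/tcoef_small // | le_men] := ltnP n (m + e).
have [// | [_ hx]] := tcoef_hom J e homx.
have [// | [le_J hy]] := tcoef_hom J e homy.
rewrite !mul0n !mul1n ?addn0 ?add0n in le_J hx hy.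
have le_mn' : (m - J <= n - e)%N by lia.
have [L okL LE] := IH le_mn' hx hy (tcoef_top_inv inv szJ e).
exists [seq (c.1, tab_lift K e J c.2) | c <- L].
  rewrite all_map; apply/allP => c cL /=.
  by apply: tab_lift_ok => //; apply: (allP okL).
move=> B io f g sf sg; rewrite LE // /tabval big_map /=.
have : {subset L <= L} by [].
elim: {1 3 4}L => [|c L' IHL'] sub.
  by exists 0; rewrite ?size_poly0 // !big_nil mulr0 scale0r addr0.
have [|r sr E] := IHL'; first by move=> x xL; apply: sub; rewrite inE xL orbT.
have /(allP okL)/and4P[/eqP s1 /eqP s2 a1 a2] := sub _ (mem_head _ _).
have le_J2 : (J <= size c.2.2)%N by rewrite s2; lia.
have [r' sr' E'] := tab_lift_val e 'X (size_map_polyC sf) (size_map_polyC sg) le_J2 a1 a2.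
rewrite !big_cons E E'.
have -> : tabv (map_poly polyC f) (map_poly polyC g) c.2 = (tabv f g c.2)%:P.
  by symmetry; apply: tabv_nat => i; rewrite coef_map.
exists ((io c.1)%:P%:P * r' + r).
  apply: leq_trans (size_polyD _ _) _; rewrite geq_max sr andbT mul_polyC.
  by rewrite (leq_trans (size_scale_leq _ _)).
by rewrite -!mul_polyC !rmorphD !rmorphM; ring.
Qed.

Lemma topexp_lift : exists2 L, all (fun c => tabok K.+1 n m c.2) L &
  forall B (io : {rmorphism F -> B}) (f g : {poly B}),
    (size f <= K)%N -> (size g <= K)%N ->
    (size (topexp K io f g phi -
       tabval (polyC \o (polyC \o io)) (addtop K f 'X%:P) (addtop K g 'X) L)%R <= J)%N.
Proof.
(* [M] bounds the degree in x of the coefficient of y^J at the generic pair, hence at every pair. *)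
pose M := size ((topexp K (@gen F N) (gx K) (gy K) phi)`_J).
have [L okL LE] : exists2 L, all (fun c => tabok K.+1 n m c.2) L &
  forall B (io : {rmorphism F -> B}) (f g : {poly B}),
    (size f <= K)%N -> (size g <= K)%N ->
    exists2 r : {poly {poly B}}, (size r <= J)%N &
      tabval (polyC \o (polyC \o io)) (addtop K f 'X%:P) (addtop K g 'X) L =
      (\sum_(e < M) 'X ^+ e * (pev io f g (tcoef K phi J e))%:P) *: 'X^J + r.
  elim: (M) => [|M' [L okL LE]].
    exists [::] => // B io f g sf sg; exists 0; first by rewrite size_poly0.
    by rewrite /tabval big_nil big_ord0 scale0r addr0.
  have [L' okL' LE'] := tcoef_lift M'.
  exists (L ++ L'); first by rewrite all_cat okL.
  move=> B io f g sf sg; have [r sr E] := LE B io f g sf sg.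
  have [r' sr' E'] := LE' B io f g sf sg.
  exists (r + r'); first by rewrite (leq_trans (size_polyD _ _)) // geq_max sr.
  by rewrite tabval_cat E E' big_ord_recr /= scalerDl addrACA.
exists L => // B io f g sf sg; have [r sr ->] := LE B io f g sf sg.
set S := \sum_(e < M) _.
have SE : S = (topexp K io f g phi)`_J.
  apply/polyP => e; rewrite -[RHS]/(coef2 _ J e) topexp_coef // /S.
  under eq_bigr do rewrite -['X]scale1r.
  have [lt|le] := ltnP e M.
    by rewrite (coef_sumX _ (fun e => pev io f g (tcoef K phi J e))) // expr1n mul1r.
  have -> : tcoef K phi J e = 0 by rewrite tcoefE /coef2 nth_default.
  rewrite rmorph0 coef_sum big1 // => i _; rewrite scale1r coefMC coefXn.
  by rewrite gtn_eqF ?mul0r // (leq_trans (ltn_ord i)).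
rewrite opprD addrA; apply: leq_trans (size_polyD _ _) _; rewrite size_polyN geq_max sr andbT.
apply/leq_sizeP => j le_Jj; rewrite coefB coefZ coefXn.
have [->|ne] := eqVneq j J; first by rewrite mulr1 SE subrr.
by rewrite mulr0 subr0 nth_default // (leq_trans (szJ io sf sg)) // ltn_neqAle eq_sym ne.
Qed.

End Top.

(** Induction on the strict bound [J] for the degree in y: subtracting the tableaux of [topexp_lift]
    removes the terms in the highest power of y and keeps homogeneity and invariance. *)
Lemma fft_step J phi :
  hom K.+1 K.+1 1 0 n phi -> hom K.+1 K.+1 0 1 m phi -> shinv K.+1 phi ->
  (forall B (io : {rmorphism F -> B}) (f g : {poly B}),
    (size f <= K)%N -> (size g <= K)%N -> (size (topexp K io f g phi) <= J)%N) ->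
  tabspan K.+1 n m phi.
Proof.
elim: J phi => [|J IHJ] phi hx hy inv szJ.
  exists [::] => // A io f g sf sg; rewrite /tabval big_nil.
  have [H [f' [g' [sf' sg' <-]]]] := pev_addtop io phi sf sg.
  have := szJ _ io _ _ sf' sg'; rewrite leqn0 size_poly_eq0 => /eqP ->.
  exact: rmorph0.
have [L okL LE] := topexp_lift hx hy inv szJ.
have sK A (f : {poly A}) : (size f <= K.+1)%N -> (size f <= N)%N.
  by move=> sf; apply: leq_trans ltKN.
have tE A (io : {rmorphism F -> A}) (f g : {poly A}) : (size f <= K.+1)%N ->
    (size g <= K.+1)%N -> pev io f g (tabpoly L : P) = tabval io f g L.
  by move=> sf sg; rewrite pev_tabpoly ?sK.
have sZ A (s : A) (f : {poly A}) : (size f <= K.+1)%N -> (size (s *: f) <= K.+1)%N.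
  by move=> sf; rewrite (leq_trans (size_scale_leq _ _)).
have [||||L' okL' LE'] := IHJ (phi - (tabpoly L : P)).
- apply: homB => // A io s f g sf sg; rewrite !tE ?sZ //.
  by rewrite (tabval_hom _ _ _ _ _ okL le_mn) expr0 expr1 expr1n mulr1.
- apply: homB => // A io s f g sf sg; rewrite !tE ?sZ //.
  by rewrite (tabval_hom _ _ _ _ _ okL le_mn) expr0 expr1 expr1n mul1r.
- move=> A io t f g sf sg; rewrite !rmorphB inv // !tE ?size_addZ //; congr (_ - _).
  by apply: eq_bigr => c _; rewrite tabv_shift.
- move=> B io f g sf sg; rewrite rmorphB.
  have -> : topexp K io f g (tabpoly L : P) =
      tabval (polyC \o (polyC \o io)) (addtop K f 'X%:P) (addtop K g 'X) L.
    by apply: tE; apply: size_addtop.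
  exact: LE.
exists (L' ++ L); first by rewrite all_cat okL'.
move=> A io f g sf sg; rewrite tabval_cat -LE' // rmorphB tE //.
by rewrite subrK.
Qed.

End Step.

(* First fundamental theorem for the unipotent group: simultaneous invariants
   of t.(f, g) = (f, g + t f) are generated by the coefficients of f and the
   2 x 2 minors. *)
Theorem shift_invariants K n m phi : (K <= N)%N -> (m <= n)%N ->
  hom K K 1 0 n phi -> hom K K 0 1 m phi -> shinv K phi -> tabspan K n m phi.
Proof.
elim: K n m phi => [|K IHK] n m phi ltKN le_mn hx hy inv.
  have z A (io : {rmorphism F -> A}) (f g : {poly A}) :
      (size f <= 0)%N -> (size g <= 0)%N -> pev io f g phi = io (pev idfun 0 0 phi).
    rewrite !leqn0 !size_poly_eq0 => /eqP-> /eqP->; symmetry.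
    by apply: pev_nat => // i _; rewrite !coef0 rmorph0.
  have [n0 | n_gt0] := posnP n.
    exists [:: (pev idfun 0 0 phi, ([::], [::]))].
      by move: le_mn; rewrite n0 leqn0 => /eqP->.
    move=> A io f g sf sg; rewrite z // /tabval big_seq1 /tabv /= !big_nil.
    by rewrite !mulr1.
  exists [::] => // A io f g sf sg; rewrite /tabval big_nil.
  (* Without coordinates phi is a constant, and homogeneity of positive degree, used with s = 0,
     makes it vanish. *)
  have := hx _ io 0 f g sf sg.
  rewrite expr0 expr1 scale0r scale1r expr0n eqn0Ngt n_gt0 mul0r => <-.
  by rewrite [RHS]z ?size_poly0 // z.
pose J := size (topexp K (@gen F N) (gx K) (gy K) phi).
apply: (fft_step ltKN le_mn _ (J := J)) => // [n' m' psi|B io f g sf sg].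
  by apply: IHK; apply: ltnW.
apply/leq_sizeP => i le_Ji; apply/polyP => e; rewrite coef0.
rewrite -[LHS]/(coef2 _ i e) topexp_coef //.
have -> : tcoef K phi i e = 0; last exact: rmorph0.
by rewrite tcoefE /coef2 (nth_default 0 le_Ji) coef0.
Qed.

End FFT.

(** * Resultants and the action of matrices on binary forms *)

Section Resultant.

(** Degrees are formal: [f] counts as degree [p] and [g] as degree [k], whatever their leading
    coefficients. The rows made from [g] come before those made from [f], which fixes the sign. *)
Definition sylv (A : idomainType) p k (f g : {poly A}) : 'M[A]_(p + k) :=
  \matrix_(i, j) match split i with
                 | inl i => ('X^i * g)`_j
                 | inr i => ('X^i * f)`_j
                 end.

(* The resultant of f and g for the formal degrees p and k. *)
Definition res (A : idomainType) p k (f g : {poly A}) : A := \det (sylv p k f g).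

Lemma res_nat (A B : idomainType) (h : {rmorphism A -> B}) p k
    (f g : {poly A}) (f' g' : {poly B}) :
  (forall i, h f`_i = f'`_i) -> (forall i, h g`_i = g'`_i) ->
  h (res p k f g) = res p k f' g'.
Proof.
move=> hf hg; rewrite /res -det_map_mx; congr (\det _).
apply/matrixP => i j; rewrite !mxE; case: split => i'; rewrite !coefXnM;
  by case: ifP; rewrite ?rmorph0.
Qed.

Lemma sylv_l (A : idomainType) p k (f g : {poly A}) (i : 'I_p) j :
  sylv p k f g (lshift k i) j = ('X^i * g)`_j.
Proof. by rewrite mxE (unsplitK (inl i)). Qed.

Lemma sylv_r (A : idomainType) p k (f g : {poly A}) (i : 'I_k) j :
  sylv p k f g (rshift p i) j = ('X^i * f)`_j.
Proof. by rewrite mxE (unsplitK (inr i)). Qed.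

(** Combining the rows of a Sylvester matrix is a multiplication on the left; the effect of scaling,
    shift and substitution on the resultant is then read off determinants of block matrices. *)
Lemma block_sylv (A : idomainType) p k (f g : {poly A})
    (M1 : 'M_p) (M2 : 'M_(p, k)) (M3 : 'M_(k, p)) (M4 : 'M_k) (S : 'M_(p + k)) :
  (forall i j, S (lshift k i) j =
     \sum_l M1 i l * ('X^l * g)`_j + \sum_l M2 i l * ('X^l * f)`_j) ->
  (forall i j, S (rshift p i) j =
     \sum_l M3 i l * ('X^l * g)`_j + \sum_l M4 i l * ('X^l * f)`_j) ->
  S = block_mx M1 M2 M3 M4 *m sylv p k f g.
Proof.
move=> H1 H2; apply/matrixP => i j.
rewrite -(splitK i); case: (split i) => i' /=.
  rewrite H1 mxE big_split_ord /=; congr (_ + _); apply: eq_bigr => l _.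
    by rewrite block_mxEul sylv_l.
  by rewrite block_mxEur sylv_r.
rewrite H2 mxE big_split_ord /=; congr (_ + _); apply: eq_bigr => l _.
  by rewrite block_mxEdl sylv_l.
by rewrite block_mxEdr sylv_r.
Qed.

Lemma sum_scalar (A : pzRingType) n (c : A) (i : 'I_n) (G : 'I_n -> A) :
  \sum_l (c%:M : 'M_n) i l * G l = c * G i.
Proof.
rewrite (bigD1 i) //= mxE eqxx big1 ?addr0 // => l ne.
by rewrite mxE eq_sym (negPf ne) mul0r.
Qed.

Lemma sum_zero (A : pzRingType) n n' (i : 'I_n) (G : 'I_n' -> A) :
  \sum_l (0 : 'M_(n, n')) i l * G l = 0.
Proof. by rewrite big1 // => l _; rewrite mxE mul0r. Qed.

Lemma res_scale (A : idomainType) p k s t (f g : {poly A}) :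
  res p k (s *: f) (t *: g) = s ^+ k * t ^+ p * res p k f g.
Proof.
rewrite /res (@block_sylv _ p k f g t%:M 0 0 s%:M (sylv p k (s *: f) (t *: g))) => [|i j|i j]; rewrite ?sylv_l ?sylv_r.
- by rewrite det_mulmx det_ublock !det_scalar [t ^+ _ * _]mulrC.
- by rewrite sum_scalar sum_zero addr0 -scalerAr coefZ.
- by rewrite sum_scalar sum_zero add0r -scalerAr coefZ.
Qed.

Lemma res_shift (A : idomainType) k t (f g : {poly A}) :
  res k k f (g + t *: f) = res k k f g.
Proof.
rewrite /res (@block_sylv _ k k f g 1%:M t%:M 0 1%:M (sylv k k f (g + t *: f))) => [|i j|i j]; rewrite ?sylv_l ?sylv_r.
- by rewrite det_mulmx det_ublock !det1 !mul1r.
- by rewrite !sum_scalar mul1r mulrDr -scalerAr coefD coefZ.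
- by rewrite sum_scalar sum_zero add0r mul1r.
Qed.

(** If [f] has no term of degree p + 1, the last column has at most one nonzero entry, the leading
    coefficient of [g] in row [p]; the sign is that of the position (p, p + k). *)
Lemma res_recl (A : idomainType) p k (f g : {poly A}) :
  (size f <= p.+1)%N -> (size g <= k.+1)%N ->
  res p.+1 k f g = (-1) ^+ k * g`_k * res p k f g.
Proof.
move=> sf sg; rewrite /res.
have ltp : (p < p.+1 + k)%N by rewrite addSn ltnS leq_addr.
pose i0 : 'I_(p.+1 + k) := Ordinal ltp.
have i0E : i0 = lshift k (ord_max : 'I_p.+1) by apply: val_inj.
rewrite (expand_det_col _ (ord_max : 'I_(p + k).+1)) (bigD1 i0) //= big1 ?addr0.
  have -> : sylv p.+1 k f g i0 (ord_max : 'I_(p + k).+1) = g`_k.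
    by rewrite i0E sylv_l coefXnM /= ltnNge leq_addr /= addKn.
  rewrite /cofactor /=.
  rewrite addnA addnn exprD -mul2n exprM sqrrN !expr1n mul1r mulrCA mulrA.
  congr (_ * \det _); apply/matrixP => i j.
  rewrite [LHS]mxE [LHS]mxE -{2}(splitK i).
  have jE : lift (ord_max : 'I_(p + k).+1) j = j :> nat by rewrite /= /bump leqNgt ltn_ord.
  case: splitP => i' iE /=.
    have -> : lift i0 i = lshift k (widen_ord (leqnSn p) i').
      by apply: val_inj; rewrite /= /bump leqNgt iE ltn_ord.
    rewrite [RHS]sylv_l; etransitivity; first exact: sylv_l.
    by rewrite jE.
  have -> : lift i0 i = rshift p.+1 i'.
    by apply: val_inj; rewrite /= /bump iE leq_addr addSn.
  rewrite [RHS]sylv_r; etransitivity; first exact: sylv_r.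
  by rewrite jE.
move=> i ne; apply/eqP; rewrite mulf_eq0; apply/orP; left; apply/eqP.
rewrite -(splitK i) in ne *; case: (split i) ne => i' /= ne.
  etransitivity; first exact: sylv_l.
  rewrite coefXnM /= ifN; last by have := ltn_ord i'; lia.
  rewrite nth_default // (leq_trans sg) //.
  have : (i' < p)%N.
    rewrite ltn_neqAle -ltnS ltn_ord andbT; apply: contraNneq ne => e.
    by apply/eqP/val_inj; rewrite /= e.
  lia.
etransitivity; first exact: sylv_r.
rewrite coefXnM /= ifN; last by have := ltn_ord i'; lia.
rewrite nth_default // (leq_trans sf) //.
by have := ltn_ord i'; lia.
Qed.

Lemma res_0 (A : idomainType) k c (g : {poly A}) : res 0 k c%:P g = c ^+ k.
Proof.
rewrite /res (_ : sylv _ _ _ _ = c%:M) ?det_scalar //.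
apply/matrixP => i j; rewrite -(splitK i); case: (split i) => [[] //|i'] /=.
rewrite sylv_r coefXnM coefC mxE -val_eqE /=.
case: (ltngtP i' j) => [lt|lt|->]; last by rewrite subnn eqxx.
  by rewrite subn_eq0 leqNgt lt.
by [].
Qed.

(** A pair without common factor, which shows that the generic resultant is nonzero. *)
Lemma res_one (A : idomainType) p k : res p k 1 'X^k != 0 :> A.
Proof.
elim: p => [|p IHp]; first by rewrite res_0 expr1n oner_neq0.
rewrite res_recl ?size_poly1 ?size_polyXn // coefXn eqxx mulr1.
by rewrite mulf_neq0 ?signr_eq0.
Qed.

(** The row vector made of the coefficients of - f and g is in the kernel, because g (l f) - f (l g)
    = 0. It is zero only if f = g = 0, and then the matrix itself is zero. *)
Lemma res_common (A : idomainType) p k (l f g : {poly A}) :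
  (0 < p)%N -> (0 < k)%N -> (size l <= 2)%N -> (size f <= p)%N -> (size g <= k)%N ->
  res p k (l * f) (l * g) = 0.
Proof.
move=> p0 k0 sl sf sg; apply/eqP/det0P.
pose v : 'rV[A]_(p + k) := row_mx (\row_i (- f`_i)) (\row_i g`_i).
have [fz | fnz] := boolP ((f == 0) && (g == 0)).
  case/andP: fz => /eqP-> /eqP->.
  have lt0 : (0 < p + k)%N by rewrite addn_gt0 p0.
  exists (delta_mx 0 (Ordinal lt0)).
    apply/eqP => /matrixP/(_ 0 (Ordinal lt0)); rewrite !mxE !eqxx /=.
    by move/eqP; rewrite oner_eq0.
  apply/matrixP => i j; rewrite !mxE big1 // => l' _.
  rewrite [X in _ * X](_ : _ = 0) ?mulr0 // -(splitK l').
  by case: (split l') => l'' /=; rewrite ?sylv_l ?sylv_r !mulr0 coef0.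
exists v.
  apply: contraNneq fnz => vz.
  have vE i : v 0 i = 0 by rewrite vz mxE.
  apply/andP; split; apply/eqP/polyP => i; rewrite coef0.
    have [lt | le] := ltnP i p; last by rewrite nth_default // (leq_trans sf).
    by have := vE (lshift k (Ordinal lt)); rewrite row_mxEl mxE => /eqP; rewrite oppr_eq0 => /eqP.
  have [lt | le] := ltnP i k; last by rewrite nth_default // (leq_trans sg).
  by have := vE (rshift p (Ordinal lt)); rewrite row_mxEr mxE.
apply/matrixP => i j; rewrite !mxE big_split_ord /= (ord1 i).
have E (n : nat) (h h' : {poly A}) : (size h <= n)%N ->
    (h * h')`_j = \sum_(i < n) h`_i * ('X^i * h')`_j.
  move=> sh; have hE : h = \sum_(i < n) h`_i *: 'X^i.
    by rewrite -poly_def; apply/polyP => i'; rewrite coef_poly;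
       case: ltnP => // le; rewrite nth_default // (leq_trans sh).
  rewrite {1}hE mulr_suml coef_sum; apply: eq_bigr => i' _.
  by rewrite -scalerAl coefZ.
under eq_bigr do rewrite row_mxEl sylv_l mxE mulNr.
under [X in _ + X]eq_bigr do rewrite row_mxEr sylv_r mxE.
rewrite sumrN -(E _ f) // -(E _ g) // mulrCA [g * _]mulrCA [f * g]mulrC.
by rewrite addNr.
Qed.

End Resultant.

Section SubstitutionAction.
Context {A : idomainType}.
Implicit Types (M : 'M[A]_2) (f g h : {poly A}).

Definition lincol M (c : 'I_2) : {poly A} := (M 0 c)%:P + (M 1 c) *: 'X.

(* The action of a 2 x 2 matrix on the binary forms of degree d, written as
   polynomials in one variable. *)
Definition gact d M f : {poly A} :=
  \sum_(j < d.+1) f`_j *: (lincol M 0 ^+ (d - j) * lincol M 1 ^+ j).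

Lemma gactD d M f g : gact d M (f + g) = gact d M f + gact d M g.
Proof. by rewrite -big_split; apply: eq_bigr => j _; rewrite coefD scalerDl. Qed.

Lemma gactZ d M c f : gact d M (c *: f) = c *: gact d M f.
Proof. by rewrite scaler_sumr; apply: eq_bigr => j _; rewrite coefZ scalerA. Qed.

Lemma gact_sum d M (I : Type) (r : seq I) (P : pred I) (G : I -> {poly A}) :
  gact d M (\sum_(i <- r | P i) G i) = \sum_(i <- r | P i) gact d M (G i).
Proof.
apply: (big_morph (gact d M) (gactD d M)).
by rewrite /gact big1 // => j _; rewrite coef0 scale0r.
Qed.

Lemma gactXn d M i : (i <= d)%N ->
  gact d M 'X^i = lincol M 0 ^+ (d - i) * lincol M 1 ^+ i.
Proof.
move=> id; have lt : (i < d.+1)%N by [].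
rewrite /gact (bigD1 (Ordinal lt)) //= big1 => [|j ne].
  by rewrite coefXn eqxx scale1r addr0.
rewrite coefXn; case: eqP => [e|_]; last by rewrite scale0r.
by case/eqP: ne; apply: val_inj.
Qed.

Lemma poly_sumX n f : (size f <= n)%N -> f = \sum_(i < n) f`_i *: 'X^i.
Proof.
move=> sf; rewrite -poly_def; apply/polyP => i; rewrite coef_poly.
by case: ltnP => // le; rewrite nth_default // (leq_trans sf).
Qed.

Lemma gactM a b M f g : (size f <= a.+1)%N -> (size g <= b.+1)%N ->
  gact (a + b) M (f * g) = gact a M f * gact b M g.
Proof.
move=> /poly_sumX {1}-> /poly_sumX {1}->.
rewrite mulr_suml gact_sum [gact a M f]/gact mulr_suml; apply: eq_bigr => i _.
rewrite mulr_sumr gact_sum [gact b M g]/gact mulr_sumr; apply: eq_bigr => j _.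
rewrite -scalerAl -scalerAr !gactZ -exprD gactXn; last first.
  by rewrite leq_add // -ltnS.
rewrite -scalerAl -scalerAr; congr (_ *: (_ *: _)).
have -> : (a + b - (i + j) = (a - i) + (b - j))%N.
  by have := ltn_ord i; have := ltn_ord j; lia.
by rewrite !exprD; ring.
Qed.

Lemma size_lincol M c : (size (lincol M c) <= 2)%N.
Proof.
apply: leq_trans (size_polyD _ _) _; rewrite geq_max (leq_trans (size_polyC_leq1 _)) //.
by rewrite (leq_trans (size_scale_leq _ _)) ?size_polyX.
Qed.

Lemma size_lincolX M c n : (size (lincol M c ^+ n) <= n.+1)%N.
Proof.
elim: n => [|n IHn]; first by rewrite expr0 size_poly1.
rewrite exprS; apply: leq_trans (size_polyMleq _ _) _.
by have := size_lincol M c; lia.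
Qed.

Lemma size_gact d M f : (size (gact d M f) <= d.+1)%N.
Proof.
apply: leq_trans (size_sum _ _ _) _; apply/bigmax_leqP => j _.
apply: leq_trans (size_scale_leq _ _) _; apply: leq_trans (size_polyMleq _ _) _.
have := size_lincolX M 0 (d - j); have := size_lincolX M 1 j.
by have := ltn_ord j; lia.
Qed.

Lemma lincol_mul M N c : lincol (M *m N) c = gact 1 M (lincol N c).
Proof.
rewrite /gact big_ord_recl big_ord1 /= /lincol !mxE !big_ord_recl !big_ord0 !addr0.
rewrite !coefD !coefC !coefZ !coefX /= !mulr0 !mulr1 addr0 add0r.
rewrite /bump /= subn0 subnn !expr1 !expr0 mul1r.
have -> : lift ord0 ord0 = 1 :> 'I_2 by apply: val_inj.
have -> : ord0 = 0 :> 'I_2 by [].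
rewrite -!mul_polyC !rmorphD !rmorphM; ring.
Qed.

Lemma gactX d M f n : (size f <= d.+1)%N -> gact (d * n) M (f ^+ n) = gact d M f ^+ n.
Proof.
move=> sf; elim: n => [|n IHn].
  by have := @gactXn 0 M 0 isT; rewrite muln0 subn0 !expr0 mulr1.
rewrite mulnS !exprS gactM ?IHn //.
elim: n {IHn} => [|n IHn]; first by rewrite expr0 size_poly1.
by rewrite exprS (leq_trans (size_polyMleq _ _)) // mulnS; lia.
Qed.

Lemma gact_comp d M N f : gact d (M *m N) f = gact d M (gact d N f).
Proof.
rewrite [in LHS]/gact [gact d N f]/gact gact_sum; apply: eq_bigr => j _.
rewrite gactZ; congr (_ *: _).
have X1 P' c n : gact n M (lincol P' c ^+ n) = lincol (M *m P') c ^+ n.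
  by rewrite -{1}[n]mul1n gactX ?size_lincol // lincol_mul.
have E a b : gact (a + b) M (lincol N 0 ^+ a * lincol N 1 ^+ b) =
    lincol (M *m N) 0 ^+ a * lincol (M *m N) 1 ^+ b.
  by rewrite gactM ?size_lincolX // !X1.
by rewrite -E subnK // -ltnS.
Qed.

Definition gactmx n M : 'M[A]_n :=
  \matrix_(i, j) (lincol M 0 ^+ (n.-1 - i) * lincol M 1 ^+ i)`_j.

Lemma coef_gact d M f (j : 'I_d.+1) :
  (gact d M f)`_j = \sum_(i < d.+1) f`_i * gactmx d.+1 M i j.
Proof.
by rewrite coef_sum; apply: eq_bigr => i _; rewrite coefZ mxE.
Qed.

(** The columns of the Sylvester matrix index forms of degree 2 k - 1. Acting on them turns the row
    X^i g into (M X^i) (M g), where X^i has formal degree k - 1, so it becomes a combination of rows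
    of the Sylvester matrix of the transformed pair. *)
Lemma res_gact_det k M f g : (size f <= k.+1)%N -> (size g <= k.+1)%N ->
  res k k f g * \det (gactmx (k + k) M) =
  \det (gactmx k M) ^+ 2 * res k k (gact k M f) (gact k M g).
Proof.
case: k => [|k] sf sg; first by rewrite /res !det_mx00; ring.
rewrite /res -det_mulmx (@block_sylv _ k.+1 k.+1 (gact k.+1 M f) (gact k.+1 M g)
    (gactmx k.+1 M) 0 0 (gactmx k.+1 M)
    (sylv k.+1 k.+1 f g *m gactmx (k.+1 + k.+1) M)) => [|i j|i j].
- by rewrite det_mulmx det_ublock expr2.
- rewrite mxE; under eq_bigr do rewrite sylv_l.
  rewrite -[LHS](@coef_gact (k + k.+1) M ('X^i * g) j).
  rewrite gactM ?size_polyXn // [in LHS](poly_sumX (size_gact k M 'X^i)).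
  rewrite sum_zero addr0 mulr_suml coef_sum; apply: eq_bigr => l _.
  rewrite -scalerAl coefZ (coef_gact M 'X^i l); congr (_ * _).
  rewrite (bigD1 i) //= big1 => [|i' ne]; rewrite coefXn ?eqxx ?addr0 ?mul1r //.
  by rewrite val_eqE (negPf ne) mul0r.
- rewrite mxE; under eq_bigr do rewrite sylv_r.
  rewrite -[LHS](@coef_gact (k + k.+1) M ('X^i * f) j).
  rewrite gactM ?size_polyXn // [in LHS](poly_sumX (size_gact k M 'X^i)).
  rewrite sum_zero add0r mulr_suml coef_sum; apply: eq_bigr => l _.
  rewrite -scalerAl coefZ (coef_gact M 'X^i l); congr (_ * _).
  rewrite (bigD1 i) //= big1 => [|i' ne]; rewrite coefXn ?eqxx ?addr0 ?mul1r //.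
  by rewrite val_eqE (negPf ne) mul0r.
Qed.

Definition res_inv M := forall k f g, (size f <= k.+1)%N -> (size g <= k.+1)%N ->
  res k k (gact k M f) (gact k M g) = res k k f g.

Lemma res_inv_mul M N : res_inv M -> res_inv N -> res_inv (M *m N).
Proof. by move=> HM HN k f g sf sg; rewrite !gact_comp HM ?size_gact // HN. Qed.

Lemma res_inv_det M : (forall n, \det (gactmx n M) = 1) -> res_inv M.
Proof.
move=> H k f g sf sg; have := res_gact_det M sf sg.
by rewrite !H expr1n mulr1 mul1r.
Qed.

Definition utrans (t : A) : 'M[A]_2 :=
  \matrix_(i, j) (if i == j then 1 else if i == 0 then t else 0).
Definition ltrans (t : A) : 'M[A]_2 :=
  \matrix_(i, j) (if i == j then 1 else if i == 0 then 0 else t).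

Lemma res_inv_upper t : res_inv (utrans t).
Proof.
apply: res_inv_det => n.
have l0 : lincol (utrans t) 0 = 1 by rewrite /lincol !mxE /= scale0r addr0.
have l1 : lincol (utrans t) 1 = 'X + t%:P by rewrite /lincol !mxE /= scale1r addrC.
have mon i : ('X + t%:P) ^+ i \is monic by rewrite monic_exp // monicXaddC.
have sz i : size (('X + t%:P) ^+ i) = i.+1.
  by rewrite -[t]opprK polyCN size_exp_XsubC.
rewrite det_trig => [|]; last first.
  apply/is_trig_mxP => i j lt; rewrite mxE l0 l1 expr1n mul1r nth_default //.
  by rewrite sz.
rewrite big1 // => i _; rewrite mxE l0 l1 expr1n mul1r.
by have /monicP := mon i; rewrite /lead_coef sz.
Qed.

Lemma res_inv_lower t : res_inv (ltrans t).
Proof.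
apply: res_inv_det => n.
have l0 : lincol (ltrans t) 0 = 1 + t *: 'X by rewrite /lincol !mxE.
have l1 : lincol (ltrans t) 1 = 'X by rewrite /lincol !mxE /= scale1r add0r.
rewrite -det_tr det_trig => [|]; last first.
  apply/is_trig_mxP => i j lt; rewrite !mxE l0 l1 coefMXn.
  by rewrite lt.
rewrite big1 // => i _; rewrite !mxE l0 l1 coefMXn ltnn subnn.
by rewrite -horner_coef0 !hornerE expr1n.
Qed.

End SubstitutionAction.

(** * Invariance of the resultant under SL_2 *)

Section SL2Resultant.

Lemma mx2P (R : pzRingType) (M N : 'M[R]_2) :
  M 0 0 = N 0 0 -> M 0 1 = N 0 1 -> M 1 0 = N 1 0 -> M 1 1 = N 1 1 -> M = N.
Proof.
move=> e00 e01 e10 e11; apply/matrixP => i j.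
have two (i' : 'I_2) : i' = 0 \/ i' = 1.
  by case: i' => [[|[|//]] p]; [left | right]; apply: val_inj.
by case: (two i) => ->; case: (two j) => ->.
Qed.

Lemma mulmx2 (R : pzRingType) (M N : 'M[R]_2) i j :
  (M *m N) i j = M i 0 * N 0 j + M i 1 * N 1 j.
Proof.
rewrite mxE !big_ord_recl big_ord0 addr0.
by have -> : lift ord0 ord0 = 1 :> 'I_2 by apply: val_inj.
Qed.

(** SL_2 of a field is generated by transvections, for which the determinants above are 1. A matrix
    with nonzero lower left entry is a product upper, lower, upper; any other one acquires such an
    entry after multiplication by a lower transvection. The factorisation divides by that entry, so
    it takes place over [F] before the extension to [A]. *)
Lemma res_inv_SL2 (F : fieldType) (A : idomainType) (io : {rmorphism F -> A})
  (M : 'M[F]_2) : \det M = 1 -> res_inv (map_mx io M).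
Proof.
move=> detM.
have dE : M 0 0 * M 1 1 - M 0 1 * M 1 0 = 1.
  rewrite -detM (expand_det_row _ 0) !big_ord_recl big_ord0 addr0 /cofactor.
  rewrite !det_mx11 !mxE /= /bump /= expr0 mul1r expr1 mulN1r mulrN.
  by congr (_ * M _ _ - M _ _ * M _ _); apply: val_inj.
have main (L : 'M[F]_2) : L 1 0 != 0 -> L 0 0 * L 1 1 - L 0 1 * L 1 0 = 1 ->
    res_inv (map_mx io L).
  move=> nz dL.
  have -> : L = utrans ((L 0 0 - 1) / L 1 0) *m ltrans (L 1 0) *m
                utrans ((L 1 1 - 1) / L 1 0).
    apply: mx2P; rewrite !mulmx2 !mxE /=.
    - by field.
    - have -> : L 0 1 = (L 0 0 * L 1 1 - 1) / L 1 0.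
        by apply: (canRL (mulfK nz)); rewrite -dL; ring.
      by field.
    - by ring.
    - by field.
  rewrite !map_mxM.
  have uE t : map_mx io (utrans t) = utrans (io t).
    by apply/matrixP => i j; rewrite !mxE; do 2?case: ifP => _; rewrite ?rmorph0 ?rmorph1.
  have lE t : map_mx io (ltrans t) = ltrans (io t).
    by apply/matrixP => i j; rewrite !mxE; do 2?case: ifP => _; rewrite ?rmorph0 ?rmorph1.
  rewrite !uE lE.
  by apply: res_inv_mul (res_inv_mul _ _) _; [exact: res_inv_upper|exact: res_inv_lower|exact: res_inv_upper].
have [z | nz] := eqVneq (M 1 0) 0; last exact: main.
have M00 : M 0 0 != 0.
  apply: contra_eq_neq dE => ->; rewrite z mul0r mulr0 subr0 eq_sym.
  exact: oner_neq0.
have -> : M = ltrans (-1) *m (ltrans 1 *m M).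
  by apply: mx2P; rewrite !mulmx2 !mxE /= ?mulmx2 ?mxE /=; ring.
rewrite map_mxM; apply: res_inv_mul.
  have -> : map_mx io (ltrans (-1)) = ltrans (-1).
    apply/matrixP => i j; rewrite !mxE; do 2?case: ifP => _; rewrite ?rmorph0 ?rmorph1 //.
    by rewrite rmorphN1.
  exact: res_inv_lower.
apply: main; rewrite !mulmx2 !mxE /=; first by rewrite z mulr0 addr0 mul1r.
by rewrite -[RHS]dE; ring.
Qed.

End SL2Resultant.

(** * Division by the resultant *)

Section Division.
Context {F : idomainType} {N : nat}.
Implicit Types (A B : idomainType) (phi psi chi R : {mpoly F[N + N]}).
Local Notation P := {mpoly F[N + N]}.

Definition cgr A (c x y : A) := exists w, x = y + c * w.

Lemma cgr_refl A (c x : A) : cgr c x x.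
Proof. by exists 0; rewrite mulr0 addr0. Qed.

Lemma cgrM A (c x y x' y' : A) : cgr c x y -> cgr c x' y' -> cgr c (x * x') (y * y').
Proof.
by move=> [w ->] [w' ->]; exists (y * w' + w * y' + c * w * w'); ring.
Qed.

Lemma cgrD A (c x y x' y' : A) : cgr c x y -> cgr c x' y' -> cgr c (x + x') (y + y').
Proof. by move=> [w ->] [w' ->]; exists (w + w'); ring. Qed.

Lemma pev_cgr A (io : {rmorphism F -> A}) (c : A) (f g f' g' : {poly A}) phi :
  (forall i, cgr c f`_i f'`_i) -> (forall i, cgr c g`_i g'`_i) ->
  cgr c (pev io f g phi) (pev io f' g' phi).
Proof.
move=> hf hg; elim/mpolyind: phi => [|c0 m p _ _ IH].
  by rewrite !rmorph0; apply: cgr_refl.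
rewrite !rmorphD /=; apply: cgrD IH.
rewrite -mul_mpolyC !rmorphM !pevC; apply: cgrM (cgr_refl _ _) _.
rewrite mpolyXE_id !rmorph_prod; apply: (big_ind2 (cgr c)) => [||i _].
- exact: cgr_refl.
- by move=> *; apply: cgrM.
rewrite !rmorphXn; elim: (m i) => [|k IHk]; first by rewrite !expr0; apply: cgr_refl.
rewrite !exprS; apply: cgrM IHk.
by rewrite -(splitK i); case: (split i) => j /=; rewrite ?pev_x ?pev_y.
Qed.

(** At the generic pair scaled by an indeterminate the nonzero value of [R] cancels, and [chi]
    scales by the difference of the degrees. *)
Lemma hom_divide K L i j e n R chi phi :
  (forall A (io : {rmorphism F -> A}) (f g : {poly A}),
    (size f <= K)%N -> (size g <= L)%N ->
    pev io f g phi = pev io f g R * pev io f g chi) ->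
  hom K L i j e R -> hom K L i j n phi -> trunc K L R != 0 ->
  law0 K L chi \/ (e <= n)%N /\ hom K L i j (n - e) chi.
Proof.
move=> E hR hphi Rn; apply: hom_cancel_gen.
have sx : (size (map_poly polyC (@gx F N K)) <= K)%N.
  exact: leq_trans (size_poly _ _) (size_gx _).
have sy : (size (map_poly polyC (@gy F N L)) <= L)%N.
  exact: leq_trans (size_poly _ _) (size_gy _).
have := E _ (polyC \o gen) _ _ (leq_trans (size_scale_leq ('X ^+ i) _) sx)
  (leq_trans (size_scale_leq ('X ^+ j) _) sy).
rewrite hphi // hR // E // !pev_polyC => e1.
apply: (mulfI (_ : (trunc K L R)%:P != 0)); first by rewrite polyC_eq0.
by rewrite mulrCA [in RHS]mulrCA e1 mulrA.
Qed.

Lemma split_x p L phi : (p < N)%N -> exists psi,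
  forall A (io : {rmorphism F -> A}) (f g : {poly A}),
    (size f <= p.+1)%N -> (size g <= L)%N ->
    pev io f g phi = pev io (take_poly p f) g phi + f`_p * pev io f g psi.
Proof.
move=> lt; pose v := lshift N (Ordinal lt).
have [psi E] : cgr ('X_v : P) (trunc p.+1 L phi) (trunc p L phi).
  apply: pev_cgr => i; last exact: cgr_refl.
  rewrite !coef_poly ltnS; case: (ltngtP i p) => [_|_|->]; [exact: cgr_refl|exact: cgr_refl|].
  by exists 1; rewrite mulr1 add0r insubT.
exists psi => A io f g sf sg.
rewrite -(pev_trunc io phi sf sg) E rmorphD rmorphM pev_x; congr (_ + _).
apply: pev_nat => [c | i iN | i iN]; first exact: pevC.
  rewrite coef_take_poly coef_poly; case: ifP => _; last exact: rmorph0.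
  by rewrite insubT pev_x.
exact: pev_gy.
Qed.

Lemma split_y K k phi : (k < N)%N -> exists psi,
  forall A (io : {rmorphism F -> A}) (f g : {poly A}),
    (size f <= K)%N -> (size g <= k.+1)%N ->
    pev io f g phi = pev io f (take_poly k g) phi + g`_k * pev io f g psi.
Proof.
move=> lt; pose v := rshift N (Ordinal lt).
have [psi E] : cgr ('X_v : P) (trunc K k.+1 phi) (trunc K k phi).
  apply: pev_cgr => i; first exact: cgr_refl.
  rewrite !coef_poly ltnS; case: (ltngtP i k) => [_|_|->]; [exact: cgr_refl|exact: cgr_refl|].
  by exists 1; rewrite mulr1 add0r insubT.
exists psi => A io f g sf sg.
rewrite -(pev_trunc io phi sf sg) E rmorphD rmorphM pev_y; congr (_ + _).
apply: pev_nat => [c | i iN | i iN]; first exact: pevC.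
  exact: pev_gx.
rewrite coef_take_poly coef_poly; case: ifP => _; last exact: rmorph0.
by rewrite insubT pev_y.
Qed.

(* phi vanishes on the pairs having a common factor, for the formal degrees p
   and k *)
Definition vanish p k phi := forall A (io : {rmorphism F -> A}) (l f g : {poly A}),
  (size l <= 2)%N -> (size f <= p)%N -> (size g <= k)%N ->
  pev io (l * f) (l * g) phi = 0.

Lemma size_lM A (l f : {poly A}) p : (size l <= 2)%N -> (size f <= p)%N ->
  (size (l * f)%R <= p.+1)%N.
Proof.
move=> sl sf; apply: leq_trans (size_polyMleq _ _) _.
by move: sl sf; case: (size l) => [|[|[|//]]]; lia.
Qed.

Lemma top_lM A (l f : {poly A}) p : (size l <= 2)%N -> (size f <= p.+1)%N ->
  (l * f)`_p.+1 = l`_1 * f`_p.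
Proof.
move=> sl sf; rewrite coefM (bigD1 (inord 1)) //= inordK // big1 => [|i ne].
  by rewrite addr0 subSS subn0.
have [lt | ge] := ltnP i 2; last by rewrite nth_default ?mul0r // (leq_trans sl).
have i0 : i = 0%N :> nat.
  case: (val i =P 0%N) lt => // i0 lt; case/eqP: ne; apply: val_inj => /=.
  by rewrite inordK //; move: i0 lt => /=; lia.
by rewrite i0 subn0 [f`__]nth_default ?mulr0.
Qed.

Lemma map_perturb A (H : {rmorphism {poly A} -> A}) (q : {poly A}) j :
  (forall c, H c%:P = c) -> H 'X = 0 ->
  map_poly H (map_poly polyC q) = q /\
  map_poly H (map_poly polyC q + 'X *: 'X^j) = q.
Proof.
move=> HC HX; have E : map_poly H (map_poly polyC q) = q.
  by apply/polyP => i; rewrite coef_map coef_map /= HC.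
split=> //; apply/polyP => i; rewrite coef_map /= coefD coefZ rmorphD rmorphM.
by rewrite -[H (map_poly _ _)`_i]coef_map E HX mul0r addr0.
Qed.

(* The hypothesis only controls psi when the leading coefficient is nonzero,
   so the pair is first perturbed into one with nonzero leading coefficient. *)
Lemma vanish_x p k phi psi : (0 < k)%N -> vanish p.+1 k phi ->
  (forall A (io : {rmorphism F -> A}) (f g : {poly A}),
    (size f <= p.+2)%N -> (size g <= k.+1)%N ->
    pev io f g phi = f`_p.+1 * pev io f g psi) ->
  vanish p.+1 k psi.
Proof.
move=> k_gt0 van E A io l f g sl sf sg.
pose up (q : {poly A}) : {poly {poly A}} := map_poly polyC q.
pose l' := up l + 'X *: 'X^1; pose f' := up f + 'X *: 'X^p.
have sl' : (size l' <= 2)%N.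
  apply: leq_trans (size_polyD _ _) _; rewrite geq_max size_map_polyC //=.
  by rewrite (leq_trans (size_scale_leq _ _)) ?size_polyXn.
have sf' : (size f' <= p.+1)%N.
  apply: leq_trans (size_polyD _ _) _; rewrite geq_max size_map_polyC //=.
  by rewrite (leq_trans (size_scale_leq _ _)) ?size_polyXn.
have sg' : (size (up g) <= k)%N by rewrite size_map_polyC.
have := van _ (polyC \o io) l' f' (up g) sl' sf' sg'.
rewrite E ?size_lM // top_lM //.
have nz (c : A) : c%:P + 'X != 0.
  by rewrite addrC -size_poly_eq0 size_XaddC.
rewrite !coefD !coefZ !coef_map !coefXn !eqxx !mulr1 /= => /eqP.
rewrite !mulf_eq0 (negPf (nz _)) (negPf (nz _)) /= => /eqP z.
have [H [HC HX _]] := horner_ex (0 : A).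
rewrite -[RHS](rmorph0 H) -z; symmetry; apply: pev_nat => [c|i _|i _].
- exact: HC.
- have ml : map_poly H l' = l := (map_perturb l 1 HC HX).2.
  have mf : map_poly H f' = f := (map_perturb f p HC HX).2.
  by rewrite -coef_map rmorphM /= ml mf.
- have ml : map_poly H l' = l := (map_perturb l 1 HC HX).2.
  have mg : map_poly H (up g) = g := (map_perturb g 0 HC HX).1.
  by rewrite -coef_map rmorphM /= ml mg.
Qed.

Lemma vanish_y p k phi psi : (0 < p)%N -> vanish p k.+1 phi ->
  (forall A (io : {rmorphism F -> A}) (f g : {poly A}),
    (size f <= p.+1)%N -> (size g <= k.+2)%N ->
    pev io f g phi = g`_k.+1 * pev io f g psi) ->
  vanish p k.+1 psi.
Proof.
move=> p_gt0 van E A io l f g sl sf sg.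
pose up (q : {poly A}) : {poly {poly A}} := map_poly polyC q.
pose l' := up l + 'X *: 'X^1; pose g' := up g + 'X *: 'X^k.
have sl' : (size l' <= 2)%N.
  apply: leq_trans (size_polyD _ _) _; rewrite geq_max size_map_polyC //=.
  by rewrite (leq_trans (size_scale_leq _ _)) ?size_polyXn.
have sg' : (size g' <= k.+1)%N.
  apply: leq_trans (size_polyD _ _) _; rewrite geq_max size_map_polyC //=.
  by rewrite (leq_trans (size_scale_leq _ _)) ?size_polyXn.
have sf' : (size (up f) <= p)%N by rewrite size_map_polyC.
have := van _ (polyC \o io) l' (up f) g' sl' sf' sg'.
rewrite E ?size_lM // top_lM //.
have nz (c : A) : c%:P + 'X != 0.
  by rewrite addrC -size_poly_eq0 size_XaddC.
rewrite !coefD !coefZ !coef_map !coefXn !eqxx !mulr1 /= => /eqP.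
rewrite !mulf_eq0 (negPf (nz _)) (negPf (nz _)) /= => /eqP z.
have [H [HC HX _]] := horner_ex (0 : A).
have ml : map_poly H l' = l := (map_perturb l 1 HC HX).2.
have mf : map_poly H (up f) = f := (map_perturb f 0 HC HX).1.
have mg : map_poly H g' = g := (map_perturb g k HC HX).2.
rewrite -[RHS](rmorph0 H) -z; symmetry; apply: pev_nat => [c|i _|i _].
- exact: HC.
- by rewrite -coef_map rmorphM /= ml mf.
- by rewrite -coef_map rmorphM /= ml mg.
Qed.

(** For linear f this is f_1^k g(- f_0 / f_1), the value of [g] at the root of [f] with denominators
    cleared: the remainder of f_1^k g in the division by f. *)
Definition root_value A k (f g : {poly A}) : A :=
  \sum_(j < k.+1) g`_j * ((- f`_0) ^+ j * f`_1 ^+ (k - j)).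

Lemma root_valueP A k (f g : {poly A}) : (size f <= 2)%N -> (size g <= k.+1)%N ->
  exists2 h : {poly A}, (size h <= k)%N &
    f`_1 ^+ k *: g = f * h + (root_value k f g)%:P.
Proof.
move=> sf; have fE : f = f`_1 *: 'X + (f`_0)%:P.
  apply/polyP => -[|[|i]]; rewrite coefD coefZ coefX coefC /= ?mulr0 ?mulr1 ?add0r ?addr0 //.
  by rewrite nth_default // (leq_trans sf).
elim: k g => [|k IHk] g sg.
  exists 0; first by rewrite size_poly0.
  rewrite /root_value big_ord1 !expr0 !mulr1 scale1r mulr0 add0r.
  exact: size1_polyC.
have [c [g' gE]] : exists c g', g = g' * 'X + c%:P.
  exists g`_0, (drop_poly 1 g); rewrite -[LHS](poly_take_drop 1) addrC expr1; congr (_ + _).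
  by apply/polyP => i; rewrite coef_take_poly coefC; case: i.
have sg' : (size g' <= k.+1)%N.
  apply/leq_sizeP => j le; have : g`_j.+1 = 0 by rewrite nth_default // (leq_trans sg).
  by rewrite gE coefD coefMX coefC /= addr0.
have [h sh E] := IHk g' sg'.
exists ((f`_1 *: 'X) * h + (root_value k f g')%:P).
  apply: leq_trans (size_polyD _ _) _; rewrite geq_max -scalerAl.
  rewrite (leq_trans (size_scale_leq _ _)) /=.
    by rewrite (leq_trans (size_polyC_leq1 _)).
  by rewrite mulrC (leq_trans (size_polyMleq _ _)) // size_polyX addnS addn1 ltnS.
have rE : root_value k.+1 f g = c * f`_1 ^+ k.+1 - f`_0 * root_value k f g'.
  rewrite /root_value big_ord_recl /= expr0 mul1r subn0; congr (_ + _).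
    by rewrite gE coefD coefMX coefC /= add0r.
  rewrite -mulNr mulr_sumr; apply: eq_bigr => j _; rewrite /= /bump /= add1n subSS exprS.
  by rewrite gE coefD coefMX coefC /= addr0; ring.
rewrite rE {1}gE exprS scalerDr -scalerA scalerAl E.
rewrite -!mul_polyC rmorphB !rmorphM rmorphXn.
rewrite -mul_polyC in fE; set r := (root_value _ _ _)%:P.
apply/eqP; rewrite -subr_eq0; apply/eqP.
transitivity (r * ((f`_1)%:P * 'X + (f`_0)%:P - f)); first by ring.
by rewrite -fE subrr mulr0.
Qed.

End Division.

(** * Polynomials vanishing on pairs with a common factor *)

Section ResultantDivides.
Context {F : idomainType} {N : nat}.
Implicit Types (A B : idomainType) (phi psi chi R : {mpoly F[N + N]}).
Local Notation P := {mpoly F[N + N]}.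
Local Notation gx := (@gx F N).
Local Notation gy := (@gy F N).
Local Notation gen := (@gen F N).

Lemma pev_gxW A (io : {rmorphism F -> A}) (f g : {poly A}) K i :
  (size f <= K)%N -> (K <= N)%N -> pev io f g (gx K)`_i = f`_i.
Proof.
move=> sf KN; have [lt | le] := ltnP i N; first exact: pev_gx.
by rewrite !nth_default ?rmorph0 // (leq_trans _ le) ?(leq_trans _ KN) ?size_gx.
Qed.

Lemma pev_gyW A (io : {rmorphism F -> A}) (f g : {poly A}) K i :
  (size g <= K)%N -> (K <= N)%N -> pev io f g (gy K)`_i = g`_i.
Proof.
move=> sf KN; have [lt | le] := ltnP i N; first exact: pev_gy.
by rewrite !nth_default ?rmorph0 // (leq_trans _ le) ?(leq_trans _ KN) ?size_gy.
Qed.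

Lemma mpolyX_nz n (i : 'I_n) : 'X_i != 0 :> {mpoly F[n]}.
Proof. by rewrite -msupp_eq0 msuppX. Qed.

Lemma gx_nz K i : (i < K)%N -> (K <= N)%N -> (gx K)`_i != 0.
Proof.
move=> iK KN; have iN := leq_trans iK KN.
by rewrite coef_poly iK (insubT (fun i => (i < N)%N) iN) mpolyX_nz.
Qed.

Lemma gy_nz K i : (i < K)%N -> (K <= N)%N -> (gy K)`_i != 0.
Proof.
move=> iK KN; have iN := leq_trans iK KN.
by rewrite coef_poly iK (insubT (fun i => (i < N)%N) iN) mpolyX_nz.
Qed.

Lemma trunc_gx K L i : (i < K)%N -> (K <= N)%N -> trunc K L (gx K)`_i = (gx K)`_i.
Proof. by move=> iK KN; apply: pev_gx; rewrite ?size_gx // (leq_trans iK). Qed.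

Lemma trunc_gy K L i : (i < L)%N -> (L <= N)%N -> trunc K L (gy L)`_i = (gy L)`_i.
Proof. by move=> iK KN; apply: pev_gy; rewrite ?size_gy // (leq_trans iK). Qed.

Lemma hom_gx K L i j l : (l < K)%N -> (K <= N)%N -> hom K L i j i (gx K)`_l.
Proof.
move=> lK KN A io s f g sf sg; rewrite !pev_gxW ?coefZ //.
by rewrite (leq_trans (size_scale_leq _ _)).
Qed.

Lemma hom_gy K L i j l : (l < L)%N -> (L <= N)%N -> hom K L i j j (gy L)`_l.
Proof.
move=> lK KN A io s f g sf sg; rewrite !pev_gyW ?coefZ //.
by rewrite (leq_trans (size_scale_leq _ _)).
Qed.

Lemma homM K L i j a b phi psi :
  hom K L i j a phi -> hom K L i j b psi -> hom K L i j (a + b) (phi * psi).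
Proof.
by move=> h h' A io s f g sf sg; rewrite !rmorphM h // h' // exprD; ring.
Qed.

Lemma pev_trunc_take A (io : {rmorphism F -> A}) (f g : {poly A}) K L phi :
  pev io f g (trunc K L phi) = pev io (take_poly K f) (take_poly L g) phi.
Proof.
apply: pev_nat => [c|i iN|i iN]; first exact: pevC.
  rewrite coef_take_poly coef_poly; case: ifP => _; last exact: rmorph0.
  by rewrite (insubT (fun i => (i < N)%N) iN) pev_x.
rewrite coef_take_poly coef_poly; case: ifP => _; last exact: rmorph0.
by rewrite (insubT (fun i => (i < N)%N) iN) pev_y.
Qed.

Lemma take_polyZ A (s : A) K (f : {poly A}) : take_poly K (s *: f) = s *: take_poly K f.
Proof.
by apply/polyP => i; rewrite coefZ !coef_take_poly coefZ; case: ifP; rewrite ?mulr0.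
Qed.

Lemma hom_trunc K L K' L' i j e phi :
  hom K L i j e phi -> hom K' L' i j e (trunc K L phi).
Proof.
move=> h A io s f g _ _; rewrite !pev_trunc_take !take_polyZ.
by apply: h; apply: size_take_poly.
Qed.

Lemma root_value_nat A B (h : {rmorphism A -> B}) k (f g : {poly A}) (f' g' : {poly B}) :
  (forall i, h f`_i = f'`_i) -> (forall i, h g`_i = g'`_i) ->
  h (root_value k f g) = root_value k f' g'.
Proof.
move=> hf hg; rewrite rmorph_sum; apply: eq_bigr => j _.
by rewrite !rmorphM !rmorphXn rmorphN !hf hg.
Qed.

(** Modulo [rho], the polynomial f_1^k g is a multiple of f, so f_1^(k m) phi(f, g) = phi(f, f_1^k
    g) is 0. As f_1 is prime and does not divide [rho], it follows that [rho] divides phi; but [rho]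
    has degree k > n in f. *)
Lemma linear_vanish k n m phi : (1 < N)%N -> (k < N)%N -> (n < k)%N ->
  hom 2 k.+1 1 0 n phi -> hom 2 k.+1 0 1 m phi -> vanish 1 k phi -> law0 2 k.+1 phi.
Proof.
move=> N2 kN nk hx hy van.
pose f := gx 2; pose g := gy k.+1; pose rho := root_value k f g.
have sf : (size f <= 2)%N by exact: size_gx.
have sg : (size g <= k.+1)%N by exact: size_gy.
have rhoE A (io : {rmorphism F -> A}) (f' g' : {poly A}) :
    (size f' <= 2)%N -> (size g' <= k.+1)%N -> pev io f' g' rho = root_value k f' g'.
  by move=> sf' sg'; apply: root_value_nat => i; [apply: pev_gxW | apply: pev_gyW].
have tr0 : trunc 1 k.+1 rho != 0.
  have -> : trunc 1 k.+1 rho = root_value k (gx 1) g.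
    by apply: rhoE; rewrite ?size_gx //; apply: leq_trans (size_gx _) _.
  rewrite /root_value big_ord_recr /= big1 => [|i _].
    rewrite add0r subnn mulr1 mulf_neq0 ?gy_nz // expf_neq0 // oppr_eq0.
    by rewrite gx_nz // ltnW.
  by rewrite [X in X ^+ (k - i)]coef_poly /= expr0n subn_eq0 leqNgt ltn_ord /= !mulr0.
have trr : trunc 2 k.+1 rho = rho by apply: rhoE.
have rho0 : trunc 2 k.+1 rho != 0.
  apply: contraNneq tr0 => /law0P z; apply/eqP/law0P => A io f' g' sf' sg'.
  by apply: z => //; apply: leq_trans sf' _.
have x1E K : (1 < K)%N -> trunc K k.+1 f`_1 = f`_1.
  move=> lt; rewrite {1}/f coef_poly insubT pev_x.
  by rewrite /f !coef_poly lt !insubT.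
have [w0 E0] : exists w, f`_1 ^+ (k * m) * trunc 2 k.+1 phi = rho * trunc 2 k.+1 w.
  have [h sh hE] := root_valueP sf sg.
  have [w wE] : cgr rho (pev gen f (f`_1 ^+ k *: g) phi) (pev gen f (f * h) phi).
    rewrite hE; apply: pev_cgr => i; first exact: cgr_refl.
    rewrite coefD coefC; case: eqP => _; last by rewrite addr0; apply: cgr_refl.
    by exists 1; rewrite mulr1.
  have z : pev gen f (f * h) phi = 0.
    have s1 : (size (1%R : {poly P}) <= 1)%N by rewrite size_poly1.
    by have := van _ gen f 1 h sf s1 sh; rewrite mulr1.
  have := hy _ gen (f`_1 ^+ k) f g sf sg; rewrite expr0 expr1 scale1r wE z add0r.
  move/(congr1 (trunc 2 k.+1)); rewrite !rmorphM !rmorphXn x1E // trr => E.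
  exists w; rewrite E exprM; congr (_ * _).
  by rewrite -/(trunc 2 k.+1 phi) [RHS](pev_trunc gen phi (size_gx 2) (size_gy k.+1)).
(* The factors f_1 are cancelled one at a time: setting f_1 = 0 in the equation shows that the
   cofactor vanishes there, hence is divisible by f_1. *)
have cancel e w : f`_1 ^+ e * trunc 2 k.+1 phi = rho * trunc 2 k.+1 w ->
    exists w', trunc 2 k.+1 phi = rho * trunc 2 k.+1 w'.
  elim: e w => [|e IHe] w E; first by exists w; rewrite -E mul1r.
  have [psi psiE] := split_x k.+1 w N2.
  have z : trunc 1 k.+1 w = 0.
    have := congr1 (trunc 1 k.+1) E; rewrite exprS !rmorphM.
    have -> : trunc 1 k.+1 f`_1 = 0.
      by rewrite /f coef_poly insubT pev_x coef_poly.
    rewrite !mul0r => /esym/eqP; rewrite mulf_eq0 (negPf tr0) /= => /eqP.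
    rewrite [trunc 1 k.+1 (trunc _ _ _)]pev_trunc ?size_gy //.
    exact: leq_trans (size_gx 1) _.
  have := psiE _ gen f g sf sg; rewrite -/(trunc 2 k.+1 w).
  have -> : take_poly 1 f = gx 1.
    by apply/polyP => i; rewrite coef_take_poly !coef_poly; case: i => [|[|i]].
  rewrite -/(trunc 1 k.+1 w) z add0r -/(trunc 2 k.+1 psi) => wE.
  apply: (IHe psi).
  have E' : f`_1 * (f`_1 ^+ e * trunc 2 k.+1 phi) = f`_1 * (rho * trunc 2 k.+1 psi).
    by rewrite mulrA -exprS E wE mulrCA.
  by move: E'; apply: mulfI; apply: gx_nz.
have [w wE] := cancel _ _ E0.
have wL A (io : {rmorphism F -> A}) (f' g' : {poly A}) :
    (size f' <= 2)%N -> (size g' <= k.+1)%N ->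
    pev io f' g' phi = pev io f' g' rho * pev io f' g' w.
  move=> sf' sg'; rewrite -(pev_trunc io phi sf' sg') wE rmorphM.
  by rewrite (pev_trunc io w sf' sg').
have hrho : hom 2 k.+1 1 0 k rho.
  move=> A io s f' g' sf' sg'; rewrite expr1 expr0 scale1r !rhoE //; last first.
    by rewrite (leq_trans (size_scale_leq _ _)).
  rewrite /root_value mulr_sumr; apply: eq_bigr => j _; rewrite !coefZ.
  rewrite -mulrN !exprMn; have -> : s ^+ k = s ^+ j * s ^+ (k - j).
    by rewrite -exprD subnKC // -ltnS.
  by ring.
have [z|[]] := hom_divide wL hrho hx rho0; last by rewrite leqNgt nk.
by move=> A io f' g' sf' sg'; rewrite wL // z // mulr0.
Qed.

Definition resP p k : P := res p k (gx p.+1) (gy k.+1).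

Lemma pev_resP p k A (io : {rmorphism F -> A}) (f g : {poly A}) :
  (p < N)%N -> (k < N)%N -> (size f <= p.+1)%N -> (size g <= k.+1)%N ->
  pev io f g (resP p k) = res p k f g.
Proof.
by move=> pN kN sf sg; apply: res_nat => i; [apply: pev_gxW | apply: pev_gyW].
Qed.

Lemma trunc_resP p k : (p < N)%N -> (k < N)%N -> trunc p.+1 k.+1 (resP p k) != 0.
Proof.
move=> pN kN; have := res_one F p k; apply: contraNneq => /law0P.
move/(_ _ idfun 1 'X^k); rewrite pev_resP ?size_poly1 ?size_polyXn //.
by move=> ->.
Qed.

Lemma hom_resP p k i j : (p < N)%N -> (k < N)%N ->
  hom p.+1 k.+1 i j (i * k + j * p) (resP p k).
Proof.
move=> pN kN A io s f g sf sg.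
rewrite !pev_resP ?(leq_trans (size_scale_leq _ _)) // res_scale.
by rewrite -!exprM -exprD.
Qed.

(** Induction on the formal degree of f, then on the degree n in f. Where f has leading coefficient
    0, phi vanishes together with the leading coefficient of g; the quotient by the latter is a
    multiple of the resultant of smaller degree, and [res_recl] makes phi there a multiple of the
    full resultant. Subtracting this multiple leaves the leading coefficient of f times a polynomial
    of degree n - 1 in f that still vanishes on common factors. At q = 0 the vanishing carries no
    information on the power of f_0, whence the condition on n. *)
Lemma resultant_divides q k n m phi : (0 < k)%N -> (q < N)%N -> (k < N)%N ->
  (q = 0%N -> (k <= n)%N) ->
  hom q.+1 k.+1 1 0 n phi -> hom q.+1 k.+1 0 1 m phi -> vanish q k phi ->
  exists chi, forall A (io : {rmorphism F -> A}) (f g : {poly A}),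
    (size f <= q.+1)%N -> (size g <= k.+1)%N ->
    pev io f g phi = res q k f g * pev io f g chi.
Proof.
case: k => [//|k] _ + kN.
elim: q n m phi => [|q IHq] n m phi qN kn hx hy van.
  (* Here f is the constant f_0, the resultant is f_0^(k + 1) and phi = f_0^n phi(1, g). *)
  exists (((gx 1)`_0) ^+ (n - k.+1) * pev gen 1 (gy k.+2) phi) => A io f g sf sg.
  have fE : f = f`_0 *: 1 by rewrite -mul_polyC mulr1; apply: size1_polyC.
  have s1 : (size (1%R : {poly A}) <= 1)%N by rewrite size_poly1.
  rewrite rmorphM rmorphXn pev_gxW //.
  have -> : pev io f g (pev gen 1 (gy k.+2) phi) = pev io 1 g phi.
    apply: pev_nat => [c|i _|i iN]; first exact: pevC.
      by rewrite !coef1 rmorph_nat.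
    exact: pev_gy.
  have := hx _ io f`_0 1 g s1 sg; rewrite expr1 expr0 scale1r -fE => ->.
  have -> : res 0 k.+1 f g = f`_0 ^+ k.+1 by rewrite [in LHS](size1_polyC sf) res_0.
  by rewrite mulrA -exprD subnKC //; apply: kn.
have kN1 := ltnW kN; pose R1 := resP q.+1 k.+1.
have red n' psi0 : hom q.+2 k.+2 1 0 n' psi0 -> hom q.+2 k.+2 0 1 m psi0 ->
    vanish q.+1 k.+1 psi0 -> exists chi psi,
    (forall A (io : {rmorphism F -> A}) (f g : {poly A}),
      (size f <= q.+2)%N -> (size g <= k.+2)%N ->
      pev io f g psi0 = pev io f g R1 * pev io f g chi + f`_q.+1 * pev io f g psi) /\
    (law0 q.+2 k.+2 psi \/ (0 < n')%N /\ [/\ hom q.+2 k.+2 1 0 n'.-1 psi,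
      hom q.+2 k.+2 0 1 m psi & vanish q.+1 k.+1 psi]).
  move=> {hx hy van phi n kn} hx hy van.
  have triv : law0 q.+2 k.+2 psi0 -> exists chi psi,
    (forall A (io : {rmorphism F -> A}) (f g : {poly A}),
      (size f <= q.+2)%N -> (size g <= k.+2)%N ->
      pev io f g psi0 = pev io f g R1 * pev io f g chi + f`_q.+1 * pev io f g psi) /\
    (law0 q.+2 k.+2 psi \/ (0 < n')%N /\ [/\ hom q.+2 k.+2 1 0 n'.-1 psi,
      hom q.+2 k.+2 0 1 m psi & vanish q.+1 k.+1 psi]).
    move=> z; exists 0, 0; split; last by left=> A io f g _ _; rewrite rmorph0.
    by move=> A io f g sf sg; rewrite z // !rmorph0 !mulr0 addr0.
  (* The induction hypothesis is used at [q], and at q = 0 it requires k + 1 <= n'; below this bound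
     [linear_vanish] shows that [psi0] is 0. *)
  have [q0 | kn] : (q = 0%N /\ (n' < k.+1)%N) \/ (q = 0%N -> (k.+1 <= n')%N).
    by case: (posnP q) => [-> | q_gt0]; last (by right=> q0; rewrite q0 in q_gt0);
       case: (ltnP n' k.+1); [left | right].
  - apply: triv; have [q00 lt] := q0; rewrite q00 in hx hy van qN *.
    exact: linear_vanish lt hx hy van.
  have [phi1 phi1E0] := split_y q.+1 psi0 kN.
  have phi1E A (io : {rmorphism F -> A}) (f g : {poly A}) :
      (size f <= q.+1)%N -> (size g <= k.+2)%N ->
      pev io f g psi0 = pev io f g (gy k.+2)`_k.+1 * pev io f g phi1.
    move=> sf sg; rewrite phi1E0 // pev_gyW //.
    (* When both leading coefficients vanish, 1 is a common factor of formal degree 1: the forms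
       have a common root at infinity. *)
    have := van _ io 1 f (take_poly k.+1 g); rewrite !mul1r => ->; first by rewrite add0r.
    - by rewrite size_poly1.
    - exact: sf.
    - exact: size_take_poly.
  have hxr : hom q.+1 k.+2 1 0 n' psi0.
    by move=> A io s f g sf sg; apply: hx => //; apply: leqW.
  have hyr : hom q.+1 k.+2 0 1 m psi0.
    by move=> A io s f g sf sg; apply: hy => //; apply: leqW.
  have ynz : trunc q.+1 k.+2 (gy k.+2)`_k.+1 != 0 by rewrite trunc_gy ?gy_nz.
  have hx1 := hom_divide phi1E (@hom_gy q.+1 k.+2 1 0 k.+1 (ltnSn k.+1) kN) hxr ynz.
  have hy1 := hom_divide phi1E (@hom_gy q.+1 k.+2 0 1 k.+1 (ltnSn k.+1) kN) hyr ynz.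
  have [chi1 [chi1E chi1x chi1y]] : exists chi1, [/\
      forall A (io : {rmorphism F -> A}) (f g : {poly A}),
        (size f <= q.+1)%N -> (size g <= k.+2)%N ->
        pev io f g phi1 = pev io f g (resP q k.+1) * pev io f g chi1,
      hom q.+2 k.+2 1 0 n' (R1 * trunc q.+1 k.+2 chi1) &
      hom q.+2 k.+2 0 1 m (R1 * trunc q.+1 k.+2 chi1)].
    have triv1 : law0 q.+1 k.+2 phi1 -> exists chi1, [/\
      forall A (io : {rmorphism F -> A}) (f g : {poly A}),
        (size f <= q.+1)%N -> (size g <= k.+2)%N ->
        pev io f g phi1 = pev io f g (resP q k.+1) * pev io f g chi1,
      hom q.+2 k.+2 1 0 n' (R1 * trunc q.+1 k.+2 chi1) &
      hom q.+2 k.+2 0 1 m (R1 * trunc q.+1 k.+2 chi1)].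
      move=> z; exists 0; split=> [A io f g sf sg||].
      - by rewrite z // rmorph0 mulr0.
      - by apply: hom0 => A io f g _ _; rewrite rmorph0 mulr0 rmorph0.
      - by apply: hom0 => A io f g _ _; rewrite rmorph0 mulr0 rmorph0.
    case: hx1 => [/triv1 // | [_ hx1]]; case: hy1 => [/triv1 // | [m_gt0 hy1]].
    rewrite subn0 in hx1.
    have van1 : vanish q k.+1 phi1.
      have [q0 | q_gt0] := posnP q; last first.
        apply: vanish_y q_gt0 _ _ => [A io l f g sl sf sg|A io f g sf sg].
          by apply: van => //; apply: leqW.
        by rewrite phi1E // pev_gyW.
      move=> A io l f g sl sf sg.
      have f0 : f = 0 by apply/eqP; rewrite -size_poly_eq0 -leqn0 -q0.
      have s0 : (size (0%R : {poly A}) <= q.+1)%N by rewrite size_poly0.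
      have := hx1 _ io 0 0 (l * g) s0 (size_lM sl sg).
      rewrite expr1 expr0 scale0r scale1r f0 mulr0 => ->.
      by rewrite expr0n eqn0Ngt (leq_trans _ (kn q0)) // mul0r.
    have [chi1 chi1E] := IHq _ _ _ (ltnW qN) kn hx1 hy1 van1.
    have chi1E' A (io : {rmorphism F -> A}) (f g : {poly A}) :
        (size f <= q.+1)%N -> (size g <= k.+2)%N ->
        pev io f g phi1 = pev io f g (resP q k.+1) * pev io f g chi1.
      by move=> sf sg; rewrite chi1E // pev_resP // ltnW.
    exists chi1; split=> //.
      have := hom_divide chi1E' (@hom_resP q k.+1 1 0 (ltnW qN) kN) hx1 (trunc_resP (ltnW qN) kN).
      rewrite mul1n mul0n addn0 => -[z | [le h]].
        by apply: hom0 => A io f g sf sg; rewrite rmorphM pev_trunc_take z ?mulr0 ?size_take_poly.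
      rewrite -(subnKC le); apply: homM; last exact: hom_trunc h.
      by have := @hom_resP q.+1 k.+1 1 0 qN kN; rewrite mul1n mul0n addn0.
    have := hom_divide chi1E' (@hom_resP q k.+1 0 1 (ltnW qN) kN) hy1 (trunc_resP (ltnW qN) kN).
    rewrite mul1n mul0n add0n => -[z | [le h]].
      by apply: hom0 => A io f g sf sg; rewrite rmorphM pev_trunc_take z ?mulr0 ?size_take_poly.
    have -> : m = (q.+1 + (m - 1 - q))%N by lia.
    apply: homM; last exact: hom_trunc h.
    by have := @hom_resP q.+1 k.+1 0 1 qN kN; rewrite mul1n mul0n add0n.
  (* [eps] compensates the sign in [res_recl]; the truncation frees [chi1] from the leading
     coefficient of f, so that homogeneity extends to pairs of full size. *)
  pose eps : P := (-1) ^+ k.+1; pose chi2 := eps * trunc q.+1 k.+2 chi1.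
  pose psi2 := psi0 - R1 * chi2.
  have homeps i j e phi : hom q.+2 k.+2 i j e phi -> hom q.+2 k.+2 i j e (eps * phi).
    move=> h A io s f g sf sg; rewrite !rmorphM h // rmorphXn rmorphN1.
    by rewrite rmorphXn rmorphN1 mulrCA.
  have hx2 : hom q.+2 k.+2 1 0 n' psi2.
    by apply: homB => //; rewrite /chi2 mulrCA; apply: homeps.
  have hy2 : hom q.+2 k.+2 0 1 m psi2.
    by apply: homB => //; rewrite /chi2 mulrCA; apply: homeps.
  have van2 : vanish q.+1 k.+1 psi2.
    move=> A io l f g sl sf sg; rewrite rmorphB van // rmorphM pev_resP ?size_lM //.
    by rewrite res_common // mul0r subr0.
  have [psi psiE0] := split_x k.+2 psi2 qN.
  have psiE A (io : {rmorphism F -> A}) (f g : {poly A}) :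
      (size f <= q.+2)%N -> (size g <= k.+2)%N ->
      pev io f g psi2 = f`_q.+1 * pev io f g psi.
    move=> sf sg; rewrite psiE0 // -[RHS]add0r; congr (_ + _).
    set f' := take_poly _ _; have sf' : (size f' <= q.+1)%N by apply: size_take_poly.
    rewrite rmorphB !rmorphM phi1E // chi1E // pev_gyW //.
    have -> : pev io f' g R1 = (-1) ^+ k.+1 * g`_k.+1 * res q k.+1 f' g.
      by rewrite -res_recl //; apply: pev_resP => //; apply: leqW.
    rewrite pev_resP // ?rmorphXn ?rmorphN1.
      rewrite (pev_trunc io chi1 sf' sg).
      have key (a b c e : A) : a * (b * c) - e * a * b * (e * c) =
          (1 - e ^+ 2) * (a * (b * c)) by ring.
      by rewrite key sqrr_sign subrr mul0r.
    exact: ltnW.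
  exists chi2, psi; split=> [A io f g sf sg|].
    have <- : pev io f g (R1 * chi2) = pev io f g R1 * pev io f g chi2.
      exact: rmorphM.
    by rewrite -psiE // /psi2 rmorphB [RHS]addrC subrK.
  have psiE' A (io : {rmorphism F -> A}) (f g : {poly A}) :
      (size f <= q.+2)%N -> (size g <= k.+2)%N ->
      pev io f g psi2 = pev io f g (gx q.+2)`_q.+1 * pev io f g psi.
    by move=> sf sg; rewrite psiE // pev_gxW.
  have xnz : trunc q.+2 k.+2 (gx q.+2)`_q.+1 != 0 by rewrite trunc_gx ?gx_nz.
  have := hom_divide psiE' (@hom_gx q.+2 k.+2 1 0 q.+1 (ltnSn q.+1) qN) hx2 xnz.
  have := hom_divide psiE' (@hom_gx q.+2 k.+2 0 1 q.+1 (ltnSn q.+1) qN) hy2 xnz.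
  case=> [z | [_ hy3]]; [by left | case=> [z | [n_gt0 hx3]]; [by left | right]].
  split=> //; split; first by rewrite -subn1.
    by rewrite subn0 in hy3.
  exact: vanish_x van2 psiE.
elim: n phi hx hy van kn => [|n IHn] phi hx hy van _.
  have [chi [psi [E [z|[]//]]]] := red _ _ hx hy van.
  exists chi => A io f g sf sg; rewrite E // z // mulr0 addr0.
  by rewrite pev_resP.
have [chi [psi [E [z|[_ [hx' hy' van']]]]]] := red _ _ hx hy van.
  exists chi => A io f g sf sg; rewrite E // z // mulr0 addr0.
  by rewrite pev_resP.
have [//|chi' chi'E] := IHn psi hx' hy' van'.
exists (chi + (gx q.+2)`_q.+1 * chi') => A io f g sf sg.
rewrite E // chi'E // pev_resP // rmorphD rmorphM pev_gxW //.
by ring.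
Qed.

End ResultantDivides.

(** * Functionals on tensor powers as polynomial functions *)

Section TensorEvaluation.
Context {F : fieldType} {I : finType} {V : vectType F}.
Implicit Types (A B : idomainType) (nu : 'Hom(tpow I V, F^o)).
Local Notation D := (\dim {:V}).
Local Notation idx := {dffun forall i : I, 'I_(\dim {:V})}.

Definition vb (s : idx) : tpow I V := pure (fun i => (vbasis {:V})`_(s i)).

Lemma tpow_sum (t : tpow I V) : t = \sum_(s : idx) (t s : F) *: vb s.
Proof. exact: tens_sum_basis. Qed.

Lemma vbE (s s' : idx) : (vb s s' : F) = (s' == s)%:R.
Proof. exact: (pure_basis (V := fun=> V)). Qed.

(* The value of the extension of scalars of nu at the tensor product of the
   vectors with coordinates given by the coefficients of the p i. *)
Definition tev A (io : {rmorphism F -> A}) nu (p : I -> {poly A}) : A :=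
  \sum_(s : idx) io (nu (vb s)) * \prod_i (p i)`_(s i).

Lemma tevP A (io : {rmorphism F -> A}) a nu nu' (p : I -> {poly A}) :
  tev io (a *: nu + nu') p = io a * tev io nu p + tev io nu' p.
Proof.
rewrite mulr_sumr -big_split; apply: eq_bigr => s _ /=.
by rewrite add_lfunE scale_lfunE rmorphD rmorphM mulrDl mulrA.
Qed.

Lemma tev0 A (io : {rmorphism F -> A}) (p : I -> {poly A}) : tev io 0 p = 0.
Proof. by apply: big1 => s _; rewrite zero_lfunE rmorph0 mul0r. Qed.

Lemma tev_nat A B (h : {rmorphism A -> B}) (io : {rmorphism F -> A})
    (io' : {rmorphism F -> B}) nu (p : I -> {poly A}) (p' : I -> {poly B}) :
  (forall c, h (io c) = io' c) -> (forall i j, (j < D)%N -> h (p i)`_j = (p' i)`_j) ->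
  h (tev io nu p) = tev io' nu p'.
Proof.
move=> hio hp; rewrite rmorph_sum; apply: eq_bigr => s _.
rewrite rmorphM hio rmorph_prod; congr (_ * _); apply: eq_bigr => i _.
exact: hp.
Qed.

Lemma eq_tev A (io : {rmorphism F -> A}) nu (p p' : I -> {poly A}) :
  p =1 p' -> tev io nu p = tev io nu p'.
Proof.
by move=> e; apply: eq_bigr => s _; congr (_ * _); apply: eq_bigr => i _; rewrite e.
Qed.

Definition upd A (p : I -> {poly A}) y q := fun i => if i == y then q else p i.

Lemma tev_upd A (io : {rmorphism F -> A}) nu (p : I -> {poly A}) y q t r :
  tev io nu (upd p y (q + t *: r)) =
  tev io nu (upd p y q) + t * tev io nu (upd p y r).
Proof.
rewrite mulr_sumr -big_split; apply: eq_bigr => s _ /=.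
rewrite !(bigD1 (P := xpredT) y) //= /upd eqxx coefD coefZ.
have E u : \prod_(i | i != y) (if i == y then u else p i)`_(s i) =
    \prod_(i | i != y) (p i)`_(s i).
  by apply: eq_bigr => i /negPf ->.
by rewrite !E; ring.
Qed.

Lemma nu_pure nu (v : I -> V) :
  nu (pure v) = \sum_(s : idx) (\prod_i coord (vbasis {:V}) (s i) (v i)) * nu (vb s).
Proof.
rewrite {1}(tpow_sum (pure v)) linear_sum; apply: eq_bigr => s _.
by rewrite linearZ /= ffunE.
Qed.

Lemma tev_alt A (io : {rmorphism F -> A}) nu (p : I -> {poly A}) x y :
  x != y -> (forall v : I -> V, v x = v y -> nu (pure v) = 0) ->
  p x = p y -> tev io nu p = 0.
Proof.
move=> ne alt pxy.
pose tau (s : idx) : idx := [ffun i => s (tperm x y i)].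
have tauK : involutive tau by move=> s; apply/ffunP => i; rewrite !ffunE tpermK.
pose w (s : idx) := \prod_i (p i)`_(s i).
have wtau s : w (tau s) = w s.
  rewrite /w (reindex_inj (@perm_inj _ (tperm x y))); apply: eq_bigr => i _.
  rewrite ffunE tpermK; congr (polyseq _)`_ _.
  by case: tpermP => [->|->|].
have atau s : nu (vb (tau s)) = - nu (vb s).
  pose e i := (vbasis {:V})`_(s i).
  pose g (a b : V) := nu (pure (fun i => if i == x then a else if i == y then b else e i)).
  have gl a b c : g (a + b) c = g a c + g b c.
    pose v0 i := if i == y then c else e i.
    have E z : g z c = nu (pure (@dfwith I (fun=> V) v0 x z)).
      congr (nu (pure _)); apply: boolp.funext => i.
      case: dfwithP => [|j nej]; first by rewrite eqxx.
      by rewrite /v0 eq_sym (negPf nej).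
    rewrite !E -linearD /=; congr (nu _).
    by have := @pure_multilinear F I (fun=> V) v0 x 1 a b; rewrite !scale1r.
  have gr a b c : g c (a + b) = g c a + g c b.
    pose v0 i := if i == x then c else e i.
    have E z : g c z = nu (pure (@dfwith I (fun=> V) v0 y z)).
      congr (nu (pure _)); apply: boolp.funext => i.
      case: dfwithP => [|j nej]; first by rewrite eqxx eq_sym (negPf ne).
      by rewrite /v0 [j == y]eq_sym (negPf nej).
    rewrite !E -linearD /=; congr (nu _).
    by have := @pure_multilinear F I (fun=> V) v0 y 1 a b; rewrite !scale1r.
  have gd a : g a a = 0 by apply: alt; rewrite eqxx eq_sym (negPf ne) eqxx.
  have : g (e x + e y) (e x + e y) = 0 by apply: gd.
  rewrite gl !gr !gd add0r addr0 => /eqP; rewrite addr_eq0 => /eqP E.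
  have -> : vb s = pure (fun i => if i == x then e x else if i == y then e y else e i).
    by congr pure; apply: boolp.funext => i; do 2?case: eqP => [->|_].
  rewrite -/(g _ _) E opprK; congr (nu (pure _)); apply: boolp.funext => i.
  rewrite ffunE; case: tpermP => [->|->|/eqP/negPf-> /eqP/negPf->] //; rewrite eqxx //.
  by rewrite eq_sym (negPf ne).
have adiag (s : idx) : s x = s y -> nu (vb s) = 0 by move=> e; apply: alt; rewrite e.
rewrite /tev (bigID (fun s : idx => s x < s y)%N) /=.
rewrite [X in _ + X](bigID (fun s : idx => s y < s x)%N) /=.
rewrite [X in _ + (_ + X)]big1 ?addr0 => [|s /andP[le1 le2]]; last first.
  by rewrite adiag ?rmorph0 ?mul0r //; apply: val_inj => /=; lia.
rewrite [X in _ + X](reindex_inj (inv_inj tauK)) /=.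
rewrite -[X in _ + X]opprK; apply/eqP; rewrite subr_eq0; apply/eqP.
rewrite -sumrN; apply: eq_big => [s|s _].
  rewrite !ffunE tpermL tpermR -leqNgt; apply/idP/andP => [lt|[] //].
  by split=> //; apply: ltnW.
by rewrite atau rmorphN -/(w s) -/(w (tau s)) wtau mulNr opprK.
Qed.

Section Content.
Context {J : finType} (rho : I -> J).

(** How often each basis vector occurs in each fibre of [rho]. Tuples have equal contents when a
    permutation preserving the fibres exchanges them, and [orb] is the corresponding orbit sum. *)
Definition cont (s : idx) : {ffun J -> {ffun 'I_D -> 'I_(#|I|.+1)}} :=
  [ffun j => [ffun v => inord #|[pred i | (rho i == j) && (s i == v)]|]].

Lemma contE s j v : cont s j v = #|[pred i | (rho i == j) && (s i == v)]| :> nat.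
Proof. by rewrite !ffunE inordK // ltnS; apply: max_card. Qed.

Definition orb c : tpow I V := \sum_(s : idx | cont s == c) vb s.

Lemma orbE c s : (orb c s : F) = (cont s == c)%:R.
Proof.
rewrite sum_ffunE; have [e | ne] := eqVneq (cont s) c.
  rewrite (bigD1 s) ?e //= vbE eqxx big1 ?addr0 // => s' /andP[_ ne].
  by rewrite vbE eq_sym (negPf ne).
rewrite big1 // => s' /eqP e; rewrite vbE; case: eqP => // ss'.
by rewrite ss' e eqxx in ne.
Qed.

(* Tensors symmetric under the permutations of I preserving rho. *)
Definition symt : {vspace tpow I V} := <<[seq orb c | c]>>%VS.

Lemma symtP (t : tpow I V) :
  reflect (forall s s' : idx, cont s = cont s' -> t s = t s') (t \in symt).
Proof.
apply: (iffP idP) => [/coord_span -> s s' e | H].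
  rewrite !sum_ffunE; apply: eq_bigr => i _; rewrite !ffunE; congr (_ *: _).
  have lt : (i < size [seq orb c | c])%N by rewrite size_image.
  have /mapP[c _ ->] := mem_nth 0 lt.
  by rewrite -[LHS]/(orb c s : F) -[RHS]/(orb c s' : F) !orbE e.
pose tc c : F := if [pick s | cont s == c] is Some s then t s else 0.
have -> : t = \sum_c tc c *: orb c.
  rewrite [LHS]tpow_sum (partition_big cont xpredT) //=; apply: eq_bigr => c _.
  rewrite scaler_sumr; apply: eq_bigr => s /eqP sc; congr (_ *: _).
  rewrite /tc; case: pickP => [s' /eqP s'c | /(_ s)]; last by rewrite sc eqxx.
  by apply: H; rewrite sc s'c.
apply: memv_suml => c _; apply/memvZ/memv_span/mapP; exists c => //.
by rewrite mem_enum.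
Qed.

Lemma mem_orb c : orb c \in symt.
Proof. by apply/symtP => s s' e; rewrite -[LHS]/(orb c s : F) -[RHS]/(orb c s' : F) !orbE e. Qed.

Lemma tev_cont A (io : {rmorphism F -> A}) nu (p : J -> {poly A}) :
  tev io nu (fun i => p (rho i)) =
  \sum_c io (nu (orb c)) * \prod_j \prod_(v < D) (p j)`_v ^+ (c j v).
Proof.
rewrite /tev (partition_big cont xpredT) //=; apply: eq_bigr => c _.
rewrite linear_sum rmorph_sum mulr_suml; apply: eq_bigr => s /eqP <-.
congr (_ * _); rewrite (partition_big rho xpredT) //=; apply: eq_bigr => j _.
rewrite (partition_big s xpredT) //=; apply: eq_bigr => v _.
rewrite contE -prodr_const; apply: eq_big => [i | i /andP[/eqP -> /eqP ->]] //.
Qed.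

Lemma tev_symt0 A (io : {rmorphism F -> A}) nu (p : J -> {poly A}) :
  (forall t, t \in symt -> nu t = 0) -> tev io nu (fun i => p (rho i)) = 0.
Proof.
by move=> z; rewrite tev_cont big1 // => c _; rewrite z ?mem_orb // rmorph0 mul0r.
Qed.

(** Evaluate at one generic vector per fibre: distinct contents give distinct monomials, so the
    value of [nu] at each orbit sum is a coefficient of the result. *)
Lemma tev_inj nu :
  (forall A (io : {rmorphism F -> A}) (p : J -> {poly A}),
    (forall j, (size (p j) <= D)%N) -> tev io nu (fun i => p (rho i)) = 0) ->
  forall t, t \in symt -> nu t = 0.
Proof.
move=> H.
pose M := #|{: J * 'I_D}|; pose P : idomainType := {mpoly F[M]}.
pose p j : {poly P} := \poly_(v < D)
  (if insub v is Some v' then 'X_(enum_rank (j, v')) else 0).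
have pE j (v : 'I_D) : (p j)`_v = 'X_(enum_rank (j, v)) by rewrite coef_poly ltn_ord valK.
pose mc (c : {ffun J -> {ffun 'I_D -> 'I_(#|I|.+1)}}) : 'X_{1..M} :=
  [multinom (c (enum_val i).1 (enum_val i).2 : nat) | i < M].
have mc_inj : injective mc.
  move=> c c' e; apply/ffunP => j; apply/ffunP => v; apply: val_inj => /=.
  have := congr1 (fun m : 'X_{1..M} => m (enum_rank (j, v))) e.
  by rewrite !mnmE enum_rankK.
have monE (c : {ffun J -> {ffun 'I_D -> 'I_(#|I|.+1)}}) : \prod_j \prod_(v < D) (p j)`_v ^+ (c j v) = 'X_[mc c].
  rewrite mpolyXE_id (reindex (@enum_rank _ : J * 'I_D -> 'I_M)) /=; last first.
    by apply: onW_bij; apply: enum_rank_bij.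
  rewrite pair_bigA /=; apply: eq_bigr => -[j v] _.
  by rewrite mnmE enum_rankK pE.
have nuc c : nu (orb c) = 0.
  have := H P (@mpolyC M F) p (fun j => size_poly _ _).
  rewrite tev_cont => /(congr1 (mcoeff (mc c))).
  rewrite mcoeff0 raddf_sum (bigD1 c) //= [X in _ + X]big1 ?addr0 => [<-|c' ne].
    by rewrite mcoeffCM monE mcoeffX eqxx mulr1.
  by rewrite mcoeffCM monE mcoeffX (inj_eq mc_inj) (negPf ne) mulr0.
move=> t /coord_span ->; rewrite linear_sum big1 // => i _; rewrite linearZ /=.
have lt : (i < size [seq orb c | c])%N by rewrite size_image.
by have /mapP[c _ ->] := mem_nth 0 lt; rewrite nuc scaler0.
Qed.

End Content.

End TensorEvaluation.

Section BaseChange.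
Context {F : fieldType} {V V2 : vectType F}.

(* The extension of scalars of g, in the coordinates of the chosen bases. *)
Definition lext (A : idomainType) (io : {rmorphism F -> A}) (g : 'Hom(V, V2))
    (f : {poly A}) : {poly A} :=
  \sum_(j < \dim {:V2})
    (\sum_(l < \dim {:V}) f`_l * io (coord (vbasis {:V2}) j (g (vbasis {:V})`_l))) *: 'X^j.

Lemma coef_lext (A : idomainType) (io : {rmorphism F -> A}) g f (j : 'I_(\dim {:V2})) :
  (lext io g f)`_j = \sum_(l < \dim {:V})
     f`_l * io (coord (vbasis {:V2}) j (g (vbasis {:V})`_l)).
Proof.
rewrite coef_sum (bigD1 j) //= [X in _ + X]big1 => [|i ne].
  by rewrite addr0 coefZ coefXn eqxx mulr1.
rewrite coefZ coefXn; case: eqP => [e|_]; last by rewrite mulr0.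
by case/eqP: ne; apply: val_inj.
Qed.

Lemma size_lext (A : idomainType) (io : {rmorphism F -> A}) g f :
  (size (lext io g f) <= \dim {:V2})%N.
Proof.
apply: leq_trans (size_sum _ _ _) _; apply/bigmax_leqP => j _.
by rewrite (leq_trans (size_scale_leq _ _)) // size_polyXn.
Qed.

Context {I : finType}.

Lemma sum_idx (W : vectType F) (T : nmodType)
    (G : {dffun forall i : I, 'I_(\dim {:W})} -> T) :
  \sum_s G s = \sum_(s : {ffun I -> 'I_(\dim {:W})}) G s.
Proof.
by apply: (reindex (fun s : {ffun I -> 'I_(\dim {:W})} => s : {dffun forall i : I, _}));
   apply: onW_bij; exists id.
Qed.

Lemma tev_lext (A : idomainType) (io : {rmorphism F -> A})
    (nu : 'Hom(tpow I V2, F^o)) (g : 'Hom(V, V2)) (p : I -> {poly A}) :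
  tev io (nu \o tmap (fun _ : I => g))%VF p = tev io nu (fun i => lext io g (p i)).
Proof.
rewrite /tev.
transitivity (\sum_(s : {dffun forall i : I, 'I_(\dim {:V})})
  \sum_(s' : {dffun forall i : I, 'I_(\dim {:V2})}) io (nu (vb s')) *
     \prod_i ((p i)`_(s i) * io (coord (vbasis {:V2}) (s' i) (g (vbasis {:V})`_(s i))))).
  apply: eq_bigr => s _; rewrite comp_lfunE /vb tmap_pure nu_pure rmorph_sum mulr_suml.
  apply: eq_bigr => s' _; rewrite rmorphM rmorph_prod big_split /=.
  by rewrite [X in X * _]mulrC -mulrA; congr (_ * _); rewrite mulrC.
rewrite exchange_big; apply: eq_bigr => s' _; rewrite -mulr_sumr; congr (_ * _).
rewrite sum_idx -(bigA_distr_bigA (fun i (l : 'I_(\dim {:V})) => (p i)`_l *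
  io (coord (vbasis {:V2}) (s' i) (g (vbasis {:V})`_l)))).
by apply: eq_bigr => i _; rewrite coef_lext.
Qed.

End BaseChange.

Section Model.
Context {F : fieldType} {I J : finType} {V W : vectType F}.
Variables (q : 'Hom(tpow I V, W)) (rho : I -> J).

(* A functional on the quotient q of a tensor power, as a polynomial law. *)
Definition mev (A : idomainType) (io : {rmorphism F -> A}) (f : 'Hom(W, F^o))
    (p : J -> {poly A}) : A :=
  tev io (f \o q)%VF (fun i => p (rho i)).

Lemma mev_nat (A B : idomainType) (h : {rmorphism A -> B}) (io : {rmorphism F -> A})
    (io' : {rmorphism F -> B}) f (p : J -> {poly A}) (p' : J -> {poly B}) :
  (forall c, h (io c) = io' c) ->
  (forall i j, (j < \dim {:V})%N -> h (p i)`_j = (p' i)`_j) ->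
  h (mev io f p) = mev io' f p'.
Proof. by move=> hio hp; apply: tev_nat => // i j; apply: hp. Qed.

Lemma mevP (A : idomainType) (io : {rmorphism F -> A}) a f f' (p : J -> {poly A}) :
  mev io (a *: f + f') p = io a * mev io f p + mev io f' p.
Proof. by rewrite /mev comp_lfunDl -comp_lfunZl tevP. Qed.

Lemma mev0 (A : idomainType) (io : {rmorphism F -> A}) (p : J -> {poly A}) :
  mev io 0 p = 0.
Proof. by rewrite /mev comp_lfun0l tev0. Qed.

Hypothesis q_surj : (q @: symt rho)%VS = fullv.

Lemma mev_inj f :
  (forall (A : idomainType) (io : {rmorphism F -> A}) (p : J -> {poly A}),
    (forall j, (size (p j) <= \dim {:V})%N) -> mev io f p = 0) -> f = 0.
Proof.
move=> z; apply/lfunP => w; rewrite zero_lfunE.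
have : w \in (q @: symt rho)%VS by rewrite q_surj memvf.
case/memv_imgP => t ts ->; rewrite -comp_lfunE.
exact: (tev_inj (rho := rho) (nu := (f \o q)%VF)) ts.
Qed.

(** On families that are constant along the fibres, a functional is seen only through its
    restriction to symmetric tensors, so equivariance of [q] on these tensors suffices. *)
Lemma mev_act (A : idomainType) (io : {rmorphism F -> A}) (g : 'End(V)) (gW : 'End(W))
    f (p : J -> {poly A}) :
  (forall t, t \in symt rho -> q (tmap (fun _ : I => g) t) = gW (q t)) ->
  mev io (f \o gW)%VF p = mev io f (fun j => lext io g (p j)).
Proof.
move=> E; rewrite /mev -(tev_lext io (f \o q)%VF g (fun i => p (rho i))).
apply/eqP; rewrite -subr_eq0; apply/eqP.
have <- := tev_symt0 (rho := rho) io (nu := ((-1) *: (f \o q \o tmap (fun=> g)) + (f \o gW \o q))%VF) p.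
  by rewrite tevP rmorphN1 mulN1r addrC.
move=> t ts; rewrite add_lfunE scale_lfunE !comp_lfunE E //.
by rewrite scaleN1r addNr.
Qed.

End Model.

Section ResultantTableaux.
Context {F : idomainType} {k : nat}.
Local Notation N := k.+1.
Implicit Types (A : idomainType) (phi chi : {mpoly F[N + N]}).

(** The resultant cancels where it is nonzero, but it may vanish at the given pair: invariance is
    proved at the generic pair with a generic parameter, then specialised. *)
Lemma shinv_divide chi phi : (forall A (io : {rmorphism F -> A}) (f g : {poly A}),
    (size f <= N)%N -> (size g <= N)%N ->
    pev io f g phi = res k k f g * pev io f g chi) ->
  shinv N phi -> shinv N chi.
Proof.
move=> E inv A io t f g sf sg.
have sgt (B : idomainType) (r : B) (a b : {poly B}) : (size a <= N)%N -> (size b <= N)%N ->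
    (size (b + r *: a)%R <= N)%N.
  by move=> sa sb; rewrite (leq_trans (size_polyD _ _)) // geq_max sb (leq_trans (size_scale_leq _ _)).
have key (B : idomainType) (ioB : {rmorphism F -> B}) (r : B) (a b : {poly B}) :
    (size a <= N)%N -> (size b <= N)%N -> res k k a b != 0 ->
    pev ioB a (b + r *: a) chi = pev ioB a b chi.
  move=> sa sb Rn; apply: (mulfI Rn); rewrite -[in LHS](res_shift k r a b) -!E ?sgt //.
  exact: inv.
have [B [ioB [f' [g' [t' [h [[sf' sg' Rn] hio hx hy ht]]]]]]] : exists (B : idomainType)
    (ioB : {rmorphism F -> B}) (f' g' : {poly B}) (t' : B) (h : {rmorphism B -> A}),
    [/\ [/\ (size f' <= N)%N, (size g' <= N)%N & res k k f' g' != 0],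
      forall c, h (ioB c) = io c, forall i, (i < N)%N -> h f'`_i = f`_i,
      forall i, (i < N)%N -> h g'`_i = g`_i & h t' = t].
  pose P : idomainType := {mpoly F[N + N]}.
  exists {poly P}, (polyC \o @gen F N), (map_poly polyC (@gx F N N)).
  exists (map_poly polyC (@gy F N N)), 'X, (psubst (pev io f g) t).
  split=> [|c|i iN|i iN|]; last exact: psubstX.
  - split; [exact: leq_trans (size_poly _ _) (size_gx _) |
            exact: leq_trans (size_poly _ _) (size_gy _) |].
    rewrite -(@res_nat _ _ polyC k k (@gx F N N) (@gy F N N)) => [|i|i]; rewrite ?coef_map //.
    rewrite polyC_eq0; have := @trunc_resP F N k k (ltnSn _) (ltnSn _).
    by apply: contraNneq => z; rewrite /resP z rmorph0.
  - by rewrite psubstC pevC.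
  - by rewrite coef_map psubstC pev_gx.
  - by rewrite coef_map psubstC pev_gy.
have <- : h (pev ioB f' g' chi) = pev io f g chi by apply: pev_nat.
rewrite -(key _ ioB t') //; symmetry; apply: pev_nat => // i iN.
by rewrite !coefD !coefZ rmorphD rmorphM ht hx ?hy.
Qed.

(** The quotient by the resultant inherits invariance and has degree (n - k, m - k), so it is a
    combination of tableaux; when k > m the degrees leave only 0. *)
Lemma shinv_resultant n m phi : (0 < k)%N -> (m <= n)%N ->
  hom N N 1 0 n phi -> hom N N 0 1 m phi -> shinv N phi -> vanish k k phi ->
  law0 N N phi \/ (k <= m)%N /\
  exists2 L, all (fun c => tabok N (n - k)%N (m - k)%N c.2) L &
    forall A (io : {rmorphism F -> A}) (f g : {poly A}),
      (size f <= N)%N -> (size g <= N)%N ->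
      pev io f g phi = res k k f g * tabval io f g L.
Proof.
move=> k0 le_mn hx hy inv van.
have [|chi chiE] := @resultant_divides F N k k n m phi k0 (ltnSn _) (ltnSn _) _ hx hy van.
  by move=> z; rewrite z in k0.
have E A (io : {rmorphism F -> A}) (f g : {poly A}) : (size f <= N)%N -> (size g <= N)%N ->
    pev io f g phi = pev io f g (@resP F N k k) * pev io f g chi.
  by move=> sf sg; rewrite chiE // pev_resP.
have Rn := @trunc_resP F N k k (ltnSn _) (ltnSn _).
have z0 : law0 N N chi -> law0 N N phi.
  by move=> z A io f g sf sg; rewrite E // z ?mulr0.
have := hom_divide E (@hom_resP F N k k 1 0 (ltnSn _) (ltnSn _)) hx Rn.
rewrite mul1n mul0n addn0 => -[/z0 | [_ hx']]; first by left.
have := hom_divide E (@hom_resP F N k k 0 1 (ltnSn _) (ltnSn _)) hy Rn.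
rewrite mul1n mul0n add0n => -[/z0 | [le_km hy']]; first by left.
right; split=> //.
have [L okL LE] := shift_invariants (leqnn N) (leq_sub2r k le_mn) hx' hy' (shinv_divide chiE inv).
by exists L => // A io f g sf sg; rewrite chiE // LE.
Qed.

End ResultantTableaux.

(** * Symmetric tensors *)

Lemma card_contents D d N r : D = d.+1 -> (r <= N)%N ->
  #|[set c : {ffun 'I_D -> 'I_N.+1} | (\sum_v c v)%N == r]| = 'C(d + r, r).
Proof.
move=> -> {D} rN; rewrite -['C(_, r)]bin_sub ?leq_addl // addnK -card_ord_partitions.
pose f (t : d.+1.-tuple 'I_r.+1) : {ffun 'I_d.+1 -> 'I_N.+1} :=
  [ffun v => widen_ord (rN : (r.+1 <= N.+1)%N) (tnth t v)].
have f_inj : injective f.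
  move=> t u e; apply: eq_from_tnth => v; apply: val_inj => /=.
  by have := congr1 (fun c : {ffun _ -> _} => val (c v)) e; rewrite !ffunE.
rewrite -(card_imset _ f_inj); apply: eq_card => c; rewrite inE.
apply/eqP/imsetP => [sc | [t]]; last first.
  rewrite inE big_tuple => /eqP <- ->.
  by apply: eq_bigr => v _; rewrite ffunE.
have cr v : (c v < r.+1)%N by rewrite ltnS -sc (bigD1 v) //= leq_addr.
exists [tuple Ordinal (cr v) | v < d.+1].
  by rewrite inE big_tuple -[X in _ == X]sc; apply/eqP/eq_bigr => v _; rewrite tnth_mktuple.
by apply/ffunP => v; rewrite ffunE tnth_mktuple; apply: val_inj.
Qed.

Lemma count_enum (T : finType) (P : pred T) : count P (enum T) = #|P|.
Proof. by rewrite -size_filter cardE enumT. Qed.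

Section SymmetricDimension.
Context {F : fieldType} {I J : finType} {V : vectType F} (rho : I -> J).
Local Notation D := (\dim {:V}).
Local Notation idx := {dffun forall i : I, 'I_(\dim {:V})}.
Local Notation cnt := (@cont F I V J rho).
Local Notation contents := {ffun J -> {ffun 'I_D -> 'I_(#|I|.+1)}}.

Lemma orb_free (a : contents -> F) : \sum_c a c *: orb rho c = 0 :> tpow I V ->
  forall s, a (cnt s) = 0.
Proof.
move=> /(congr1 (fun t : tpow I V => t)) /ffunP z s.
have := z s; rewrite sum_ffunE ffunE (bigD1 (cnt s)) //= big1 ?addr0 => [<-|c ne].
  by rewrite ffunE -[X in _ *: X]/(orb rho (cnt s) s : F) orbE eqxx [RHS]mulr1.
by rewrite ffunE -[X in _ *: X]/(orb rho c s : F) orbE eq_sym (negPf ne) [LHS]mulr0.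
Qed.

Lemma dim_symt_cont : \dim (@symt F I V J rho) = #|[set cnt s | s : idx]|.
Proof.
set S := [set _ | _ in _]; pose X := [tuple orb rho (enum_val i) | i < #|S|].
have -> : symt rho = <<X>>%VS.
  apply/eqP; rewrite eqEsubv; apply/andP; split; apply/span_subvP => t.
    case/mapP => c _ ->; have [cS | /negP cS] := boolP (c \in S).
      apply/memv_span/tnthP; exists (enum_rank_in cS c).
      by rewrite tnth_mktuple enum_rankK_in.
    rewrite [orb rho c]big1 ?mem0v // => s /eqP e; case: cS.
    by apply/imsetP; exists s.
  by case/tnthP => i ->; rewrite tnth_mktuple; apply: mem_orb.
suff : free X by rewrite /free => /eqP ->; rewrite size_tuple.
apply/freeP => k z i.
pose a c := if [pick i | enum_val i == c] is Some i then k i else 0.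
have aE j : a (enum_val j) = k j.
  rewrite /a; case: pickP => [j' /eqP/enum_val_inj -> // | /(_ j)].
  by rewrite eqxx.
have /imsetP[s _ e] := enum_valP i; rewrite -aE e; apply: (@orb_free a).
rewrite -[RHS]z (bigID (mem S)) /= [X in _ + X]big1 ?addr0 => [|c cS]; last first.
  rewrite /a; case: pickP => [j /eqP ej | _]; last by rewrite scale0r.
  by rewrite -ej enum_valP in cS.
rewrite (reindex_onto (@enum_val _ (mem S)) (enum_rank_in (enum_valP i))) => [|c cS]; last first.
  by rewrite enum_rankK_in.
apply: eq_big => [j|j _]; first by rewrite enum_valP enum_valK_in eqxx.
by rewrite aE (nth_map i) ?size_enum_ord // nth_ord_enum.
Qed.

Definition fiber j := [seq i <- enum I | rho i == j].

Lemma cont_onto d (c : contents) : D = d.+1 ->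
  (forall j, \sum_v c j v = size (fiber j))%N -> exists s : idx, cnt s = c.
Proof.
move=> eD sc; have x0 : 'I_D by rewrite eD; apply: ord0.
(* [w j] lists each basis index as often as prescribed for j, and [s] writes this list along the
   fibre of j. *)
pose w j := flatten [seq nseq (c j v) v | v <- enum 'I_D].
have cw j v : count_mem v (w j) = c j v.
  rewrite count_flatten -map_comp sumnE big_map big_enum /= (bigD1 v) //=.
  rewrite count_nseq /= eqxx mul1n big1 ?addn0 // => u ne.
  by rewrite count_nseq /= (negPf ne).
have sw j : size (w j) = size (fiber j).
  rewrite -sc size_flatten /shape -map_comp sumnE big_map big_enum /=.
  by apply: eq_bigr => v _; rewrite size_nseq.
pose s : idx := [ffun i => nth x0 (w (rho i)) (index i (fiber (rho i)))].
exists s; apply/ffunP => j; apply/ffunP => v; apply: val_inj.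
rewrite /= contE -cw.
have -> : w j = [seq s i | i <- fiber j].
  apply: (@eq_from_nth _ x0); first by rewrite size_map.
  move=> k; rewrite sw => kw.
  have [i0 _] : exists i : I, True by move: kw; case: (fiber j) => // i; exists i.
  rewrite (nth_map i0) //; have := mem_nth i0 kw; rewrite mem_filter => /andP[/eqP e _].
  by rewrite ffunE e index_uniq // filter_uniq ?enum_uniq.
rewrite count_map count_filter count_enum; apply: eq_card => i.
by rewrite !inE andbC.
Qed.

Lemma dim_symt d : D = d.+1 ->
  \dim (@symt F I V J rho) = (\prod_j 'C(d + size (fiber j), size (fiber j)))%N.
Proof.
move=> eD; rewrite dim_symt_cont.
pose Fm j := [set c : {ffun 'I_D -> 'I_(#|I|.+1)} | (\sum_v c v)%N == size (fiber j)].
rewrite (_ : #|_| = #|family Fm|); last first.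
  apply: eq_card => c; apply/imsetP/familyP => [[s _ ->] j | H].
    rewrite inE; apply/eqP; under eq_bigr do rewrite contE -sum1_card.
    transitivity (\sum_(i | rho i == j) 1)%N.
      by rewrite [RHS](partition_big s xpredT).
    by rewrite sum1_card size_filter count_enum.
  have [|s e] := cont_onto (c := c) eD; last by exists s.
  by move=> j; have := H j; rewrite inE => /eqP.
rewrite card_family foldrE big_map big_enum /=; apply: eq_bigr => j _.
by apply: card_contents => //; rewrite size_filter count_enum max_card.
Qed.

End SymmetricDimension.

Section SymmetricTensors.
Context {F : fieldType} {r : nat} {V : vectType F}.
Local Notation idx := {dffun forall i : 'I_r, 'I_(\dim {:V})}.

Lemma tshuffleE (s : 'S_r) (t : tpow 'I_r V) (x : idx) :
  (tshuffle s t x : F) = t [ffun i => x (s^-1%g i)].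
Proof.
rewrite {1}(tpow_sum t) linear_sum sum_ffunE.
have vbs (y : idx) : tshuffle s (vb y) = vb [ffun i => y (s i)].
  by rewrite /vb tshuffle_pure; congr pure; apply: boolp.funext => i; rewrite ffunE.
pose y : idx := [ffun i => x (s^-1%g i)].
have ys : [ffun i => y (s i)] = x by apply/ffunP => i; rewrite !ffunE permK.
rewrite (bigD1 y) //= linearZ /= ffunE vbs ys -[X in _ *: X]/(vb x x : F) vbE eqxx.
rewrite [_ *: _]mulr1 big1 ?addr0 // => z ne; rewrite linearZ /= ffunE vbs.
rewrite -[X in _ *: X]/(vb _ x : F) vbE; case: eqP => [e|_]; last exact: mulr0.
by case/eqP: ne; apply/ffunP => i; rewrite ffunE e ffunE permKV.
Qed.

Lemma symtens_symt : symtens_space r V = symt (fun _ : 'I_r => tt).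
Proof.
apply/vspaceP => t; apply/idP/symtP => [|H].
  rewrite memvE => /subv_bigcapP tP x y e.
  have /tuple_permP[s es] : perm_eq [tuple x i | i < r] [tuple y i | i < r].
    apply/allP => v _; rewrite /= !count_map.
    have := congr1 (fun c : {ffun unit -> {ffun 'I_(\dim {:V}) -> 'I_(#|'I_r|.+1)}} =>
      val (c tt v)) e; rewrite /= !contE => E; apply/eqP.
    rewrite -!enumT !count_enum -[LHS]/(#|[pred i | (tt == tt) && (x i == v)]|) E.
    exact: eq_card.
  have xy i : x i = y (s i).
    by have := congr1 (fun w => tnth w i) (val_inj es); rewrite !tnth_mktuple.
  have /fixedSpaceP ft : t \in fixedSpace (tshuffle s) by rewrite memvE; apply: tP.
  rewrite -[in LHS]ft -[LHS]/(tshuffle s t x : F) tshuffleE.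
  suff -> : [ffun i => x (s^-1%g i)] = y by []. apply/ffunP => i.
  by rewrite ffunE xy permKV.
rewrite memvE; apply/subv_bigcapP => s _; apply/fixedSpaceP; apply/ffunP => x.
rewrite -[LHS]/(tshuffle s t x : F) tshuffleE; apply: H; apply/ffunP => j; apply/ffunP => v.
apply: val_inj; rewrite /= !contE.
rewrite -(card_image (@perm_inj _ s^-1%g)) //=; apply: eq_card => i; rewrite !inE.
apply/imageP/idP => [[k] | xi].
  by rewrite !inE ffunE => xk ->.
by exists (s i); rewrite ?permK // !inE ffunE permK.
Qed.

Lemma dim_symtens d : \dim {:V} = d.+1 -> \dim {:symtens r V} = 'C(d + r, r).
Proof.
move=> eD; rewrite dimvf -[LHS]/(\dim (symtens_space r V)) symtens_symt (dim_symt _ eD).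
rewrite (big_pred1 tt) => [|[]//]; rewrite size_filter count_enum.
by congr ('C(_ + _, _)); rewrite -[RHS]card_ord; apply: eq_card.
Qed.

End SymmetricTensors.

Section RowSymmetric.
Context {F : fieldType} (la : seq nat) {V : vectType F}.
Local Notation row i := 'I_(nth 0%N la i).
Local Notation rowidx i := {dffun forall j : row i, 'I_(\dim {:V})}.
Local Notation idx := {dffun forall p : box la, 'I_(\dim {:V})}.

Definition rowpart (s : idx) (i : 'I_(size la)) : rowidx i := [ffun j => s (Tagged (fun i : 'I_(size la) => row i) j)].

Lemma row_incl_pure (t : forall i : 'I_(size la), symtens (nth 0%N la i) V) (s : idx) :
  (row_incl la V (pure t) s : F) = \prod_i (vsval (t i) (rowpart s i) : F).
Proof.
rewrite /row_incl comp_lfunE tmap_pure /merge tlift_pure; last exact: merge_fun_multilinear.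
by rewrite ffunE; apply: eq_bigr => i _; rewrite lfunE.
Qed.

Lemma cont_rowpart (s : idx) i v :
  cont (@tag _ _ : box la -> _) s i v =
  cont (fun _ : row i => tt) (rowpart s i) tt v :> nat.
Proof.
rewrite !contE -!sum1_card.
transitivity (\sum_(p : box la | (tag p == i) && (s p == v)) 1)%N => [//|].
transitivity (\sum_(i' | i' == i) \sum_(j : row i' | rowpart s i' j == v) 1)%N.
  rewrite sig_big_dep /=; apply: eq_bigl => -[i' j] /=; by rewrite ffunE.
by rewrite big_pred1_eq; apply: eq_bigl => j; rewrite !inE.
Qed.

(** The orbit sum of a content is the product over the rows of the orbit sums of the row contents,
    hence the image of a pure tensor of symmetric tensors. *)
Lemma limg_row_incl : limg (row_incl la V) = symt (@tag _ _ : box la -> _).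
Proof.
apply/eqP; rewrite eqEsubv; apply/andP; split.
  apply/subvP => _ /memv_imgP[x _ ->]; rewrite (tens_sum_basis x) linear_sum.
  apply: memv_suml => z _; rewrite linearZ /=; apply: memvZ; apply/symtP => s s' e.
  rewrite -[LHS]/(row_incl la V _ s : F) -[RHS]/(row_incl la V _ s' : F) !row_incl_pure.
  apply: eq_bigr => i _; set t := (vbasis _)`_ _.
  have /symtP : vsval t \in symt (fun _ : row i => tt).
    by rewrite -symtens_symt; apply: subvsP.
  apply; apply/ffunP => -[]; apply/ffunP => v.
  by apply: val_inj; rewrite /= -!cont_rowpart e.
apply/span_subvP => _ /mapP[c _ ->].
have [s0 sc|no] := pickP (fun s : idx => cont (@tag _ _ : box la -> _) s == c); last first.
  by rewrite [orb _ c]big_pred0 ?mem0v.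
pose o (i : 'I_(size la)) : tpow (row i) V := orb (fun=> tt) (cont (fun _ : row i => tt) (rowpart s0 i)).
pose t (i : 'I_(size la)) : symtens (nth 0%N la i) V := vsproj _ (o i).
suff -> : orb (@tag _ _ : box la -> _) c = row_incl la V (pure t) by apply/memv_img/memvf.
apply/ffunP => s; rewrite -[LHS]/(orb _ _ s : F) orbE -[RHS]/(row_incl la V _ s : F).
rewrite row_incl_pure; have E i : (vsval (t i) (rowpart s i) : F) =
    (cont (fun _ : row i => tt) (rowpart s i) == cont (fun _ : row i => tt) (rowpart s0 i))%:R.
  by rewrite vsprojK ?orbE // symtens_symt mem_orb.
under eq_bigr do rewrite E; rewrite -(eqP sc); case: eqP => [e | ne].
  rewrite big1 // => i _; case: eqP => // -[]; apply/ffunP => -[]; apply/ffunP => v.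
  by apply: val_inj; rewrite /= -!cont_rowpart e.
have [i nei] : exists i : 'I_(size la), cont (fun _ : row i => tt) (rowpart s i) !=
    cont (fun _ : row i => tt) (rowpart s0 i).
  apply/existsP; apply: contra_notT ne => /existsPn H.
  apply/ffunP => i; apply/ffunP => v; apply: val_inj; rewrite /= !cont_rowpart.
  by have := H i; rewrite negbK => /eqP ->.
by rewrite (bigD1 i) //= (negPf nei) mul0r.
Qed.

End RowSymmetric.

(** * Functionals on Weyl modules *)

Section ProductFunctional.
Context {F : fieldType} {I : finType} {V : I -> vectType F}.

Definition prodf (e : forall i, 'Hom(V i, F^o)) : 'Hom(tens V, F^o) :=
  tlift (fun v : forall i, V i => \prod_i (e i (v i) : F) : F^o).

Lemma prodf_pure e v : prodf e (pure v) = \prod_i (e i (v i) : F).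
Proof.
rewrite /prodf tlift_pure // => {}v i a x y.
rewrite !(bigD1 (P := xpredT) i) //= !dfwith_in linearP mulrDl -mulrA.
congr (a * (_ * _) + _ * _); apply: eq_bigr => j ji;
  by rewrite !dfwith_out // eq_sym.
Qed.

End ProductFunctional.

Section WeylModel.
Context {F : fieldType} (la : seq nat) {V : vectType F}.
Local Notation D := (\dim {:V}).
Local Notation tg := (@tag _ _ : box la -> 'I_(size la)).
Local Notation idx := {dffun forall p : box la, 'I_(\dim {:V})}.

(** Meant for row-symmetric tensors, where it is [col_proj]; elsewhere [vsproj] makes a choice
    without significance. *)
Definition qW : 'Hom(tpow (box la) V, weyl la V) :=
  (linfun (vsproj (limg (weyl_map la V))) \o col_proj la V)%VF.

Lemma limg_weyl_map : limg (weyl_map la V) = (col_proj la V @: symt tg)%VS.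
Proof. by rewrite /weyl_map limg_comp limg_row_incl. Qed.

Lemma vsval_qW t : t \in symt tg -> vsval (qW t) = col_proj la V t.
Proof.
by move=> ts; rewrite comp_lfunE lfunE vsprojK // limg_weyl_map memv_img.
Qed.

Lemma qW_surj : (qW @: symt tg)%VS = fullv.
Proof.
apply/eqP; rewrite eqEsubv subvf; apply/subvP => x _.
have : vsval x \in (col_proj la V @: symt tg)%VS by rewrite -limg_weyl_map subvsP.
case/memv_imgP => t ts xt; apply/memv_imgP; exists t => //.
by apply: val_inj; rewrite /= vsval_qW.
Qed.

Lemma symt_act (G : groupType) (rV : rep G V) g t : t \in symt tg ->
  tmap (fun=> rV g) t \in symt tg.
Proof.
rewrite -limg_row_incl => /memv_imgP[x _ ->].
rewrite -[tmap _ _](comp_lfunE (tpow_rep rV (box la) g)) -row_incl_act comp_lfunE.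
exact/memv_img/memvf.
Qed.

Lemma qW_act (G : groupType) (rV : rep G V) g t : t \in symt tg ->
  qW (tmap (fun=> rV g) t) = weyl_rep la rV g (qW t).
Proof.
move=> ts; apply: val_inj; rewrite /= vsval_qW ?symt_act // vsval_weyl_rep vsval_qW //.
by have := congr1 (fun f : 'Hom(_, _) => f t) (col_proj_act la rV g); rewrite !comp_lfunE.
Qed.

Lemma le_ncols (p : box la) : (tagged p < ncols la)%N.
Proof.
apply: leq_trans (ltn_ord (tagged p)) _.
exact: (leq_bigmax (F := fun i : 'I_(size la) => nth 0%N la i)).
Qed.

Definition colof (p : box la) : 'I_(ncols la) := Ordinal (le_ncols p).

Lemma colof_box j (a : 'I_#|col j|) : colof (col_box a) = j.
Proof. exact: val_inj. Qed.

Lemma box_columns (T : comNzRingType) (H : box la -> T) :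
  \prod_p H p = \prod_(j < ncols la) \prod_(a < #|col j|) H (col_box a).
Proof.
rewrite (partition_big colof xpredT) //=; apply: eq_bigr => j _.
rewrite -[RHS](@big_imset _ _ _ _ _ (@col_box la j) predT H) => [|a a' _ _ e]; last first.
  by apply: enum_val_inj; have := congr1 tg e.
apply: eq_bigl => p; apply/eqP/imsetP => [e | [a _ ->]]; last exact: colof_box.
have pj : tag p \in col j by rewrite inE -e /=; apply: ltn_ord.
exists (enum_rank_in pj (tag p)) => //; apply: box_eq; first by rewrite /= enum_rankK_in.
exact: (congr1 val e).
Qed.

Context (coef : 'I_(ncols la) -> bool -> F)
  (kk : 'I_(size la) -> 'I_(ncols la) -> bool -> 'I_D).

Hypothesis alt : forall j (w : 'I_#|col j| -> V) (a a' : 'I_#|col j|),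
  a' = a.+1 :> nat -> w a = w a' ->
  \sum_b coef j b * \prod_c coord (vbasis {:V}) (kk (enum_val c) j b) (w c) = 0.

Let cf (i : 'I_D) : 'Hom(V, F^o) := linfun (coord (vbasis {:V}) i : V -> F^o).

Let cfE i v : cf i v = coord (vbasis {:V}) i v.
Proof. by rewrite lfunE. Qed.

Let aj j : 'Hom(tpow 'I_#|col j| V, F^o) :=
  \sum_b coef j b *: prodf (fun c => cf (kk (enum_val c) j b)).

Let ajE j (w : 'I_#|col j| -> V) : aj j (pure w) =
  \sum_b coef j b * \prod_c coord (vbasis {:V}) (kk (enum_val c) j b) (w c).
Proof.
rewrite sum_lfunE; apply: eq_bigr => b _; rewrite scale_lfunE prodf_pure.
by congr (_ * _); apply: eq_bigr => c _; rewrite cfE.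
Qed.

Let ej j : 'Hom(extpow #|col j| V, F^o) := (aj j \o (qproj (extpow_rel #|col j| V))^-1)%VF.

Let ejE j t : ej j (qproj (extpow_rel #|col j| V) t) = aj j t.
Proof.
rewrite comp_lfunE; apply/eqP; rewrite -subr_eq0 -linearB -memv_ker.
set x := (_ - _); have : x \in extpow_rel #|col j| V.
  by rewrite -qproj_eq0 linearB /= limg_lfunVK ?subrr // limg_qproj memvf.
apply/subvP/spanset_min => _ [v [i [i' [e vi ->]]]].
by rewrite memv_ker ajE (alt e vi).
Qed.

Let ceps (eps : {ffun 'I_(ncols la) -> bool}) (p : box la) : 'I_D :=
  kk (tag p) (colof p) (eps (colof p)).

Let nu : 'Hom(tpow (box la) V, F^o) :=
  \sum_(eps : {ffun 'I_(ncols la) -> bool})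
    (\prod_j coef j (eps j)) *: prodf (fun p => cf (ceps eps p)).

Let nuE : nu = (prodf ej \o col_proj la V)%VF.
Proof.
apply: tens_ext => v; rewrite comp_lfunE col_proj_pure prodf_pure.
under [RHS]eq_bigr do rewrite ejE ajE.
rewrite bigA_distr_bigA sum_lfunE; apply: eq_bigr => eps _.
rewrite scale_lfunE prodf_pure big_split; congr (_ * _).
rewrite box_columns; apply: eq_bigr => j _; apply: eq_bigr => c _.
by rewrite cfE /ceps colof_box.
Qed.

(** On each column, the form with terms indexed by [b] vanishes on equal neighbours, so it descends
    to the exterior power; the product of these forms over the columns restricts to the Weyl module.
    Two terms are what a 2 x 2 determinant requires. *)
Lemma weyl_functional : exists lam : 'Hom(weyl la V, F^o),
  forall (A : idomainType) (io : {rmorphism F -> A}) (p : 'I_(size la) -> {poly A}),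
  mev qW tg io lam p =
  \prod_j \sum_b io (coef j b) * \prod_(i in col j) (p i)`_(kk i j b).
Proof.
exists (prodf ej \o linfun vsval)%VF => A io p.
have -> : mev qW tg io (prodf ej \o linfun vsval) p = tev io nu (fun i => p (tg i)).
  apply/eqP; rewrite eq_sym -subr_eq0; apply/eqP; rewrite nuE.
  have <- := tev_symt0 (rho := tg) io (nu := ((-1) *: ((prodf ej \o linfun vsval) \o qW) +
    (prodf ej \o col_proj la V))%VF) p.
    by rewrite tevP rmorphN1 mulN1r addrC.
  move=> t ts; rewrite add_lfunE scale_lfunE.
  rewrite (comp_lfunE _ qW) (comp_lfunE (prodf ej) (linfun vsval)).
  by rewrite [linfun _ _]lfunE /= vsval_qW // comp_lfunE scaleN1r addNr.
have E eps : tev io (prodf (fun p => cf (ceps eps p))) (fun i => p (tg i)) =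
    \prod_i (p (tg i))`_(ceps eps i).
  pose s : idx := [ffun i => ceps eps i].
  rewrite /tev (bigD1 s) //= [X in _ + X]big1 ?addr0 => [|s' ne].
    rewrite prodf_pure [X in io X]big1 ?rmorph1 ?mul1r => [|i _].
      by apply: eq_bigr => i _; rewrite ffunE.
    by rewrite cfE ffunE coord_free ?eqxx ?(basis_free (vbasisP _)).
  have [i nei] : exists i, s' i != s i.
    apply/existsP; apply: contra_neqT ne => /existsPn H.
    by apply/ffunP => i; apply/eqP; have := H i; rewrite negbK.
  rewrite prodf_pure (bigD1 i) //= cfE coord_free ?(basis_free (vbasisP _)) //.
  by move: nei; rewrite ffunE eq_sym => /negPf->; rewrite mul0r rmorph0 mul0r.
have H (r : seq {ffun 'I_(ncols la) -> bool}) k (nus : _ -> 'Hom(tpow (box la) V, F^o)) :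
    tev io (\sum_(eps <- r) k eps *: nus eps) (fun i => p (tg i)) =
    \sum_(eps <- r) io (k eps) * tev io (nus eps) (fun i => p (tg i)).
  elim: r => [|eps r IHr]; first by rewrite !big_nil tev0.
  by rewrite !big_cons tevP IHr.
rewrite /nu H bigA_distr_bigA; apply: eq_bigr => eps _; rewrite E big_split rmorph_prod.
congr (_ * _); rewrite box_columns; apply: eq_bigr => j _.
by rewrite [RHS]big_enum_val; apply: eq_bigr => a _; rewrite /ceps colof_box.
Qed.

End WeylModel.

Fact ord2_succ k (a b : 'I_k) : (k <= 2)%N -> (a < b)%N -> b = a.+1 :> nat.
Proof. by move=> k2 ab; have := ltn_ord b; lia. Qed.

Fact ord2_cover k (a b c : 'I_k) : (k <= 2)%N -> b = a.+1 :> nat -> (c == a) || (c == b).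
Proof. by move=> k2 ab; rewrite -!val_eqE /=; have := ltn_ord b; have := ltn_ord c; lia. Qed.

(** * Two-row shapes: functionals as shift invariants *)

Section TwoRows.
Context {F : fieldType} (n m : nat) {V : vectType F}.
Local Notation D := (\dim {:V}).
Local Notation la := [:: n; m].
Local Notation tg := (@tag _ _ : box la -> 'I_(size la)).
Implicit Types (A B : idomainType).

Definition pt A (f g : {poly A}) (i : 'I_(size la)) : {poly A} :=
  if val i == 0%N then f else g.

Lemma box_rows (T : comNzRingType) (c : 'I_(size la) -> T) :
  \prod_(p : box la) c (tg p) = c ord0 ^+ n * c (lift ord0 ord0) ^+ m.
Proof.
transitivity (\prod_(i : 'I_(size la)) \prod_(j : 'I_(nth 0%N la i)) c i); first by rewrite sig_big_dep.
by rewrite !big_ord_recl big_ord0 /= mulr1 !prodr_const !card_ord.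
Qed.

Section AnyQuotient.
Context {W : vectType F} (q : 'Hom(tpow (box la) V, W)).

Lemma mev_scale A (io : {rmorphism F -> A}) lam s t (f g : {poly A}) :
  mev q tg io lam (pt (s *: f) (t *: g)) = s ^+ n * t ^+ m * mev q tg io lam (pt f g).
Proof.
rewrite /mev /tev mulr_sumr; apply: eq_bigr => x _; rewrite [RHS]mulrCA; congr (_ * _).
rewrite -(box_rows (fun i => if val i == 0%N then s else t)) -big_split.
by apply: eq_bigr => i _; rewrite /pt; case: ifP => _; rewrite coefZ.
Qed.

Definition mevp lam : {mpoly F[D + D]} := mev q tg gen lam (pt (gx D) (gy D)).

Lemma pev_mevp A (io : {rmorphism F -> A}) lam (f g : {poly A}) :
  (size f <= D)%N -> (size g <= D)%N -> pev io f g (mevp lam) = mev q tg io lam (pt f g).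
Proof.
move=> sf sg; apply: mev_nat => [c|i j jD]; first exact: pevC.
by rewrite /pt; case: ifP => _; [apply: pev_gx | apply: pev_gy].
Qed.

Lemma hom_mevp lam : hom D D 1 0 n (mevp lam) /\ hom D D 0 1 m (mevp lam).
Proof.
split=> A io s f g sf sg; rewrite !pev_mevp ?(leq_trans (size_scale_leq _ _)) //;
  by rewrite mev_scale expr1 expr0 expr1n ?mul1r ?mulr1.
Qed.

Lemma mev_pt A (io : {rmorphism F -> A}) lam p :
  mev q tg io lam p = mev q tg io lam (pt (p ord0) (p (lift ord0 ord0))).
Proof.
apply: eq_tev => -[i x] /=; rewrite /pt; case: ifP => i0; congr (p _); apply: val_inj => /=.
  exact/eqP.
by move: i0; case: i {x} => -[|[|]].
Qed.

End AnyQuotient.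

Definition wev A (io : {rmorphism F -> A}) (lam : 'Hom(weyl la V, F^o)) (f g : {poly A}) : A :=
  mev (qW la) tg io lam (pt f g).

Lemma wevP A (io : {rmorphism F -> A}) a lam lam' (f g : {poly A}) :
  wev io (a *: lam + lam') f g = io a * wev io lam f g + wev io lam' f g.
Proof. exact: mevP. Qed.

Lemma wev_nat A B (h : {rmorphism A -> B}) (io : {rmorphism F -> A})
    (io' : {rmorphism F -> B}) lam (f g : {poly A}) (f' g' : {poly B}) :
  (forall c, h (io c) = io' c) -> (forall i, (i < D)%N -> h f`_i = f'`_i) ->
  (forall i, (i < D)%N -> h g`_i = g'`_i) -> h (wev io lam f g) = wev io' lam f' g'.
Proof.
by move=> hio hf hg; apply: mev_nat => // i j jD; rewrite /pt; case: ifP => _; [apply: hf | apply: hg].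
Qed.

Lemma wev_scale A (io : {rmorphism F -> A}) lam s t (f g : {poly A}) :
  wev io lam (s *: f) (t *: g) = s ^+ n * t ^+ m * wev io lam f g.
Proof. exact: mev_scale. Qed.

Lemma wev_inj lam : (forall A (io : {rmorphism F -> A}) (f g : {poly A}),
  (size f <= D)%N -> (size g <= D)%N -> wev io lam f g = 0) -> lam = 0.
Proof.
move=> z; apply: (mev_inj (qW_surj la)) => A io p sp.
by rewrite mev_pt; apply: z.
Qed.

Lemma wev_act (G : groupType) (rV : rep G V) g A (io : {rmorphism F -> A}) lam (f f' : {poly A}) :
  wev io (lam \o weyl_rep la rV g)%VF f f' = wev io lam (lext io (rV g) f) (lext io (rV g) f').
Proof.
rewrite /wev (@mev_act _ _ _ _ _ (qW la) tg _ io (rV g) (weyl_rep la rV g) lam); last first.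
  by move=> t; apply: qW_act.
by apply: eq_tev => i; rewrite /pt; case: ifP.
Qed.

(** A column has at most two boxes, so two distinct boxes of a column are adjacent, as the relations
    defining the exterior power demand. *)
Lemma col_proj_alt (v : box la -> V) x y : colof x = colof y -> x != y -> v x = v y ->
  col_proj la V (pure v) = 0.
Proof.
move=> exy nxy vxy; rewrite col_proj_pure; apply/ffunP => s; rewrite !ffunE.
rewrite (bigD1 (colof x)) //= (_ : qproj _ _ = 0) ?linear0 ?mul0r //.
have xc : tg x \in col (colof x) by rewrite inE; apply: ltn_ord (tagged x).
have yc : tg y \in col (colof x) by rewrite exy inE; apply: ltn_ord (tagged y).
pose a := enum_rank_in xc (tg x); pose b := enum_rank_in xc (tg y).
have xa : col_box a = x by apply: box_eq; rewrite /= ?enum_rankK_in.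
have yb : col_box b = y.
  by apply: box_eq; rewrite /= ?enum_rankK_in //; apply: (congr1 val exy).
have nab : a != b by apply: contra_neq nxy => ab; rewrite -xa -yb ab.
have le2 : (#|col (colof x)| <= 2)%N by apply: leq_trans (max_card _) _; rewrite card_ord.
apply/eqP; rewrite qproj_eq0; apply: mem_spanset.
have [ab|ba] := ltnP a b.
  exists (fun c => v (col_box c)), a, b; rewrite xa yb; split=> //.
  exact: ord2_succ.
exists (fun c => v (col_box c)), b, a; rewrite xa yb; split=> //.
have {}ba : (b < a)%N by rewrite ltn_neqAle ba andbT eq_sym.
exact: ord2_succ.
Qed.

Hypothesis le_mn : (m <= n)%N.

(** Replace g by g + t f one box of the second row at a time. Each replacement adds t times a value
    in which this box and the one above it both carry f, and that value is 0 by alternation along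
    the column. *)
Lemma wev_shift A (io : {rmorphism F -> A}) lam t (f g : {poly A}) :
  wev io lam f (g + t *: f) = wev io lam f g.
Proof.
pose p (S : seq (box la)) x := if val (tg x) == 0%N then f
  else if x \in S then g + t *: f else g.
suff H S : tev io (lam \o qW la)%VF (p S) = tev io (lam \o qW la)%VF (p [::]).
  rewrite /wev /mev -[RHS](H (enum (box la))); apply: eq_tev => x.
  by rewrite /p /pt mem_enum.
elim: S => // x S <-; have [xS | xS] := boolP ((x \in S) || (val (tg x) == 0%N)).
  apply: eq_tev => y; rewrite /p inE; have [->|nyx] := eqVneq y x => //=.
  by case/orP: xS => ->; rewrite ?if_same.
move: xS; rewrite negb_or => /andP[xS x0].
have -> : tev io (lam \o qW la)%VF (p (x :: S)) =
    tev io (lam \o qW la)%VF (upd (p S) x (g + t *: f)).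
  apply: eq_tev => y; rewrite /upd /p inE; have [->|nyx] := eqVneq y x => //=.
  by rewrite (negPf x0).
have lt_xn : (tagged x < n)%N.
  have i1 : tg x = lift ord0 ord0.
    by apply: val_inj; have := ltn_ord (tg x); move: x0 => /=; rewrite /bump; lia.
  by apply: leq_trans (ltn_ord _) _; rewrite i1.
pose y : box la := Tagged (fun i : 'I_(size la) => 'I_(nth 0%N la i)) (Ordinal lt_xn : 'I_(nth 0%N la (@ord0 1))).
have nxy : x != y by apply: contraNneq x0 => ->.
rewrite tev_upd [X in _ + t * X](@tev_alt _ _ _ _ io _ _ x y) ?mulr0 ?addr0 //.
- apply: eq_tev => z; rewrite /upd; case: eqP => [->|//].
  by rewrite /p (negPf x0) (negPf xS).
- move=> v vxy; rewrite comp_lfunE comp_lfunE (@col_proj_alt v x y) ?linear0 //.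
  exact: val_inj.
- by rewrite /upd eqxx eq_sym (negPf nxy).
Qed.

Lemma ncols2 : ncols la = n.
Proof. by rewrite /ncols !big_ord_recl big_ord0 /= maxn0 (maxn_idPl le_mn). Qed.

Lemma prod_col2 (T : comNzRingType) (j : 'I_(ncols la)) (G : 'I_(size la) -> T) :
  \prod_(i in col j) G i = G ord0 * (if (j < m)%N then G (lift ord0 ord0) else 1).
Proof.
rewrite big_mkcond !big_ord_recl big_ord0 /= mulr1 !inE /=.
by rewrite -[X in (_ < X)%N]ncols2 ltn_ord.
Qed.

(** Column j < m carries the j-th minor of [T], [b] choosing one of its two terms; column j >= m
    carries the coordinate of index j - m in [T.2], and its second term has coefficient 0. *)
Lemma wev_tab T : (0 < D)%N -> tabok D n m T -> exists lam,
  forall A (io : {rmorphism F -> A}) (f g : {poly A}), wev io lam f g = tabv f g T.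
Proof.
move=> D0 /and4P[/eqP s1 /eqP s2 /allP a1 /allP a2]; pose x0 : 'I_D := Ordinal D0.
pose pj j := nth (0, 0)%N T.1 j.
pose kn (i : 'I_(size la)) j (b : bool) := if (j < m)%N then
  (if (val i == 0%N) (+) b then (pj j).1 else (pj j).2) else nth 0%N T.2 (j - m).
pose kk i (j : 'I_(ncols la)) b : 'I_D := insubd x0 (kn i j b).
have kkE i (j : 'I_(ncols la)) b : kk i j b = kn i j b :> nat.
  rewrite val_insubd ifT // /kn; have jn : (j < n)%N := leq_trans (ltn_ord j) (eq_leq ncols2).
  case: ifP => jm; last by apply: a2; rewrite mem_nth // s2; lia.
  have /a1 /andP[p1 p2] : pj j \in T.1 by rewrite mem_nth ?s1.
  by case: ifP.
pose coef (j : 'I_(ncols la)) (b : bool) : F := if (j < m)%N then (-1) ^+ b else (~~ b)%:R.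
have [|lam lamE] := @weyl_functional F la V coef kk.
  move=> j w a a' aa' waa'.
  have le2 : (#|col j| <= 2)%N by apply: leq_trans (max_card _) _; rewrite card_ord.
  have jm : (j < m)%N.
    rewrite ltnNge; apply/negP => mj.
    suff le1 : (#|col j| <= 1)%N by have := leq_trans (ltn_ord a') le1; rewrite aa'.
    rewrite -(cards1 (@ord0 1)); apply/subset_leq_card/subsetP => i; rewrite !inE.
    by case: i => -[|[|i]] Hi //=; rewrite ltnNge mj.
  have wa c : w c = w a.
    have := ord2_cover c le2 aa'.
    by case/orP => /eqP ->.
  have E b : \prod_c coord (vbasis {:V}) (kk (enum_val c) j b) (w c) =
      \prod_(i in col j) coord (vbasis {:V}) (kk i j b) (w a).
    by rewrite [RHS]big_enum_val; apply: eq_bigr => c _; rewrite wa.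
  rewrite big_bool !E !prod_col2 jm /coef jm mulN1r mul1r /=.
  have -> : kk ord0 j true = kk (lift ord0 ord0) j false by apply: val_inj; rewrite /= !kkE /kn jm.
  have -> : kk (lift ord0 ord0) j true = kk ord0 j false by apply: val_inj; rewrite /= !kkE /kn jm.
  by rewrite mulrC addNr.
exists lam => A io f g; rewrite /wev lamE.
pose h j := if (j < m)%N then f`_(pj j).1 * g`_(pj j).2 - f`_(pj j).2 * g`_(pj j).1
  else f`_(nth 0%N T.2 (j - m)).
transitivity (\prod_(j < ncols la) h j).
  apply: eq_bigr => j _; rewrite big_bool !prod_col2 /pt /= !kkE /coef /h /kn.
  case: ifP => _ /=; first by rewrite rmorphN1 rmorph1 mulN1r mul1r addrC.
  by rewrite rmorph0 mul0r add0r rmorph1 mul1r mulr1.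
rewrite -(big_mkord xpredT h) ncols2 (big_cat_nat _ le_mn) //= /tabv.
congr (_ * _).
  rewrite [RHS](big_nth (0, 0)%N) s1.
  by apply: eq_big_nat => j /andP[_ jm]; rewrite /h jm.
rewrite [RHS](big_nth 0%N) s2 -{1}[m]add0n big_addn; apply: eq_big_nat => j _.
by rewrite /h ltnNge leq_addl /= addnK.
Qed.

Lemma wev_tabval L : (0 < D)%N -> all (fun c => tabok D n m c.2) L -> exists lam,
  forall A (io : {rmorphism F -> A}) (f g : {poly A}), wev io lam f g = tabval io f g L.
Proof.
move=> D0; elim: L => [|c L IHL] /= => [_|/andP[okc /IHL[lam lamE]]].
  by exists 0 => A io f g; rewrite /wev mev0 /tabval big_nil.
have [lc lcE] := wev_tab D0 okc; exists (c.1 *: lc + lam) => A io f g.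
by rewrite wevP lcE lamE /tabval big_cons.
Qed.

(** By [shift_invariants] it is enough to realise tableaux. With [wev_inj], this identifies the dual
    of the Weyl module with the shift invariants of degree (n, m). *)
Lemma wev_exists (phi : {mpoly F[D + D]}) : (0 < D)%N -> hom D D 1 0 n phi -> hom D D 0 1 m phi -> shinv D phi ->
  exists lam, forall A (io : {rmorphism F -> A}) (f g : {poly A}),
    (size f <= D)%N -> (size g <= D)%N -> wev io lam f g = pev io f g phi.
Proof.
move=> D0 hx hy inv; have [L okL LE] := shift_invariants (leqnn D) le_mn hx hy inv.
have [lam lamE] := wev_tabval D0 okL.
by exists lam => A io f g sf sg; rewrite lamE LE.
Qed.

End TwoRows.

(** * Dimension of Weyl modules of two-row shapes *)

Section ShiftExpansion.
Context {F : idomainType} {N : nat}.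
Implicit Types (A B : idomainType).
Local Notation P := {mpoly F[N + N]}.
Context (phi : P) (n m : nat).
Hypotheses (hx : hom N N 1 0 n phi) (hy : hom N N 0 1 m phi).

(* phi at (f, g + t f), as a polynomial in t *)
Definition sexp A (io : {rmorphism F -> A}) (f g : {poly A}) : {poly A} :=
  pev (polyC \o io) (map_poly polyC f) (map_poly polyC g + 'X *: map_poly polyC f) phi.

Lemma sexp_nat A B (h : {rmorphism A -> B}) (H : {rmorphism {poly A} -> {poly B}}) u
    (io : {rmorphism F -> A}) (io' : {rmorphism F -> B}) (f g : {poly A}) (f' g' : {poly B}) :
  (forall c, H c%:P = (h c)%:P) -> H 'X = u -> (forall c, h (io c) = io' c) ->
  (forall i, (i < N)%N -> h f`_i = f'`_i) -> (forall i, (i < N)%N -> h g`_i = g'`_i) ->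
  H (sexp io f g) = pev (polyC \o io') (map_poly polyC f')
    (map_poly polyC g' + u *: map_poly polyC f') phi.
Proof.
move=> HC HX hio hf hg; apply: pev_nat => [c|i iN|i iN] /=; first by rewrite HC hio.
  by rewrite !coef_map HC /= hf.
by rewrite !coefD !coefZ !coef_map rmorphD rmorphM HC HX HC /= hf ?hg.
Qed.

Definition sc j : P := (sexp (@gen F N) (gx N) (gy N))`_j.

Lemma pev_sc A (io : {rmorphism F -> A}) (f g : {poly A}) j :
  (size f <= N)%N -> (size g <= N)%N -> pev io f g (sc j) = (sexp io f g)`_j.
Proof.
move=> sf sg; have [H [HC HX HE]] : exists H : {rmorphism {poly P} -> {poly A}},
    [/\ forall c, H c%:P = (pev io f g c)%:P, H 'X = 'X & forall q j, (H q)`_j = pev io f g q`_j].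
  exists (map_poly (pev io f g)); split=> [c||q i]; rewrite /= ?map_polyC ?map_polyX //.
  exact: coef_map.
rewrite -HE (@sexp_nat _ _ (pev io f g) H 'X (@gen F N) io _ _ f g HC HX) => [//|c|i iN|i iN].
- exact: pevC.
- exact: pev_gx.
- exact: pev_gy.
Qed.

Lemma hom_sc_x j : hom N N 1 0 (n + j) (sc j).
Proof.
move=> A io s f g sf sg; rewrite expr1 expr0 scale1r.
have ssf : (size (s *: f) <= N)%N by rewrite (leq_trans (size_scale_leq _ _)).
rewrite !pev_sc //; have [H [HC HX HE]] := psubst_ex (idfun : {rmorphism A -> A}) s.
have E : sexp io (s *: f) g = s%:P ^+ n * H (sexp io f g).
  rewrite (sexp_nat (io' := io) (f' := f) (g' := g) HC HX) //.
  rewrite -hx ?size_map_polyC ?size_addZ ?size_map_polyC // expr1 expr0 scale1r.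
  apply: (@pev_nat _ _ _ _ _ _ idfun) => [c|i _|i _] //=; first by rewrite coefZ !coef_map /= coefZ polyCM.
  by rewrite !coefD !coefZ !coef_map /= !coefZ !polyCM -!mul_polyC; ring.
by rewrite E -rmorphXn coefCM HE exprD mulrA.
Qed.

Lemma hom_sc_y j : law0 N N (sc j) \/ (j <= m)%N /\ hom N N 0 1 (m - j) (sc j).
Proof.
apply: hom_cancel => A io s f g sf sg; rewrite expr1 expr0 scale1r.
have ssg : (size (s *: g) <= N)%N by rewrite (leq_trans (size_scale_leq _ _)).
rewrite !pev_sc //; have [H [HC HX HE]] := psubst_ex (idfun : {rmorphism A -> A}) s.
have E : H (sexp io f (s *: g)) = s%:P ^+ m * sexp io f g.
  rewrite (sexp_nat (io' := io) (f' := f) (g' := s *: g) HC HX) //.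
  rewrite -hy ?size_map_polyC ?size_addZ ?size_map_polyC // expr1 expr0 scale1r.
  apply: (@pev_nat _ _ _ _ _ _ idfun) => [c|i _|i _] //=.
  by rewrite !coefD !coefZ !coefD !coefZ !coef_map /= !coefZ !polyCM -!mul_polyC; ring.
by have := congr1 (fun p : {poly A} => p`_j) E; rewrite HE -rmorphXn coefCM.
Qed.

Lemma sexp0 A (io : {rmorphism F -> A}) (f g : {poly A}) : (sexp io f g)`_0 = pev io f g phi.
Proof.
rewrite -horner_coef0; have [H [HC HX HE]] : exists H : {rmorphism {poly A} -> A},
    [/\ forall c, H c%:P = c, H 'X = 0 & forall q, H q = q.[0]].
  by exists (horner_eval 0); split=> [c||q //]; [exact: hornerC | exact: hornerX].
rewrite -HE; apply: pev_nat => [c|i _|i _] /=; first exact: HC.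
  by rewrite coef_map HC.
by rewrite coefD coefZ !coef_map rmorphD rmorphM HX mul0r addr0 HC.
Qed.

Lemma coef_shift_top (A : idomainType) (t : A) J : exists H : {rmorphism {poly A} -> {poly A}},
  [/\ forall c, H c%:P = c%:P, H 'X = 'X + t%:P &
      forall q : {poly A}, (size q <= J.+1)%N -> (H q)`_J = q`_J].
Proof.
exists (psubst polyC ('X + t%:P)); split=> [c||q sq]; rewrite ?psubstC ?psubstX //.
rewrite (psubstE _ _ sq) big_ord_recr coefD /= coefCM.
have sX k : size (('X + t%:P) ^+ k) = k.+1.
  rewrite -[t%:P]opprK -polyCN; elim: k => [|k IHk]; first by rewrite expr0 size_poly1.
  by rewrite exprSr size_Mmonic ?monicXsubC ?IHk ?size_XsubC ?addn2 // -size_poly_eq0 IHk.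
have -> : (('X + t%:P) ^+ J)`_J = 1.
  have -> : (('X + t%:P) ^+ J)`_J = lead_coef (('X + t%:P) ^+ J) by rewrite lead_coefE sX.
  by rewrite -[t%:P]opprK -polyCN; apply/monicP/monic_exp/monicXsubC.
rewrite mulr1 coef_sum big1 ?add0r // => i _.
by rewrite coefCM [X in _ * X]nth_default ?mulr0 ?sX.
Qed.

(** Shifting the pair translates the variable t, and a translation keeps the coefficient of the
    highest power. *)
Lemma shinv_sc J : (forall j, (J < j)%N -> law0 N N (sc j)) -> shinv N (sc J).
Proof.
move=> z A io t f g sf sg; have sgt : (size (g + t *: f)%R <= N)%N by apply: size_addZ.
rewrite !pev_sc //; have [H [HC HX HE]] := coef_shift_top t J.
have sz : (size (sexp io f g) <= J.+1)%N.
  by apply/leq_sizeP => j lt; rewrite -pev_sc // z.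
rewrite -(HE _ sz); congr (_`_J).
rewrite (@sexp_nat _ _ idfun H _ io io f g f g HC HX) // /sexp.
suff -> : map_poly polyC (g + t *: f) + 'X *: map_poly polyC f =
  map_poly polyC g + ('X + t%:P) *: map_poly polyC f by [].
apply/polyP => i.
by rewrite !coefD !coefZ !coef_map /= !coefD !coefZ !polyCD !polyCM; ring.
Qed.

End ShiftExpansion.

(** * Subspaces given by predicates, and dimension counts along filtrations *)

Section LinearPredicates.
Context {F : fieldType}.

Definition linpred (L : lmodType F) (P : L -> Prop) :=
  P 0 /\ forall a x y, P x -> P y -> P (a *: x + y).

(** Predicates quantifying over all domains are turned into subspaces: a subspace of maximal
    dimension inside [P] is all of [P], since any further vector could be added to it. *)
Lemma linpred_space (L : vectType F) (P : L -> Prop) : linpred P ->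
  exists U : {vspace L}, forall x, x \in U <-> P x.
Proof.
case=> P0 PD.
pose Q k := boolp.asbool (exists2 U : {vspace L}, (forall x, x \in U -> P x) & \dim U = k).
have Q0 : exists k, Q k.
  exists 0%N; apply/boolp.asboolP; exists 0%VS; rewrite ?dimv0 // => x.
  by rewrite memv0 => /eqP ->.
have Qmax k : Q k -> (k <= \dim {:L})%N.
  by move=> /boolp.asboolP[U _ <-]; apply/dimvS/subvf.
case: (ex_maxnP Q0 Qmax) => k /boolp.asboolP[U UP dU] kmax.
exists U => x; split=> [/UP // | Px].
have /kmax : Q (\dim (<[x]> + U)%VS).
  apply/boolp.asboolP; exists (<[x]> + U)%VS => // y /memv_addP[_ /vlineP[a ->]] [u uU ->].
  by apply: PD => //; apply: UP.
rewrite -dU => le; have sub : (U <= <[x]> + U)%VS by apply: addvSr.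
have /eqP -> : (U == <[x]> + U)%VS by rewrite eqEdim sub le.
by apply: (subvP (addvSl <[x]> U)); apply: memv_line.
Qed.

Section LinearExtension.
Context {L T : vectType F} {k : nat} (X : k.-tuple L) (t : 'I_k -> T).

Definition lin_ext (x : L) : T := \sum_i coord X i x *: t i.

Fact lin_ext_linear : linear lin_ext.
Proof.
move=> a x y; rewrite scaler_sumr -big_split; apply: eq_bigr => i _ /=.
by rewrite linearP scalerDl scalerA.
Qed.

HB.instance Definition _ := GRing.isLinear.Build F L T _ lin_ext lin_ext_linear.

Lemma lin_extE x : linfun lin_ext x = \sum_i coord X i x *: t i.
Proof. by rewrite lfunE. Qed.

End LinearExtension.

Definition linrel (L T : lmodType F) (R : L -> T -> Prop) :=
  forall a x y t s, R x t -> R y s -> R (a *: x + y) (a *: t + s).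

Lemma linrel0 (L T : lmodType F) (R : L -> T -> Prop) x t : linrel R -> R x t -> R 0 0.
Proof.
by move=> RD Rxt; have := RD (-1) _ _ _ _ Rxt Rxt; rewrite !scaleN1r !addNr.
Qed.

(** The relation may be multivalued: images are chosen on a basis of [U] and extended linearly. *)
Lemma linrel_fun (L T : vectType F) (U : {vspace L}) (R : L -> T -> Prop) : linrel R ->
  (forall x, x \in U -> exists t, R x t) ->
  exists h : 'Hom(L, T), forall x, x \in U -> R x (h x).
Proof.
move=> RD ex; have R00 : R 0 0 by have [t /linrel0] := ex 0 (mem0v U); apply.
pose t i : T := projT1 (boolp.cid (ex _ (vbasis_mem (mem_tnth i (vbasis U))))).
have Rt (i : 'I_(\dim U)) : R (vbasis U)`_i (t i).
  by rewrite -tnth_nth /t; case: boolp.cid.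
exists (linfun (lin_ext (vbasis U) t)) => x /coord_vbasis xE; rewrite lin_extE {1}xE.
elim/big_ind2: _ => // [u u' v v' Ru Rv|i _].
  by have := RD 1 _ _ _ _ Ru Rv; rewrite !scale1r.
by have := RD (coord (vbasis U) i x) _ _ _ _ (Rt i) R00; rewrite !addr0.
Qed.

(* The graded pieces of a filtration of L embed in the T i through the linear
   relations R i; if the dimensions add up, the embeddings are onto. *)
Lemma filtration (L : vectType F) (P : nat -> L -> Prop) (T : nat -> vectType F)
    (R : forall i, L -> T i -> Prop) M :
  (forall i, linpred (P i)) -> (forall i, linrel (R i)) ->
  (forall x, P 0%N x) -> (forall x, P M x -> x = 0) ->
  (forall i x, (i < M)%N -> P i x -> exists t, R i x t) ->
  (forall i x, (i < M)%N -> P i x -> R i x 0 -> P i.+1 x) ->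
  (\dim {:L} <= \sum_(i < M) \dim {:T i})%N /\
  ((\sum_(i < M) \dim {:T i} <= \dim {:L})%N ->
    forall i t, (i < M)%N -> exists x, P i x /\ R i x t).
Proof.
move=> Plin Rlin P0 PM Rex RS.
have [U UE] : exists U : nat -> {vspace L}, forall i x, x \in U i <-> P i x.
  exists (fun i => projT1 (boolp.cid (linpred_space (Plin i)))) => i.
  by case: boolp.cid.
have step i : (i < M)%N -> exists h : 'Hom(L, T i),
    (forall x, x \in U i -> R i x (h x)) /\ (\dim (U i) <= \dim (h @: U i) + \dim (U i.+1))%N.
  move=> iM; have [|h hR] := @linrel_fun _ _ (U i) (R i) (Rlin i).
    by move=> x /UE; apply: Rex.
  (* An element of the kernel is related to 0, so it lies in the next step of the filtration; the
     rank formula gives the inequality. *)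
  exists h; split=> //; rewrite -(limg_ker_dim h (U i)) addnC leq_add2l; apply: dimvS.
  apply/subvP => x /memv_capP[xU]; rewrite memv_ker => /eqP hx.
  by apply/UE/RS => //; [apply/UE | rewrite -hx; apply: hR].
have [h hP] : exists h : forall i, 'Hom(L, T i), forall i, (i < M)%N ->
    (forall x, x \in U i -> R i x (h i x)) /\ (\dim (U i) <= \dim (h i @: U i) + \dim (U i.+1))%N.
  have D i : exists h : 'Hom(L, T i), (i < M)%N ->
      (forall x, x \in U i -> R i x (h x)) /\ (\dim (U i) <= \dim (h @: U i) + \dim (U i.+1))%N.
    by case: (ltnP i M) => [/step[h ?] | _]; [exists h | exists 0].
  by exists (fun i => projT1 (boolp.cid (D i))) => i; case: boolp.cid.
have U0 : U 0%N = fullv.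
  by apply/vspaceP => x; rewrite memvf; apply/UE.
have UM : U M = 0%VS.
  apply/vspaceP => x; rewrite memv0; apply/idP/eqP => [/UE/PM // | ->]; exact: mem0v.
have tel k : (k <= M)%N -> (\dim {:L} <= \sum_(i < k) \dim (h i @: U i)%VS + \dim (U k))%N.
  elim: k => [|k IHk] kM; first by rewrite big_ord0 U0.
  rewrite big_ord_recr /= -addnA; apply: leq_trans (IHk (ltnW kM)) _.
  by rewrite leq_add2l; have [] := hP k kM.
have {}tel : (\dim {:L} <= \sum_(i < M) \dim (h i @: U i)%VS)%N.
  by have := tel M (leqnn M); rewrite UM dimv0 addn0.
have le i : (\dim (h i @: U i)%VS <= \dim {:T i})%N by apply/dimvS/subvf.
split=> [|ge i t iM]; first by apply: leq_trans tel _; apply: leq_sum.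
have full : (h i @: U i)%VS = fullv.
  apply/eqP; rewrite eqEdim subvf leqNgt; apply/negP => lt.
  have := leq_trans ge tel; rewrite leqNgt => /negP; apply.
  rewrite (bigD1 (Ordinal iM)) //= [X in (_ < X)%N](bigD1 (Ordinal iM)) //=.
  by rewrite -addSn leq_add // leq_sum.
have : t \in (h i @: U i)%VS by rewrite full memvf.
case/memv_imgP => x xU ->; exists x; split; first exact/UE.
by have [hR _] := hP i iM; apply: hR.
Qed.

End LinearPredicates.

(** * Dimension bounds from products of two symmetric powers *)

Section TwoRowDimension.
Context {F : fieldType} {V : vectType F} (d : nat).
Hypothesis dimV : \dim {:V} = d.+1.
Local Notation D := (\dim {:V}).
Implicit Types (A : idomainType).

Lemma dim_dual (W : vectType F) : \dim {:'Hom(W, F^o)} = \dim {:W}.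
Proof. by rewrite !dimvf /dim /= muln1. Qed.

Section Symmetric.
Context (n m : nat).
Local Notation la := [:: n; m].
Local Notation tg := (@tag _ _ : box la -> 'I_(size la)).
Local Notation S := (@symt F (box la) V _ tg).

Lemma dim_symt2 : \dim S = ('C(d + n, n) * 'C(d + m, m))%N.
Proof.
rewrite (dim_symt _ dimV) !big_ord_recl big_ord0 muln1.
have sz i : size (fiber tg i) = nth 0%N la i.
  rewrite size_filter count_enum -sum1_card.
  transitivity (\sum_(i' | i' == i) \sum_(j : 'I_(nth 0%N la i')) 1)%N.
    by rewrite sig_big_dep /=; apply: eq_bigl => p; rewrite andbT.
  by rewrite big_pred1_eq sum1_card card_ord.
by rewrite !sz.
Qed.

Lemma dim_weyl_symt : (\dim {:weyl la V} <= 'C(d + n, n) * 'C(d + m, m))%N.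
Proof.
rewrite dimvf -[dim _]/(\dim (limg (weyl_map la V))) limg_weyl_map -dim_symt2.
by rewrite -(limg_ker_dim (col_proj la V) S) leq_addl.
Qed.

Definition qX : 'Hom(tpow (box la) V, subvs_of S) := linfun (vsproj S).

Lemma qX_surj : (qX @: S)%VS = fullv.
Proof.
apply/eqP; rewrite eqEsubv subvf; apply/subvP => x _; apply/memv_imgP.
by exists (vsval x); rewrite ?subvsP // lfunE /= vsvalK.
Qed.

Definition sd A (io : {rmorphism F -> A}) (kap : 'Hom(subvs_of S, F^o)) (f g : {poly A}) j : A :=
  (mev qX tg (polyC \o io) kap
    (pt (map_poly polyC f) (map_poly polyC g + 'X *: map_poly polyC f)))`_j.

Lemma sdP A (io : {rmorphism F -> A}) a kap kap' (f g : {poly A}) j :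
  sd io (a *: kap + kap') f g j = io a * sd io kap f g j + sd io kap' f g j.
Proof. by rewrite /sd mevP coefD coefCM. Qed.

Lemma sd0 A (io : {rmorphism F -> A}) (f g : {poly A}) j : sd io 0 f g j = 0.
Proof. by rewrite /sd mev0 coef0. Qed.

Lemma pev_sc_mevp A (io : {rmorphism F -> A}) kap (f g : {poly A}) j :
  (size f <= D)%N -> (size g <= D)%N ->
  pev io f g (sc (mevp qX kap) j) = sd io kap f g j.
Proof.
move=> sf sg; rewrite pev_sc // /sexp pev_mevp ?size_addZ ?size_map_polyC //.
Qed.

(** Functionals on Sym_n V tensor Sym_m V are filtered by the degree in t of their value at (f, g +
    t f). If it is at most m - i, the coefficient of t^(m - i) is a shift invariant of degree (n + m
    - i, i), that is a functional on the Weyl module of this shape, and it vanishes only on the next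
    step. *)
Lemma sym_weyl_dim : (m <= n)%N -> ('C(d + n, n) * 'C(d + m, m) <=
  \sum_(i < m.+1) \dim {:weyl [:: (n + (m - i))%N; i : nat] V})%N.
Proof.
move=> le_mn; have D0 : (0 < D)%N by rewrite dimV.
pose T i : vectType F := 'Hom(weyl [:: (n + (m - i))%N; i] V, F^o).
pose P i kap := forall A (io : {rmorphism F -> A}) (f g : {poly A}) j,
  (size f <= D)%N -> (size g <= D)%N -> (m < i + j)%N -> sd io kap f g j = 0.
pose R i kap (lam : T i) := forall A (io : {rmorphism F -> A}) (f g : {poly A}),
  (size f <= D)%N -> (size g <= D)%N -> sd io kap f g (m - i) = wev io lam f g.
have [kx ky] : (forall kap, hom D D 1 0 n (mevp qX kap)) /\
    (forall kap, hom D D 0 1 m (mevp qX kap)) by split=> kap; have [] := hom_mevp qX kap.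
have [||||||le _] := @filtration _ 'Hom(subvs_of S, F^o) P T R m.+1.
- move=> i; split=> [|a x y Px Py] A io f g j sf sg lt; first exact: sd0.
  by rewrite sdP Px // Py // mulr0 addr0.
- by move=> i a x y t s Rx Ry A io f g sf sg; rewrite sdP Rx // Ry // wevP.
- move=> kap A io f g j sf sg; rewrite add0n => lt; rewrite -pev_sc_mevp //.
  by have [z|[le _]] := hom_sc_y (ky kap) j; [apply: z | lia].
- move=> kap z; apply: (mev_inj qX_surj) => A io p sp; rewrite mev_pt.
  by rewrite -pev_mevp // -sexp0 -pev_sc // pev_sc_mevp // z // addn0.
- move=> i kap lt Pk; have le_im : (i <= m)%N by rewrite -ltnS.
  pose phi := sc (mevp qX kap) (m - i).
  have inv : shinv D phi.
    by apply: shinv_sc => j lt_j A io f g sf sg; rewrite pev_sc_mevp // Pk //; lia.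
  have [z|[_ hy]] := hom_sc_y (ky kap) (m - i).
    by exists 0 => A io f g sf sg; rewrite /wev mev0 -pev_sc_mevp ?z.
  rewrite subKn // in hy.
  have [|lam lamE] := @wev_exists F (n + (m - i)) i V _ phi D0 (hom_sc_x (kx kap) _) hy inv.
    by lia.
  by exists lam => A io f g sf sg; rewrite lamE // pev_sc_mevp.
- move=> i kap lt Pk R0 A io f g j sf sg lt_j.
  have [->|ne] := eqVneq j (m - i)%N; first by rewrite R0 // /wev mev0.
  by apply: Pk => //; lia.
rewrite dim_dual dimvf -[dim _]/(\dim S) dim_symt2 in le.
by apply: leq_trans le _; apply: leq_sum => i _; rewrite dim_dual.
Qed.

End Symmetric.
End TwoRowDimension.

(** * Binomial identities and the recursion for the dimensions *)

Section DimensionCount.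
Local Open Scope nat_scope.

Lemma binom_step n m d k : k <= m ->
  (m.+1 + d) * ('C(n, k) * 'C(m, k) * 'C(n + m + d - k, n + m)) =
  'C(n, k) * 'C(m, k) * ((m.+1 + k) * 'C(n + m.+1 + d - k, n + m.+1) +
    (n - k) * 'C(n + m.+1 + d - k.+1, n + m.+1)).
Proof.
move=> le_km; have [lt_nk | le_kn] := ltnP n k; first by rewrite (bin_small lt_nk) !mul0n muln0.
rewrite mulnCA; congr (_ * _).
have [lt_dk | le_kd] := ltnP d k.
  rewrite !bin_small ?muln0 //; lia.
have [e de] : exists e, d = k + e by exists (d - k); rewrite subnKC.
have -> : n + m + d - k = n + m + e by lia.
have -> : n + m.+1 + d - k = (n + m + e).+1 by lia.
have -> : n + m.+1 + d - k.+1 = n + m + e by lia.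
have P := binS (n + m + e) (n + m); have Q := mul_bin_down (n + m + e).+1 (n + m).+1.
rewrite addnS P; rewrite P /= in Q.
have E : (n + m + e).+1 - (n + m).+1 = e by lia.
move: Q; rewrite E de; set a := 'C(_, (n + m).+1); set b := 'C(_, n + m) => Q.
have -> : n = (n - k) + k by lia.
move: Q; have -> : n = (n - k) + k by lia.
rewrite addnK; nia.
Qed.

(** Induction on m, after multiplication by m + 1: [binom_step] writes each term at m through two
    terms at m + 1, which are regrouped by index. For n = m this is Li Shanlan's identity. *)
Lemma binom_product n m d : 'C(d + n, n) * 'C(d + m, m) =
  \sum_(k < m.+1) 'C(n, k) * 'C(m, k) * 'C(n + m + d - k, n + m).
Proof.
elim: m => [|m IHm].
  by rewrite big_ord_recl big_ord0 !bin0 !muln1 mul1n addn0 addn0 subn0 addnC.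
apply/eqP; rewrite -(eqn_pmul2l (ltn0Sn m)); apply/eqP.
have E1 : m.+1 * ('C(d + n, n) * 'C(d + m.+1, m.+1)) = (m.+1 + d) * ('C(d + n, n) * 'C(d + m, m)).
  by rewrite mulnCA -mul_bin_diag [RHS]mulnCA addnS /= [_ + d]addnC addnS.
rewrite E1 IHm big_distrr /=.
pose U k := 'C(n + m.+1 + d - k, n + m.+1).
have -> : \sum_(k < m.+1) (m.+1 + d) * ('C(n, k) * 'C(m, k) * 'C(n + m + d - k, n + m)) =
    \sum_(k < m.+1) 'C(n, k) * 'C(m, k) * (m.+1 + k) * U k +
    \sum_(k < m.+1) k.+1 * 'C(n, k.+1) * 'C(m, k) * U k.+1.
  rewrite -big_split; apply: eq_bigr => k _ /=.
  rewrite binom_step -1?ltnS // mulnDr mulnA; congr (_ + _).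
  rewrite mul_bin_left /U; ring.
have -> : \sum_(k < m.+1) k.+1 * 'C(n, k.+1) * 'C(m, k) * U k.+1 =
    \sum_(k < m.+2) k * 'C(n, k) * 'C(m, k.-1) * U k.
  by rewrite [RHS]big_ord_recl /= !mul0n add0n.
have -> : \sum_(k < m.+1) 'C(n, k) * 'C(m, k) * (m.+1 + k) * U k =
    \sum_(k < m.+2) 'C(n, k) * 'C(m, k) * (m.+1 + k) * U k.
  by rewrite [RHS]big_ord_recr /= (bin_small (ltnSn m)) muln0 !mul0n addn0.
rewrite -big_split big_distrr; apply: eq_bigr => -[k lt_k] _ /=; rewrite -/(U k) !mulnA -mulnDl; congr (_ * _).
case: k lt_k => [|k] lt_k; first by rewrite !bin0; lia.
have E2 := mul_bin_down m.+1 k.+1; have E3 := binS m k; rewrite /= in E2.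
have lk : k <= m by [].
have -> : k.+1 * 'C(n, k.+1) * 'C(m, k) = 'C(n, k.+1) * (k.+1 * 'C(m, k)) by ring.
rewrite -mulnA -mulnDr [m.+1 * _]mulnC -mulnA; congr (_ * _).
move: E2 E3; set a := 'C(m.+1, k.+1); set b := 'C(m, k.+1); set c := 'C(m, k) => E2 E3.
have : m.+1 - k.+1 + k.+1 = m.+1 by lia.
move: (m.+1 - k.+1) E2 => e E2 E4.
rewrite mulnC in E2; nia.
Qed.

Section WeylNumbers.
Variable w : nat -> nat -> nat -> nat.
Local Notation l d n := 'C(d + n, n).

Hypothesis w0 : forall n d, w n 0 d <= l d n.
Hypothesis w_sym : forall n m d, m <= n ->
  l d n * l d m <= \sum_(i < m.+1) w (n + (m - i)) i d.
Hypothesis w_res : forall n m d, 0 < m -> m <= n ->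
  w n m d <= \sum_(i < minn m d) 'C(n + m + d - i.+1, n + m) * w (n - i.+1) (m - i.+1) i.+1.

Lemma sum_minn n m d (G : nat -> nat) :
  \sum_(i < minn m d) 'C(n + m + d - i.+1, n + m) * G i =
  \sum_(i < m) 'C(n + m + d - i.+1, n + m) * G i.
Proof.
pose H i := 'C(n + m + d - i.+1, n + m) * G i.
rewrite -(big_mkord xpredT H) -[RHS](big_mkord xpredT H).
rewrite [RHS](big_cat_nat (leq0n (minn m d)) (geq_minl m d)) /=.
rewrite [X in _ = _ + X]big_nat_cond [X in _ = _ + X]big1 ?addn0 // => i.
rewrite andbT geq_min => /andP[le lt]; rewrite /H bin_small ?mul0n //; lia.
Qed.

(** By [binom_product], the difference of the two products is the sum over k of C(n + m + d - k, n +
    m) times C(n, k) C(m, k) - C(n + 1, k) C(m - 1, k). The terms k = 0 cancel, and for k > 0 the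
    second factor is the bound that the hypothesis gives for w (n - k) (m - k) k. *)
Lemma weyl_bound m : (forall j n d, j < m -> j <= n ->
    w n j d + (if j is j'.+1 then l d n.+1 * l d j' else 0) <= l d n * l d j) ->
  forall n d, 0 < m -> m <= n ->
  \sum_(i < m) 'C(n + m + d - i.+1, n + m) * w (n - i.+1) (m - i.+1) i.+1 +
    l d n.+1 * l d m.-1 <= l d n * l d m.
Proof.
move=> IH n d m0 le_mn; case: m m0 le_mn IH => // m _ le_mn IH.
rewrite !binom_product.
have -> : \sum_(k < m.+1) 'C(n.+1, k) * 'C(m, k) * 'C(n.+1 + m + d - k, n.+1 + m) =
    \sum_(k < m.+2) 'C(n.+1, k) * 'C(m, k) * 'C(n + m.+1 + d - k, n + m.+1).
  rewrite [RHS]big_ord_recr /= (bin_small (ltnSn m)) muln0 mul0n addn0.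
  by apply: eq_bigr => k _; rewrite addSnnS.
rewrite [X in _ + X]big_ord_recl [X in _ <= X]big_ord_recl /= !bin0 addnCA leq_add2l.
rewrite -big_split; apply: leq_sum => i _ /=; rewrite /bump leq0n add1n.
rewrite [X in _ <= X]mulnC [X in _ + X]mulnC -mulnDr leq_mul2l; apply/orP; right.
have lt := ltn_ord i.
have := IH (m.+1 - i.+1) (n - i.+1) i.+1; rewrite !subnKC //; last by lia.
have E a b : b <= a -> 'C(a, a - b) = 'C(a, b) := @bin_sub a b.
rewrite !E //; try lia; move=> H.
apply: leq_trans (H _ _); try lia; rewrite leq_add2l.
rewrite subSS; case e : (m - i) => [|j].
  by rewrite [X in _ * X]bin_small ?muln0 //; lia.
have -> : i.+1 + (n - i.+1).+1 = n.+1 by lia.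
have -> : i.+1 + j = m by lia.
have -> : (n - i.+1).+1 = n.+1 - i.+1 by lia.
have -> : j = m - i.+1 by lia.
by rewrite !E //; lia.
Qed.

(** The expected dimension as an upper bound, written without subtraction. Strong induction on m
    works because every layer has a shorter second row. *)
Lemma weyl_upper m n d : m <= n ->
  w n m d + (if m is m'.+1 then l d n.+1 * l d m' else 0) <= l d n * l d m.
Proof.
elim/ltn_ind: m n d => -[|m] IH n d le_mn; first by rewrite addn0 bin0 muln1.
have := @weyl_bound m.+1 _ n d (ltn0Sn m) le_mn; rewrite /=; move=> H.
apply: leq_trans (H _) => [|j n' d' lt le]; last exact: IH.
by rewrite leq_add2r -(sum_minn n m.+1 d (fun i => w (n - i.+1) (m.+1 - i.+1) i.+1)); apply: w_res.
Qed.

Lemma weyl_telescope S M d : M + M <= S ->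
  \sum_(i < M.+1) w (S - i) i d <= l d (S - M) * l d M.
Proof.
elim: M => [|M IH] le; first by rewrite big_ord_recl big_ord0 addn0 subn0 bin0 muln1 w0.
rewrite big_ord_recr /=; have le1 : M + M <= S by lia.
have := @weyl_upper M.+1 (S - M.+1) d; have -> : (S - M.+1).+1 = S - M by lia.
by move=> H; rewrite addnC; apply: leq_trans (H _); [rewrite leq_add2l IH | lia].
Qed.

(** Removing from [w_sym] the telescoped upper bounds for i < m leaves w n m d at least the expected
    dimension, which is at least the sum by [weyl_bound]. *)
Lemma weyl_numbers n m d : 0 < m -> m <= n ->
  \sum_(i < minn m d) 'C(n + m + d - i.+1, n + m) * w (n - i.+1) (m - i.+1) i.+1 <= w n m d.
Proof.
case: m => // m _ le_mn; rewrite (sum_minn n m.+1 d (fun i => w (n - i.+1) (m.+1 - i.+1) i.+1)).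
have H := @weyl_bound m.+1 (fun j n d _ => @weyl_upper j n d) n d (ltn0Sn m) le_mn.
have := w_sym d le_mn; rewrite big_ord_recr /= subnn addn0 => H2.
have H3 := @weyl_telescope (n + m.+1) m d.
have E : \sum_(i < m.+1) w (n + m.+1 - i) i d = \sum_(i < m.+1) w (n + (m.+1 - i)) i d.
  by apply: eq_bigr => i _; congr w; have := ltn_ord i; lia.
have H4 : n + m.+1 - m = n.+1 by lia.
rewrite E H4 in H3; have {}H3 := H3 ltac:(lia).
rewrite -(leq_add2r (l d n.+1 * l d m)); apply: leq_trans H _; apply: leq_trans H2 _.
by rewrite addnC leq_add2l.
Qed.

End WeylNumbers.

End DimensionCount.

(** * Symmetric powers of the natural representation *)

Section CoordinateChange.
Context {F : fieldType}.
Implicit Types (A : idomainType) (c : nat -> nat -> F).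

Definition chg K L A (io : {rmorphism F -> A}) c (f : {poly A}) : {poly A} :=
  \poly_(j < L) \sum_(l < K) f`_l * io (c l j).

Lemma size_chg K L A (io : {rmorphism F -> A}) c f : (size (chg K L io c f) <= L)%N.
Proof. exact: size_poly. Qed.

Lemma coef_chg K L A (io : {rmorphism F -> A}) c f j : (j < L)%N ->
  (chg K L io c f)`_j = \sum_(l < K) f`_l * io (c l j).
Proof. by move=> jL; rewrite coef_poly jL. Qed.

Lemma chgP K L A (io : {rmorphism F -> A}) c a f g :
  chg K L io c (a *: f + g) = a *: chg K L io c f + chg K L io c g.
Proof.
apply/polyP => j; rewrite coefD coefZ !coef_poly; case: ifP => _; last by rewrite mulr0 addr0.
rewrite mulr_sumr -big_split; apply: eq_bigr => l _ /=.
by rewrite coefD coefZ mulrDl mulrA.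
Qed.

Lemma chg0 K L A (io : {rmorphism F -> A}) c : chg K L io c 0 = 0.
Proof.
by apply/polyP => j; rewrite coef_poly coef0 big1 ?if_same // => l _; rewrite coef0 mul0r.
Qed.

Lemma chgZ K L A (io : {rmorphism F -> A}) c a f :
  chg K L io c (a *: f) = a *: chg K L io c f.
Proof. by have := chgP K L io c a f 0; rewrite chg0 !addr0. Qed.

Lemma chg_shift K L A (io : {rmorphism F -> A}) c a f g :
  chg K L io c (g + a *: f) = chg K L io c g + a *: chg K L io c f.
Proof. by rewrite addrC chgP addrC. Qed.

Lemma chg_nat K L A (B : idomainType) (h : {rmorphism A -> B}) (io : {rmorphism F -> A})
    (io' : {rmorphism F -> B}) c (f : {poly A}) (f' : {poly B}) :
  (forall a, h (io a) = io' a) -> (forall i, (i < K)%N -> h f`_i = f'`_i) ->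
  forall j, (j < L)%N -> h (chg K L io c f)`_j = (chg K L io' c f')`_j.
Proof.
move=> hio hf j jL; rewrite !coef_chg // rmorph_sum; apply: eq_bigr => l _.
by rewrite rmorphM hio hf.
Qed.

Lemma chg_chg J K L A (io : {rmorphism F -> A}) c c' f :
  chg K L io c' (chg J K io c f) =
  chg J L io (fun l j => \sum_(k < K) c l k * c' k j) f.
Proof.
apply/polyP => j; rewrite !coef_poly; case: ifP => // jL.
transitivity (\sum_(k < K) \sum_(l < J) f`_l * io (c l k) * io (c' k j)).
  by apply: eq_bigr => k _; rewrite coef_chg // mulr_suml.
rewrite exchange_big; apply: eq_bigr => l _; rewrite rmorph_sum mulr_sumr.
by apply: eq_bigr => k _; rewrite rmorphM mulrA.
Qed.

Lemma eq_chg K L A (io : {rmorphism F -> A}) c c' f :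
  (forall l j, (l < K)%N -> (j < L)%N -> c l j = c' l j) -> chg K L io c f = chg K L io c' f.
Proof.
move=> e; apply/polyP => j; rewrite !coef_poly; case: ifP => // jL.
by apply: eq_bigr => l _; rewrite e.
Qed.

Lemma chg_id K A (io : {rmorphism F -> A}) c (f : {poly A}) : (size f <= K)%N ->
  (forall l j, (l < K)%N -> (j < K)%N -> c l j = (l == j)%:R) -> chg K K io c f = f.
Proof.
move=> sf cE; apply/polyP => j; rewrite coef_poly; case: ltnP => [jK|Kj]; last first.
  by rewrite nth_default // (leq_trans sf).
rewrite (bigD1 (Ordinal jK)) //= [X in _ + X]big1 ?addr0 => [|l ne].
  by rewrite cE // eqxx rmorph1 mulr1.
rewrite cE //; case: eqP => [e|_]; last by rewrite rmorph0 mulr0.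
by case/eqP: ne; apply: val_inj.
Qed.

End CoordinateChange.

Section SymmetricPower.
Context {F : fieldType} (d : nat).
Local Notation V2 := 'cV[F]_2.
Local Notation E := (sympow d V2).

Definition lin1 (v : V2) : {poly F} := (v 0 0)%:P + (v 1 0) *: 'X.

Lemma lin1P a (v w : V2) : lin1 (a *: v + w) = a *: lin1 v + lin1 w.
Proof. by rewrite /lin1 !mxE -!mul_polyC !polyCD !polyCM; ring. Qed.

Definition linprod (v : 'I_d -> V2) : {poly F} := \prod_i lin1 (v i).

Lemma linprodP (v : 'I_d -> V2) i a x y :
  linprod (@dfwith _ (fun=> V2) v i (a *: x + y)) =
  a *: linprod (@dfwith _ (fun=> V2) v i x) + linprod (@dfwith _ (fun=> V2) v i y).
Proof.
rewrite /linprod !(bigD1 (P := xpredT) i) //= !dfwith_in lin1P mulrDl -scalerAl.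
congr (a *: (_ * _) + _ * _); apply: eq_bigr => j ji;
  by rewrite !dfwith_out // eq_sym.
Qed.

Definition coefT l : 'Hom(tpow 'I_d V2, F^o) :=
  tlift (fun v : 'I_d -> V2 => (linprod v)`_l : F^o).

Lemma coefT_pure l v : coefT l (pure v) = (linprod v)`_l.
Proof. by rewrite /coefT tlift_pure // => w i a x y; rewrite linprodP coefD coefZ. Qed.

Lemma coefT_rel l t : t \in sympow_rel d V2 -> coefT l t = 0.
Proof.
have inv s : (coefT l \o tshuffle s = coefT l)%VF.
  apply: tens_ext => v; rewrite comp_lfunE tshuffle_pure !coefT_pure /linprod.
  by rewrite [in RHS](reindex_inj (@perm_inj _ s)).
case/memv_sumP => u uP ->; rewrite linear_sum big1 // => s _.
have /memv_imgP[x _ ->] := uP s isT.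
by rewrite add_lfunE opp_lfunE id_lfunE linearB /= -comp_lfunE inv subrr.
Qed.

Definition coefS l : 'Hom(E, F^o) := (coefT l \o (qproj (sympow_rel d V2))^-1)%VF.

Lemma coefSE l t : coefS l (qproj (sympow_rel d V2) t) = coefT l t.
Proof.
rewrite comp_lfunE; apply/eqP; rewrite -subr_eq0 -linearB; apply/eqP/coefT_rel.
by rewrite -qproj_eq0 linearB /= limg_lfunVK ?subrr // limg_qproj memvf.
Qed.

Definition e_ c : V2 := delta_mx c 0.

Lemma lin1_e (c : 'I_2) : lin1 (e_ c) = 'X^c.
Proof.
rewrite /lin1 !mxE !andbT; case: c => -[|[|//]] lt /=.
  by rewrite scale0r addr0 expr0.
by rewrite scale1r add0r expr1.
Qed.

Definition std l (i : 'I_d) : 'I_2 := if (i < l)%N then 1 else 0.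

Definition stdv l (i : 'I_d) : V2 := e_ (std l i).

Definition bS l : E := qproj (sympow_rel d V2) (pure (stdv l)).

Lemma linprod_e (c : 'I_d -> 'I_2) : linprod (fun i => e_ (c i)) = 'X^(\sum_i c i)%N.
Proof. by rewrite -prodrXr; apply: eq_bigr => i _; rewrite lin1_e. Qed.

Lemma sum_std l : (l <= d)%N -> (\sum_(i < d) std l i)%N = l.
Proof.
move=> le; transitivity (\sum_(i < d | (i < l)%N) 1)%N.
  by rewrite [RHS]big_mkcond; apply: eq_bigr => i _; rewrite /std; case: ifP.
by rewrite (big_ord_narrow le) sum1_card card_ord.
Qed.

Lemma coefS_b l l' : (l <= d)%N -> coefS l' (bS l) = (l == l')%:R.
Proof. by move=> le; rewrite coefSE coefT_pure linprod_e sum_std // coefXn eq_sym. Qed.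

(** In the coinvariants the order of the factors is lost, so a tensor of basis vectors can be sorted
    and depends only on the number of factors equal to the second one. *)
Lemma qproj_e (c : 'I_d -> 'I_2) :
  qproj (sympow_rel d V2) (pure (fun i => e_ (c i))) = bS (\sum_i c i)%N.
Proof.
set l := (\sum_i c i)%N.
have le_ld : (l <= d)%N.
  rewrite -[X in (_ <= X)%N]card_ord -sum1_card; apply: leq_sum => i _.
  by have := ltn_ord (c i); rewrite ltnS.
have cnt (w : 'I_d -> 'I_2) : count_mem (1 : 'I_2) [tuple w i | i < d] = (\sum_i w i)%N.
  rewrite count_map -?enumT count_enum -sum1_card big_mkcond; apply: eq_bigr => i _.
  by rewrite inE /=; case: (w i) => -[|[|//]].
have szc (s : d.-tuple 'I_2) : count_mem (0 : 'I_2) s = (d - count_mem (1%R : 'I_2) s)%N.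
  rewrite -[X in (X - _)%N](size_tuple s) -(count_predC (pred1 (1 : 'I_2)) s) addKn.
  by apply: eq_count => -[[|[|//]] lt].
have /tuple_permP[s es] : perm_eq [tuple c i | i < d] [tuple std l i | i < d].
  have e1 : count_mem (1 : 'I_2) [tuple c i | i < d] = count_mem (1 : 'I_2) [tuple std l i | i < d].
    by rewrite !cnt sum_std.
  have e0 : count_mem (0 : 'I_2) [tuple c i | i < d] = count_mem (0 : 'I_2) [tuple std l i | i < d].
    by rewrite !szc e1.
  apply/allP => b _; apply/eqP; have [->|b0] := eqVneq b 0; first exact: e0.
  have -> : b = 1 by apply: val_inj; case: b b0 => -[|[|//]].
  exact: e1.
have cE i : c i = std l (s i).
  by have := congr1 (fun w => tnth w i) (val_inj es); rewrite !tnth_mktuple.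
have -> : pure (fun i => e_ (c i)) = tshuffle s (pure (stdv l)).
  by rewrite tshuffle_pure; congr pure; apply: boolp.funext => i; rewrite cE.
apply/eqP; rewrite -subr_eq0 -linearB qproj_eq0.
apply: (subvP (sumv_sup s isT (subvv _))); apply/memv_imgP; exists (pure (stdv l)).
  exact: memvf.
by rewrite add_lfunE opp_lfunE id_lfunE.
Qed.

Lemma bS_span x : x = \sum_(l < d.+1) coefS l x *: bS l.
Proof.
have [t ->] := qproj_surj x.
have pureE (v : 'I_d -> V2) : qproj (sympow_rel d V2) (pure v) =
    \sum_(l < d.+1) coefT l (pure v) *: bS l.
  pose phi (v : 'I_d -> V2) := qproj (sympow_rel d V2) (pure v).
  pose psi (v : 'I_d -> V2) := \sum_(l < d.+1) coefT l (pure v) *: bS l.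
  suff e : phi = psi by rewrite -[LHS]/(phi v) e.
  pose B (i : 'I_d) (y : V2) := exists c : 'I_2, y = e_ c.
  apply: (@multilinear_span_ext F _ (fun=> V2) _ B) => [i y|||w Bw].
  - exists 'I_2, (fun c => y c 0), e_; split=> [c|]; first by exists c.
    apply/matrixP => a b; rewrite summxE (bigD1 a) //= !mxE [b]ord1 eqxx mulr1.
    by rewrite big1 ?addr0 // => c ne; rewrite !mxE eq_sym (negPf ne) mulr0.
  - exact: multilinear_comp.
  - move=> w i a y z; rewrite scaler_sumr -big_split; apply: eq_bigr => l _ /=.
    by rewrite pure_multilinear linearP scalerDl scalerA.
  have [c wE] : exists c : 'I_d -> 'I_2, w = fun i => e_ (c i).
    exists (fun i => projT1 (boolp.cid (Bw i))); apply: boolp.funext => i.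
    by case: boolp.cid.
  rewrite wE /phi /psi qproj_e; set k := (\sum_i c i)%N.
  have lt : (k < d.+1)%N.
    rewrite ltnS -[X in (_ <= X)%N]card_ord -sum1_card; apply: leq_sum => i _.
    by have := ltn_ord (c i); rewrite ltnS.
  rewrite (bigD1 (Ordinal lt)) //= coefT_pure linprod_e coefXn eqxx scale1r.
  rewrite big1 ?addr0 // => l ne; rewrite coefT_pure linprod_e coefXn.
  by case: eqP => [e|_]; [case/eqP: ne; apply: val_inj | rewrite scale0r].
rewrite {1}(tens_sum_basis t) linear_sum.
under eq_bigr do rewrite linearZ /= pureE scaler_sumr.
rewrite exchange_big; apply: eq_bigr => l _; rewrite coefSE [in RHS](tens_sum_basis t) linear_sum scaler_suml.
apply: eq_bigr => s _; rewrite [in RHS]linearZ; exact: scalerA.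
Qed.

Lemma dim_sympow : \dim {:E} = d.+1.
Proof.
pose X := [tuple bS i | i < d.+1].
have nX (i : 'I_d.+1) : X`_i = bS i by rewrite -tnth_nth tnth_mktuple.
have fX : free X.
  apply/freeP => k z i; have := congr1 (coefS i) z; rewrite linear0 linear_sum (bigD1 i) //=.
  rewrite big1 ?addr0 => [|j ne].
    by rewrite linearZ nX /= (coefS_b _ (leq_ord i)) eqxx [_ *: _]mulr1.
  rewrite linearZ nX /= (coefS_b _ (leq_ord j)); case: eqP => [e|_]; last exact: mulr0.
  by case/eqP: ne; apply: val_inj.
have sX : <<X>>%VS = fullv.
  apply/eqP; rewrite eqEsubv subvf; apply/subvP => x _; rewrite (bS_span x).
  apply: memv_suml => i _; apply/memvZ/memv_span; rewrite -nX mem_nth ?size_tuple //.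
by rewrite -sX; move: fX; rewrite /free size_tuple => /eqP.
Qed.

Local Notation D := (\dim {:E}).
Local Notation vbas := (vbasis {:E}).

Definition Bc l j : F := if insub j is Some j' then coord vbas j' (bS l) else 0.
Definition Bc' (j l : nat) : F := coefS l vbas`_j.

Lemma BcE l (j : 'I_D) : Bc l j = coord vbas j (bS l).
Proof. by rewrite /Bc valK. Qed.

(** The basis [vbasis] of Sym^d E is an arbitrary choice: [cvt] passes from the coefficients of a
    binary form to coordinates in that basis, and [cvt'] back. *)
Definition cvt (A : idomainType) (io : {rmorphism F -> A}) : {poly A} -> {poly A} := chg d.+1 D io Bc.
Definition cvt' (A : idomainType) (io : {rmorphism F -> A}) : {poly A} -> {poly A} := chg D d.+1 io Bc'.

Lemma cvtK (A : idomainType) (io : {rmorphism F -> A}) (f : {poly A}) : (size f <= d.+1)%N -> cvt' io (cvt io f) = f.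
Proof.
move=> sf; rewrite /cvt' /cvt chg_chg chg_id // => l j ld jd.
rewrite -coefS_b // [in RHS](coord_vbasis (memvf (bS l))) linear_sum.
by apply: eq_bigr => k _; rewrite linearZ BcE.
Qed.

Lemma cvt'K (A : idomainType) (io : {rmorphism F -> A}) (f : {poly A}) : (size f <= D)%N -> cvt io (cvt' io f) = f.
Proof.
move=> sf; rewrite /cvt' /cvt chg_chg chg_id // => l j lD jD.
pose l' := Ordinal lD; pose j' := Ordinal jD.
transitivity (coord vbas j' vbas`_l').
  rewrite [in RHS](bS_span vbas`_l') linear_sum; apply: eq_bigr => k _.
  by rewrite linearZ (BcE k j').
by rewrite coord_free ?(basis_free (vbasisP _)) // eq_sym.
Qed.

(** On the monomial [bS l] both sides are the product of d - l images of the first basis vector and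
    l images of the second, read as linear polynomials. *)
Lemma cvt_act (g : SL2 F) (A : idomainType) (io : {rmorphism F -> A}) (f : {poly A}) :
  (size f <= d.+1)%N ->
  lext io (sympow_rep d (nat_rep F) g) (cvt io f) = cvt io (gact d (map_mx io (SL2_mx g)) f).
Proof.
move=> sf; pose G l j : F := (lincol (SL2_mx g) 0 ^+ (d - l) * lincol (SL2_mx g) 1 ^+ l)`_j.
have -> : gact d (map_mx io (SL2_mx g)) f = chg d.+1 d.+1 io G f.
  have lm c : lincol (map_mx io (SL2_mx g)) c = map_poly io (lincol (SL2_mx g) c).
    by rewrite /lincol !mxE -!mul_polyC rmorphD rmorphM /= !map_polyC map_polyX.
  apply/polyP => j; rewrite coef_poly; case: ltnP => [lt|le]; last first.
    by rewrite nth_default // (leq_trans (size_gact _ _ _)).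
  rewrite coef_sum; apply: eq_bigr => l _.
  by rewrite coefZ !lm -!rmorphXn -rmorphM coef_map.
set rg := sympow_rep _ _ _.
have -> : lext io rg (cvt io f) =
    chg D D io (fun l j => if insub j is Some j' then coord vbas j' (rg vbas`_l) else 0) (cvt io f).
  apply/polyP => j; rewrite coef_poly; case: ltnP => [lt|le]; last first.
    by rewrite nth_default // (leq_trans (size_lext _ _ _)).
  by rewrite -[j]/(nat_of_ord (Ordinal lt)) coef_lext; apply: eq_bigr => l _; rewrite valK.
rewrite /cvt !chg_chg; apply: eq_chg => l j ld jD; pose j' := Ordinal jD.
have ij : insub j = Some j' :> option 'I_D := valK j'.
transitivity (coord vbas j' (rg (bS l))).
  rewrite [in RHS](coord_vbasis (memvf (bS l))) !linear_sum; apply: eq_bigr => k _.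
  by rewrite BcE ij linearZ linearZ.
rewrite [in LHS](bS_span (rg (bS l))) linear_sum; apply: eq_bigr => k _.
rewrite linearZ (BcE k j'); congr (_ * _).
rewrite /rg /bS sympow_rep_qproj coefSE tens_rep_pure coefT_pure /G; congr ((polyseq _)`_k).
have le (c : 'I_2) : lin1 (nat_rep F g (e_ c)) = lincol (SL2_mx g) c.
  by rewrite /lin1 /lincol lfunE /= /e_ -colE !mxE.
rewrite /linprod (bigID (fun i : 'I_d => (i < l)%N)) /= mulrC; congr (_ * _).
  rewrite (eq_bigr (fun=> lincol (SL2_mx g) 0)) => [|i /negPf il]; last by rewrite /stdv /std il le.
  rewrite prodr_const; congr (_ ^+ _); rewrite -sum1_card.
  have := sum1_card 'I_d; rewrite card_ord (bigID (fun i : 'I_d => (i < l)%N)) /=.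
  rewrite (big_ord_narrow (ld : (l <= d)%N)) sum1_card card_ord.
  by move=> /(congr1 (subn^~ l)); rewrite addKn => <-.
rewrite (eq_bigr (fun=> lincol (SL2_mx g) 1)) => [|i il]; last by rewrite /stdv /std il le.
by rewrite (big_ord_narrow (ld : (l <= d)%N)) prodr_const card_ord.
Qed.

End SymmetricPower.

Section PolynomialPoints.
Context {F : fieldType} {n m d : nat}.
Local Notation E := (sympow d 'cV[F]_2).
Local Notation la := [:: n; m].
Implicit Types (A : idomainType) (lam : 'Hom(weyl la E, F^o)).

(** The E(f, g) of the overview, at vectors given by the coefficients of binary forms. *)
Definition sw A (io : {rmorphism F -> A}) lam (f g : {poly A}) : A :=
  wev io lam (cvt d io f) (cvt d io g).

Lemma swP A (io : {rmorphism F -> A}) a lam lam' (f g : {poly A}) :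
  sw io (a *: lam + lam') f g = io a * sw io lam f g + sw io lam' f g.
Proof. exact: wevP. Qed.

Lemma sw0 A (io : {rmorphism F -> A}) (f g : {poly A}) : sw io 0 f g = 0.
Proof. exact: mev0. Qed.

Lemma sw_nat A (B : idomainType) (h : {rmorphism A -> B}) (io : {rmorphism F -> A})
    (io' : {rmorphism F -> B}) lam (f g : {poly A}) (f' g' : {poly B}) :
  (forall c, h (io c) = io' c) -> (forall i, (i < d.+1)%N -> h f`_i = f'`_i) ->
  (forall i, (i < d.+1)%N -> h g`_i = g'`_i) -> h (sw io lam f g) = sw io' lam f' g'.
Proof. by move=> hio hf hg; apply: wev_nat => // i; apply: chg_nat. Qed.

Lemma sw_scale A (io : {rmorphism F -> A}) lam s t (f g : {poly A}) :
  sw io lam (s *: f) (t *: g) = s ^+ n * t ^+ m * sw io lam f g.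
Proof. by rewrite /sw /cvt !chgZ wev_scale. Qed.

Lemma sw_shift A (io : {rmorphism F -> A}) lam t (f g : {poly A}) : (m <= n)%N ->
  sw io lam f (g + t *: f) = sw io lam f g.
Proof. by move=> le_mn; rewrite /sw /cvt chg_shift wev_shift. Qed.

Lemma sw_inj lam : (forall A (io : {rmorphism F -> A}) (f g : {poly A}),
  (size f <= d.+1)%N -> (size g <= d.+1)%N -> sw io lam f g = 0) -> lam = 0.
Proof.
move=> z; apply: wev_inj => A io f g sf sg.
by rewrite -(cvt'K io sf) -(cvt'K io sg); apply: z; apply: size_chg.
Qed.

Lemma sw_act (g : SL2 F) A (io : {rmorphism F -> A}) lam (f f' : {poly A}) :
  (size f <= d.+1)%N -> (size f' <= d.+1)%N ->
  sw io (lam \o weyl_rep la (sympow_rep d (nat_rep F)) g)%VF f f' =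
  sw io lam (gact d (map_mx io (SL2_mx g)) f) (gact d (map_mx io (SL2_mx g)) f').
Proof. by move=> sf sf'; rewrite /sw wev_act !cvt_act. Qed.

Lemma sw_tabval L : (m <= n)%N -> all (fun c => tabok d.+1 n m c.2) L -> exists lam,
  forall A (io : {rmorphism F -> A}) (f g : {poly A}),
    (size f <= d.+1)%N -> (size g <= d.+1)%N -> sw io lam f g = tabval io f g L.
Proof.
move=> le_mn okL; pose D := \dim {:E}.
pose phi : {mpoly F[D + D]} := tabval (@gen F D) (cvt' d (@gen F D) (gx D)) (cvt' d (@gen F D) (gy D)) L.
have phiE A (io : {rmorphism F -> A}) (f g : {poly A}) : (size f <= D)%N -> (size g <= D)%N ->
    pev io f g phi = tabval io (cvt' d io f) (cvt' d io g) L.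
  move=> sf sg; have ext (p : {poly {mpoly F[D + D]}}) (q : {poly A}) :
      (forall i, (i < D)%N -> pev io f g p`_i = q`_i) ->
      forall i, pev io f g (cvt' d (@gen F D) p)`_i = (cvt' d io q)`_i.
    move=> pq i; have [lt|le] := ltnP i d.+1.
      by apply: (chg_nat (K := D)) => // c; apply: pevC.
    by rewrite !nth_default ?rmorph0 // (leq_trans (size_chg _ _ _ _ _)).
  apply: tabval_nat => [c|i|i]; first exact: pevC.
    by apply: ext => j jD; apply: pev_gx.
  by apply: ext => j jD; apply: pev_gy.
have sZ A (s : A) (f : {poly A}) : (size f <= D)%N -> (size (s *: f) <= D)%N.
  by apply: leq_trans; apply: size_scale_leq.
have [||||lam lamE] := @wev_exists F n m E le_mn phi.
- by rewrite dim_sympow.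
- move=> A io s f g sf sg; rewrite !phiE ?sZ // /cvt' !chgZ -/(cvt' _ _ _).
  by rewrite (tabval_hom _ _ _ _ _ okL le_mn) expr0 expr1n expr1 mulr1.
- move=> A io s f g sf sg; rewrite !phiE ?sZ // /cvt' !chgZ -/(cvt' _ _ _).
  by rewrite (tabval_hom _ _ _ _ _ okL le_mn) expr0 expr1n expr1 mul1r.
- move=> A io t f g sf sg; rewrite !phiE //; last first.
    by rewrite (leq_trans (size_polyD _ _)) // geq_max sg sZ.
  by rewrite /cvt' chg_shift /tabval; apply: eq_bigr => c _; rewrite tabv_shift.
by exists lam => A io f g sf sg; rewrite /sw lamE ?size_chg // phiE ?size_chg // !cvtK.
Qed.

End PolynomialPoints.

Section SymmetricTensorPoints.
Context {F : fieldType} {r e : nat}.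
Local Notation E := (sympow e 'cV[F]_2).
Local Notation S := (symtens r E).
Implicit Types (A : idomainType) (gam : 'Hom(S, F^o)).

Definition qS : 'Hom(tpow 'I_r E, S) := linfun (vsproj (symtens_space r E)).

Lemma vsval_qS t : t \in symt (fun _ : 'I_r => tt) -> vsval (qS t) = t.
Proof. by rewrite -symtens_symt => ts; rewrite lfunE /= vsprojK. Qed.

Definition sv A (io : {rmorphism F -> A}) gam (u : {poly A}) : A :=
  mev qS (fun=> tt) io gam (fun=> cvt e io u).

Lemma svP A (io : {rmorphism F -> A}) a gam gam' u :
  sv io (a *: gam + gam') u = io a * sv io gam u + sv io gam' u.
Proof. exact: mevP. Qed.

Lemma sv0 A (io : {rmorphism F -> A}) u : sv io 0 u = 0.
Proof. exact: mev0. Qed.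

Lemma sv_sum A (io : {rmorphism F -> A}) (J : Type) (s : seq J) (a : J -> F)
    (gam : J -> 'Hom(S, F^o)) u :
  sv io (\sum_(j <- s) a j *: gam j) u = \sum_(j <- s) io (a j) * sv io (gam j) u.
Proof.
elim: s => [|j s IHs]; first by rewrite !big_nil sv0.
by rewrite !big_cons svP IHs.
Qed.

Lemma sv_act (g : SL2 F) A (io : {rmorphism F -> A}) gam (u : {poly A}) :
  (size u <= e.+1)%N ->
  sv io (gam \o symtens_rep r (sympow_rep e (nat_rep F)) g)%VF u =
  sv io gam (gact e (map_mx io (SL2_mx g)) u).
Proof.
move=> su; set rE := sympow_rep e (nat_rep F).
rewrite /sv (@mev_act _ _ _ _ _ qS (fun=> tt) _ io (rE g) (symtens_rep r rE g) gam); last first.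
  move=> t ts.
  have gts : tmap (fun=> rE g) t \in symt (fun _ : 'I_r => tt).
    by rewrite -symtens_symt; apply: (symtens_stable rE g); rewrite symtens_symt.
  by apply: val_inj; rewrite /= vsval_symtens_rep (vsval_qS gts) (vsval_qS ts).
by apply: eq_tev => i; rewrite cvt_act.
Qed.

Lemma sv_monomial (w : 'I_r -> 'I_e.+1) : exists gam,
  forall A (io : {rmorphism F -> A}) (u : {poly A}), (size u <= e.+1)%N ->
    sv io gam u = \prod_i u`_(w i).
Proof.
pose nu : 'Hom(tpow 'I_r E, F^o) := prodf (fun i => @coefS F e (w i)).
exists (nu \o linfun vsval)%VF => A io u su.
have -> : sv io (nu \o linfun vsval) u = tev io nu (fun=> cvt e io u).
  apply/eqP; rewrite eq_sym -subr_eq0; apply/eqP.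
  have <- := tev_symt0 (rho := fun _ : 'I_r => tt) io
    (nu := ((-1) *: ((nu \o linfun vsval) \o qS) + nu)%VF) (fun=> cvt e io u).
    by rewrite tevP rmorphN1 mulN1r addrC.
  move=> t ts; rewrite add_lfunE scale_lfunE (comp_lfunE _ qS) (comp_lfunE nu).
  rewrite (_ : linfun vsval (qS t) = t); first by rewrite scaleN1r addNr.
  by rewrite [LHS]lfunE /= vsval_qS.
rewrite -[in RHS](cvtK io su) /tev.
transitivity (\prod_(i < r) \sum_(l < \dim {:E}) (cvt e io u)`_l * io (coefS e (w i) (vbasis {:E})`_l)).
  rewrite bigA_distr_bigA sum_idx; apply: eq_bigr => s _.
  by rewrite prodf_pure rmorph_prod -big_split; apply: eq_bigr => i _; apply: mulrC.
by apply: eq_bigr => i _; rewrite /cvt' coef_chg.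
Qed.

(** The homogeneous part of degree [r] of [c], evaluated at u: the part that comes from a functional
    on Sym_r Sym^e E. *)
Definition hev A (io : {rmorphism F -> A}) (u : {poly A}) (c : {mpoly F[e.+1]}) : A :=
  \sum_(mu <- msupp c | mdeg mu == r) io c@_mu * \prod_(i < e.+1) u`_i ^+ mu i.

Lemma sv_hev c : exists gam, forall A (io : {rmorphism F -> A}) (u : {poly A}),
  (size u <= e.+1)%N -> sv io gam u = hev io u c.
Proof.
have mono (mu : 'X_{1..e.+1}) : mdeg mu == r -> exists gam,
    forall A (io : {rmorphism F -> A}) (u : {poly A}), (size u <= e.+1)%N ->
    sv io gam u = \prod_(i < e.+1) u`_i ^+ mu i.
  move=> /eqP dmu; pose w := flatten [seq nseq (mu i) i | i <- enum 'I_e.+1].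
  have sw' : size w = r.
    rewrite -dmu mdegE size_flatten /shape -map_comp sumnE big_map big_enum /=.
    by apply: eq_bigr => i _; rewrite size_nseq.
  have [gam gamE] := sv_monomial (fun i : 'I_r => nth ord0 w i).
  exists gam => A io u su; rewrite gamE //.
  transitivity (\prod_(i <- w) u`_i).
    by rewrite (big_nth ord0) sw' big_mkord.
  rewrite big_flatten big_map big_enum; apply: eq_bigr => i _ /=.
  by rewrite big_nseq iter_mulr_1.
rewrite /hev; elim: (msupp c) => [|mu s [gam gamE]].
  by exists 0 => A io u su; rewrite big_nil sv0.
have [dm | nd] := boolP (mdeg mu == r).
  have [gam1 gam1E] := mono mu dm.
  by exists (c@_mu *: gam1 + gam) => A io u su; rewrite svP gam1E // gamE // big_cons dm.
by exists gam => A io u su; rewrite gamE // big_cons (negPf nd).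
Qed.

End SymmetricTensorPoints.

(** * Functionals on the tensor product of two modules *)

Section TensorTwo.
Context {F : fieldType} {S W : vectType F}.
Local Notation V2 b := (if b then S else W).

Definition pair2 (s : S) (x : W) (b : bool) : V2 b := if b return V2 b then s else x.

Definition pure2 s x : tens2 S W := pure (pair2 s x).

Lemma pure2_linl x a s s' : pure2 (a *: s + s') x = a *: pure2 s x + pure2 s' x.
Proof.
have E z : pair2 z x = @dfwith _ (fun b : bool => V2 b) (pair2 s x) true z.
  by apply: boolp.functional_extensionality_dep => b; case: dfwithP => [//|[] //].
by have := @pure_multilinear _ _ (fun b : bool => V2 b) (pair2 s x) true a s s'; rewrite -!E.
Qed.

Lemma pure2_linr s a x x' : pure2 s (a *: x + x') = a *: pure2 s x + pure2 s x'.
Proof.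
have E z : pair2 s z = @dfwith _ (fun b : bool => V2 b) (pair2 s x) false z.
  by apply: boolp.functional_extensionality_dep => b; case: dfwithP => [//|[] //].
by have := @pure_multilinear _ _ (fun b : bool => V2 b) (pair2 s x) false a x x'; rewrite -!E.
Qed.

Definition slice_fun s x := pure2 s x.
Fact slice_linear s : linear (slice_fun s).
Proof. by move=> a x y; apply: pure2_linr. Qed.
HB.instance Definition _ s := GRing.isLinear.Build F W (tens2 S W) _ (slice_fun s) (slice_linear s).

Definition slice s : 'Hom(W, tens2 S W) := linfun (slice_fun s).

Lemma sliceE s x : slice s x = pure2 s x. Proof. by rewrite lfunE. Qed.

Lemma sliceP a s s' : slice (a *: s + s') = a *: slice s + slice s'.
Proof. by apply/lfunP => x; rewrite add_lfunE scale_lfunE !sliceE pure2_linl. Qed.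

Lemma slice_sum (J : finType) (a : J -> F) (s : J -> S) :
  slice (\sum_j a j *: s j) = \sum_j a j *: slice (s j).
Proof.
have s0 : slice 0 = 0 by have := sliceP (-1) 0 0; rewrite !scaleN1r !addNr.
have sD x y : slice (x + y) = slice x + slice y by have := sliceP 1 x y; rewrite !scale1r.
rewrite (big_morph slice sD s0); apply: eq_bigr => j _.
by have := sliceP (a j) (s j) 0; rewrite s0 !addr0.
Qed.

Lemma tens2_functional (gam : 'Hom(S, F^o)) (lam : 'Hom(W, F^o)) :
  exists tau : 'Hom(tens2 S W, F^o), forall s x, tau (pure2 s x) = gam s * lam x.
Proof.
exists (prodf (fun b : bool => if b return 'Hom(V2 b, F^o) then gam else lam)) => s x.
by rewrite prodf_pure big_bool.
Qed.

Lemma tens2_rep_pure2 (G : groupType) (rS : rep G S) (rW : rep G W) g s x :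
  tens2_rep rS rW g (pure2 s x) = pure2 (rS g s) (rW g x).
Proof.
rewrite tens_rep_pure; congr pure.
by apply: boolp.functional_extensionality_dep => -[].
Qed.

Definition cfun (j : 'I_(\dim {:S})) : 'Hom(S, F^o) :=
  linfun (coord (vbasis {:S}) j : S -> F^o).

Lemma cfunE j s : cfun j s = coord (vbasis {:S}) j s. Proof. by rewrite lfunE. Qed.

Lemma functional_sum (gam : 'Hom(S, F^o)) :
  gam = \sum_(j < \dim {:S}) gam (vbasis {:S})`_j *: cfun j.
Proof.
apply/lfunP => s; rewrite {1}(coord_vbasis (memvf s)) linear_sum sum_lfunE.
by apply: eq_bigr => j _; rewrite linearZ scale_lfunE cfunE; apply: mulrC.
Qed.

End TensorTwo.

Section TensorPoints.
Context {F : fieldType} {r e n m k : nat}.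
Local Notation Ee := (sympow e 'cV[F]_2).
Local Notation Ek := (sympow k 'cV[F]_2).
Local Notation S := (symtens r Ee).
Local Notation W := (weyl [:: n; m] Ek).
Local Notation T := (tens2 S W).
Implicit Types (A : idomainType) (tau : 'Hom(T, F^o)).

(** The chi(u; f, g) of the overview: [tau] is expanded along a basis of the first factor, and each
    coordinate functional is evaluated at u as a polynomial law. *)
Definition tE A (io : {rmorphism F -> A}) tau (u f g : {poly A}) : A :=
  \sum_(j < \dim {:S}) sv io (cfun j) u * sw io (tau \o slice (vbasis {:S})`_j)%VF f g.

Lemma tEP A (io : {rmorphism F -> A}) a tau tau' (u f g : {poly A}) :
  tE io (a *: tau + tau') u f g = io a * tE io tau u f g + tE io tau' u f g.
Proof.
rewrite /tE mulr_sumr -big_split; apply: eq_bigr => j _ /=.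
by rewrite comp_lfunDl -comp_lfunZl swP mulrDr mulrCA.
Qed.

Lemma tE0 A (io : {rmorphism F -> A}) (u f g : {poly A}) : tE io 0 u f g = 0.
Proof. by apply: big1 => j _; rewrite comp_lfun0l sw0 mulr0. Qed.

Lemma tE_pure (gam : 'Hom(S, F^o)) (lam : 'Hom(W, F^o)) tau : (forall s x, tau (pure2 s x) = gam s * lam x) ->
  forall A (io : {rmorphism F -> A}) (u f g : {poly A}),
  tE io tau u f g = sv io gam u * sw io lam f g.
Proof.
move=> tauE A io u f g; rewrite {1}(functional_sum gam) sv_sum mulr_suml.
apply: eq_bigr => j _; rewrite [io _ * _]mulrC -mulrA; congr (_ * _).
have -> : (tau \o slice (vbasis {:S})`_j)%VF = gam (vbasis {:S})`_j *: lam + 0.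
  by apply/lfunP => x; rewrite comp_lfunE sliceE tauE addr0 scale_lfunE.
by rewrite swP sw0 addr0.
Qed.

(** Expanding the images of the basis vectors of the first factor brings in the matrix of g;
    exchanging the two sums moves this matrix to u. *)
Lemma tE_act (g : SL2 F) A (io : {rmorphism F -> A}) tau (u f f' : {poly A}) :
  (size u <= e.+1)%N -> (size f <= k.+1)%N -> (size f' <= k.+1)%N ->
  tE io (tau \o tens2_rep (symtens_rep r (sympow_rep e (nat_rep F)))
    (weyl_rep [:: n; m] (sympow_rep k (nat_rep F))) g)%VF u f f' =
  tE io tau (gact e (map_mx io (SL2_mx g)) u)
    (gact k (map_mx io (SL2_mx g)) f) (gact k (map_mx io (SL2_mx g)) f').
Proof.
move=> su sf sf'; set rS := symtens_rep _ _; set rW := weyl_rep _ _.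
pose vS := vbasis {:S}.
have E1 (j : 'I_(\dim {:S})) : ((tau \o tens2_rep rS rW g) \o slice vS`_j)%VF =
    \sum_(l < \dim {:S}) coord vS l (rS g vS`_j) *: ((tau \o slice vS`_l) \o rW g)%VF.
  apply/lfunP => x; rewrite !comp_lfunE sliceE tens2_rep_pure2 -sliceE.
  rewrite [in LHS](coord_vbasis (memvf (rS g vS`_j))) slice_sum !sum_lfunE linear_sum.
  by apply: eq_bigr => l _; rewrite !scale_lfunE linearZ !comp_lfunE.
have swS (J : finType) (a : J -> F) (lam : J -> 'Hom(W, F^o)) :
    sw io (\sum_j a j *: lam j) f f' = \sum_j io (a j) * sw io (lam j) f f'.
  elim: (index_enum J) => [|j s IHs]; first by rewrite !big_nil sw0.
  by rewrite !big_cons swP IHs.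
rewrite /tE; under eq_bigr do rewrite E1 swS mulr_sumr.
rewrite exchange_big; apply: eq_bigr => l _ /=.
rewrite -sv_act // -sw_act // [(cfun l \o _)%VF]functional_sum sv_sum mulr_suml.
apply: eq_bigr => j _; rewrite comp_lfunE cfunE mulrA; congr (_ * _); exact: mulrC.
Qed.

Lemma tE_exists (L : seq ({mpoly F[e.+1]} * (seq (nat * nat) * seq nat))) : (m <= n)%N ->
  all (fun c => tabok k.+1 n m c.2) L -> exists tau,
  forall A (io : {rmorphism F -> A}) (u f g : {poly A}),
    (size u <= e.+1)%N -> (size f <= k.+1)%N -> (size g <= k.+1)%N ->
    tE io tau u f g = \sum_(c <- L) @hev F r e A io u c.1 * tabv f g c.2.
Proof.
move=> le_mn; elim: L => [|c L IHL] /= => [_|/andP[okc /IHL[tau tauE]]].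
  by exists 0 => A io u f g _ _ _; rewrite tE0 big_nil.
have [gam gamE] := @sv_hev F r e c.1.
have [|lam lamE] := @sw_tabval F n m k [:: (1, c.2)] le_mn; first by rewrite /= okc.
have [tau1 tau1E] := tens2_functional gam lam.
exists (1 *: tau1 + tau) => A io u f g su sf sg.
rewrite tEP rmorph1 mul1r tauE // (tE_pure tau1E) gamE // lamE // big_cons.
by rewrite /tabval big_seq1 /= rmorph1 mul1r.
Qed.

End TensorPoints.

(** * The layers *)

Section HomogeneousPart.
Context {F : fieldType} {e r : nat}.

Lemma coef_hev (A : idomainType) (io : {rmorphism F -> A}) (u : {poly A}) (c : {mpoly F[e.+1]}) :
  (mmap (polyC \o io) (fun i : 'I_e.+1 => u`_i *: 'X) c)`_r = @hev F r e A io u c.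
Proof.
rewrite /mmap coef_sum /hev [RHS]big_mkcond; apply: eq_bigr => mu _ /=.
rewrite coefCM /mmap1.
have -> : \prod_(i < e.+1) (u`_i *: 'X) ^+ mu i = (\prod_(i < e.+1) u`_i ^+ mu i) *: 'X^(mdeg mu).
  rewrite mdegE -prodrXr -scaler_prod; apply: eq_bigr => i _.
  by rewrite exprZn.
by rewrite coefZ coefXn eq_sym; case: eqP => _; rewrite ?mulr1 ?mulr0.
Qed.

End HomogeneousPart.

Section ResultantStep.
Context {F : fieldType} {n m d k : nat}.
Local Notation Ed := (sympow d 'cV[F]_2).
Context (lam : 'Hom(weyl [:: n; m] Ed, F^o)).
Hypotheses (le_mn : (m <= n)%N) (k_gt0 : (0 < k)%N) (le_kd : (k <= d)%N).

Section Abstract.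
Context (R : idomainType) (ioF : {rmorphism F -> R}) (U : {poly R}).

(** For fixed U over a domain [R], the map (f, g) -> E(U f, U g) is a polynomial with coefficients
    in [R]; a generic U then treats all u at once. *)
Lemma generic_law : exists phi : {mpoly R[k.+1 + k.+1]},
  forall (A : idomainType) (ioR : {rmorphism R -> A}) (f g : {poly A}),
    (size f <= k.+1)%N -> (size g <= k.+1)%N ->
    pev ioR f g phi = sw (ioR \o ioF) lam (map_poly ioR U * f) (map_poly ioR U * g).
Proof.
exists (sw (@gen R k.+1 \o ioF) lam (map_poly (@gen R k.+1) U * gx k.+1)
   (map_poly (@gen R k.+1) U * gy k.+1)) => A ioR f g sf sg.
apply: sw_nat => [c|i _|i _]; first exact: pevC.
  rewrite !coefM rmorph_sum; apply: eq_bigr => j _.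
  by rewrite rmorphM !coef_map /= pevC pev_gxW.
rewrite !coefM rmorph_sum; apply: eq_bigr => j _.
by rewrite rmorphM !coef_map /= pevC pev_gyW.
Qed.

Hypothesis van : forall (A : idomainType) (io : {rmorphism F -> A}) (u f g : {poly A}),
  (size u <= (d - k).+2)%N -> (size f <= k)%N -> (size g <= k)%N ->
  sw io lam (u * f) (u * g) = 0.
Hypothesis sU : (size U <= (d - k).+1)%N.

Lemma resultant_tableaux :
  (forall (A : idomainType) (ioR : {rmorphism R -> A}) (f g : {poly A}),
    (size f <= k.+1)%N -> (size g <= k.+1)%N ->
    sw (ioR \o ioF) lam (map_poly ioR U * f) (map_poly ioR U * g) = 0) \/
  (k <= m)%N /\ exists2 L, all (fun c : R * _ => tabok k.+1 (n - k)%N (m - k)%N c.2) L &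
  forall (A : idomainType) (ioR : {rmorphism R -> A}) (f g : {poly A}),
    (size f <= k.+1)%N -> (size g <= k.+1)%N ->
    sw (ioR \o ioF) lam (map_poly ioR U * f) (map_poly ioR U * g) =
    res k k f g * tabval ioR f g L.
Proof.
have [phi phiE] := generic_law.
have sZ A (s : A : idomainType) (f : {poly A}) : (size f <= k.+1)%N -> (size (s *: f) <= k.+1)%N.
  by apply: leq_trans; apply: size_scale_leq.
have [||||z|[le_km [L okL LE]]] := @shinv_resultant R k n m phi k_gt0 le_mn.
- move=> A ioR s f g sf sg; rewrite !phiE ?sZ // expr1 expr0 -!scalerAr sw_scale.
  by rewrite expr1n mulr1.
- move=> A ioR s f g sf sg; rewrite !phiE ?sZ // expr1 expr0 -!scalerAr sw_scale.
  by rewrite expr1n mul1r.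
- move=> A ioR t f g sf sg; rewrite !phiE //; last first.
    by rewrite (leq_trans (size_polyD _ _)) // geq_max sg sZ.
  by rewrite mulrDr -scalerAr sw_shift.
- move=> A ioR l f g sl sf sg; rewrite phiE ?size_lM // !mulrA van //.
  have := size_polyMleq (map_poly ioR U) l; have := size_poly (size U) (fun i => ioR U`_i).
  rewrite -/(map_poly ioR U); lia.
- by left => A ioR f g sf sg; rewrite -phiE // z.
by right; split=> //; exists L => // A ioR f g sf sg; rewrite -phiE // LE.
Qed.

End Abstract.

Hypothesis van : forall (A : idomainType) (io : {rmorphism F -> A}) (u f g : {poly A}),
  (size u <= (d - k).+2)%N -> (size f <= k)%N -> (size g <= k)%N ->
  sw io lam (u * f) (u * g) = 0.

Let e := (d - k)%N.

(** For generic u, division by the resultant gives tableaux with coefficients in F[u], whose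
    homogeneous parts of degree n + m define a functional on the tensor product. *)
Lemma resultant_step :
  (forall (A : idomainType) (io : {rmorphism F -> A}) (u f g : {poly A}),
    (size u <= e.+1)%N -> (size f <= k.+1)%N -> (size g <= k.+1)%N ->
    sw io lam (u * f) (u * g) = 0) \/
  (k <= m)%N /\ exists tau : 'Hom(tens2 (symtens (n + m) (sympow e 'cV[F]_2))
      (weyl [:: (n - k)%N; (m - k)%N] (sympow k 'cV[F]_2)), F^o),
  forall (A : idomainType) (io : {rmorphism F -> A}) (u f g : {poly A}),
    (size u <= e.+1)%N -> (size f <= k.+1)%N -> (size g <= k.+1)%N ->
    sw io lam (u * f) (u * g) = res k k f g * tE io tau u f g.
Proof.
pose R : idomainType := {mpoly F[e.+1]}; pose ioF : {rmorphism F -> R} := @mpolyC e.+1 F.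
pose U : {poly R} := \poly_(i < e.+1) (if insub i is Some j then 'X_j else 0).
have spec (A : idomainType) (io : {rmorphism F -> A}) (u : {poly A}) : (size u <= e.+1)%N ->
    exists ioR : {rmorphism R -> A}, [/\ forall c, ioR (ioF c) = io c, map_poly ioR U = u &
      forall c, ioR c = mmap io (fun i : 'I_e.+1 => u`_i) c].
  move=> su; exists (mmap io (fun i : 'I_e.+1 => u`_i)); split=> // [c|]; first exact: mmapC.
  apply/polyP => i; rewrite coef_map coef_poly; case: ltnP => [lt|le] /=.
    by rewrite insubT /= mmapX mmap1U.
  by rewrite rmorph0 nth_default // (leq_trans su).
have same (A : idomainType) (io : {rmorphism F -> A}) (ioR : {rmorphism R -> A}) (f g : {poly A}) :
    (forall c, ioR (ioF c) = io c) -> sw (ioR \o ioF) lam f g = sw io lam f g.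
  by move=> hio; apply: (@sw_nat _ _ _ _ _ _ idfun) => // c; apply: hio.
have [z|[le_km [L okL LE]]] := @resultant_tableaux R ioF U van (size_poly _ _).
  left=> A io u f g su sf sg; have [ioR [hio hU _]] := spec A io u su.
  by rewrite -(same A io ioR) // -hU; apply: z.
right; split=> //.
have [|tau tauE] := @tE_exists F (n + m) e (n - k) (m - k) k L (leq_sub2r k le_mn).
  exact: okL.
exists tau => A io u f g su sf sg; rewrite tauE //.
pose io' : {rmorphism F -> {poly A}} := polyC \o io.
(* E(u f, u g) has degree n + m in u and the resultant does not involve u; scaling u by an
   indeterminate and taking the coefficient of degree n + m selects the homogeneous parts. *)
pose u' : {poly {poly A}} := 'X *: map_poly polyC u.
pose f' := map_poly polyC f; pose g' := map_poly polyC g.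
have su' : (size u' <= e.+1)%N.
  by rewrite (leq_trans (size_scale_leq _ _)) ?size_map_polyC.
have [ioR [hio hU hc]] := spec {poly A} io' u' su'.
have E : sw io' lam (u' * f') (u' * g') = 'X ^+ (n + m) * (sw io lam (u * f) (u * g))%:P.
  rewrite /u' -!scalerAl sw_scale exprD; congr (_ * _).
  by symmetry; apply: (@sw_nat _ _ _ _ _ _ polyC) => // i _; rewrite -rmorphM coef_map.
have := LE _ ioR f' g' (size_map_polyC sf) (size_map_polyC sg).
rewrite hU (same _ io' ioR) // E => /(congr1 (fun p : {poly A} => p`_(n + m))).
rewrite coefXnM ltnn subnn coefC eqxx => ->.
have -> : res k k f' g' = (res k k f g)%:P.
  by symmetry; apply: res_nat => i; rewrite coef_map.
rewrite coefCM; congr (_ * _); rewrite /tabval coef_sum; apply: eq_bigr => c _.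
have -> : tabv f' g' c.2 = (tabv f g c.2)%:P.
  by symmetry; apply: tabv_nat => i; rewrite coef_map.
rewrite coefMC -coef_hev hc; congr (_`_(n + m) * _); congr (polyseq (mmap _ _ _)).
by apply: boolp.funext => i; rewrite coefZ coef_map mulrC mul_polyC.
Qed.

End ResultantStep.

Lemma dim_tens2 (F : fieldType) (S W : vectType F) :
  \dim {:tens2 S W} = (\dim {:S} * \dim {:W})%N.
Proof.
rewrite dimvf /dim /= muln1 -[LHS]/#|{dffun forall b : bool, 'I_(\dim {:if b then S else W})}|.
by rewrite card_dep_ffun foldrE big_map big_enum /= big_bool !card_ord.
Qed.

Section SubquotientIso.
Context {G : groupType} {F : fieldType} {V T : vectType F} (rV : rep G V) (rT : rep G T).

Lemma rep_iso_subquot (U W : submodule rV) (h : 'Hom(V, T)) :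
  (forall x, x \in subm_space U -> (h x == 0) = (x \in subm_space W)) ->
  (forall t, exists2 x, x \in subm_space U & h x = t) ->
  (forall g x, x \in subm_space U -> h (rV g x) = rT g (h x)) ->
  rep_iso (subquot_rep U W) rT.
Proof.
move=> hker hsurj hact; pose R := res_space U W.
pose f : 'Hom(quotv R, T) := (h \o linfun vsval \o (qproj R)^-1)%VF.
have fE u : f (qproj R u) = h (vsval u).
  have : (qproj R)^-1%VF (qproj R u) - u \in R.
    by rewrite -qproj_eq0 linearB /= limg_lfunVK ?subrr // limg_qproj memvf.
  rewrite mem_res_space -hker ?subvsP // !linearB /= subr_eq0 => /eqP <-.
  by rewrite !comp_lfunE [linfun _ _]lfunE.
exists f => [|g v].
  have f0 : lker f == 0%VS.
    rewrite -subv0; apply/subvP => y; have [u ->] := qproj_surj y.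
    by rewrite memv_ker fE hker ?subvsP // -mem_res_space memv0 qproj_eq0.
  have fV : limg f = fullv.
    apply/eqP; rewrite eqEsubv subvf; apply/subvP => t _; have [x xU <-] := hsurj t.
    by apply/memv_imgP; exists (qproj R (vsproj U x)); rewrite ?memvf // fE vsprojK.
  exists (f^-1)%VF => x; first exact: lker0_lfunK.
  by rewrite limg_lfunVK // fV memvf.
have [u ->] := qproj_surj v.
rewrite -[subquot_rep U W g _]/(quot_act (res_submodule U W) g (qproj R u)).
by rewrite (quot_act_qproj (res_submodule U W)) !fE vsval_sub_act hact ?subvsP.
Qed.

End SubquotientIso.

(** * The filtration of the space of functionals *)

Section Filtration.
Context {F : fieldType} {n m d : nat}.
Hypotheses (m_gt0 : (0 < m)%N) (le_mn : (m <= n)%N).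
Local Notation W := (weyl [:: n; m] (sympow d 'cV[F]_2)).
Local Notation rW := (weyl_rep [:: n; m] (sympow_rep d (nat_rep F))).
Local Notation T i := (tens2 (symtens (n + m) (sympow (d - i.+1)%N 'cV[F]_2))
  (weyl [:: (n - i.+1)%N; (m - i.+1)%N] (sympow i.+1 'cV[F]_2))).
Local Notation rT i := (tens2_rep (symtens_rep (n + m) (sympow_rep (d - i.+1)%N (nat_rep F)))
  (weyl_rep [:: (n - i.+1)%N; (m - i.+1)%N] (sympow_rep i.+1 (nat_rep F)))).
Implicit Types (A : idomainType) (lam : 'Hom(W, F^o)).

(* With j <= i rather than j < k: this is the space D_(i+1) of the header. *)
Definition vanishing i lam := forall A (io : {rmorphism F -> A}) (u f g : {poly A}) j,
  (j <= i)%N -> (j <= d)%N ->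
  (size u <= (d - j).+1)%N -> (size f <= j.+1)%N -> (size g <= j.+1)%N ->
  sw io lam (u * f) (u * g) = 0.

(** The graph of the embedding of D_(i+1) / D_(i+2) in the dual of the layer k = i + 1, kept as a
    relation because [tau] comes from an existence statement. *)
Definition layer i lam (tau : 'Hom(T i, F^o)) := forall A (io : {rmorphism F -> A}) (u f g : {poly A}),
  (size u <= (d - i.+1).+1)%N -> (size f <= i.+2)%N -> (size g <= i.+2)%N ->
  sw io lam (u * f) (u * g) = res i.+1 i.+1 f g * tE io tau u f g.

Lemma vanishing_linear i : linpred (vanishing i).
Proof.
split=> [|a x y Px Py] A io u f g j ji jd su sf sg; first exact: sw0.
by rewrite swP (Px _ _ _ _ _ j) // (Py _ _ _ _ _ j) // mulr0 addr0.
Qed.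

Lemma layer_linear i : linrel (@layer i).
Proof.
move=> a x y t s Rx Ry A io u f g su sf sg.
by rewrite swP tEP Rx // Ry // mulrDr mulrCA.
Qed.

(** Forms of degree 0 are constants, and E(c u, c' u) is a multiple of E(u, u) = E(u, 0 + u) = E(u,
    0), which is 0 as m > 0. *)
Lemma vanishing0 lam : vanishing 0 lam.
Proof.
move=> A io u f g j; rewrite leqn0 => /eqP -> _ _ /size1_polyC -> /size1_polyC ->.
rewrite ![u * _]mulrC !mul_polyC sw_scale.
have -> : sw io lam u u = sw io lam u 0.
  by rewrite -(sw_shift io lam 1 u 0 le_mn) scale1r add0r.
have z := sw_scale io lam 1 0 u 0; rewrite scale1r scale0r in z.
by rewrite z (expr0n _ m) eqn0Ngt m_gt0 mulr0 mul0r mulr0.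
Qed.

(** A common factor of f and g is absorbed by u, leaving forms of degree i; so [vanishing i] is the
    hypothesis of [resultant_step] for k = i + 1. *)
Lemma vanishing_step i lam : (i < d)%N -> vanishing i lam ->
  vanishing i.+1 lam \/ (i < m)%N /\ exists tau : 'Hom(T i, F^o), layer lam tau.
Proof.
move=> lt_id van; have [|z|[le [tau tauE]]] := @resultant_step F n m d i.+1 lam le_mn isT lt_id.
- move=> A io u f g su sf sg; apply: (van _ _ _ _ _ i) => //; first exact: ltnW.
  by move: su; rewrite subnSK.
- left=> A io u f g j; rewrite leq_eqVlt => /orP[/eqP -> _ | ji jd]; first exact: z.
  exact: van.
by right; split=> //; exists tau.
Qed.

Lemma vanishing_layer0 i lam : vanishing i lam -> layer lam (0 : 'Hom(T i, F^o)) ->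
  vanishing i.+1 lam.
Proof.
move=> van R0 A io u f g j; rewrite leq_eqVlt => /orP[/eqP -> _ su sf sg | ji jd].
  by rewrite R0 // tE0 mulr0.
exact: van.
Qed.

(** Beyond m there are no layers, so [vanishing m] improves step by step to [vanishing d], and j = d
    with u = 1 is the whole law. *)
Lemma vanishing_min lam : vanishing (minn m d) lam -> lam = 0.
Proof.
move=> van; have {}van : vanishing d lam.
  have [le|/ltnW le] := leqP d m; first by move: van; rewrite (minn_idPr le).
  move: van; rewrite (minn_idPl le) => van.
  have up j : (m <= j)%N -> (j <= d)%N -> vanishing j lam.
    elim: j => [|j IHj]; first by rewrite leqNgt m_gt0.
    rewrite leq_eqVlt => /orP[/eqP <- //|mj jd].
    have [//|[]] := vanishing_step jd (IHj mj (ltnW jd)).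
    by rewrite ltnNge -ltnS mj.
  exact: up.
apply: sw_inj => A io f g sf sg; rewrite -[f]mul1r -[g]mul1r.
by apply: (van _ _ _ _ _ d) => //; rewrite subnn size_poly1.
Qed.

End Filtration.

Lemma dim_layer (F : fieldType) (n m d i : nat) : (i < d)%N ->
  \dim {:tens2 (symtens (n + m) (sympow (d - i.+1)%N 'cV[F]_2))
    (weyl [:: (n - i.+1)%N; (m - i.+1)%N] (sympow i.+1 'cV[F]_2))} =
  ('C(n + m + d - i.+1, n + m) *
    \dim {:weyl [:: (n - i.+1)%N; (m - i.+1)%N] (sympow i.+1 'cV[F]_2)})%N.
Proof.
move=> lt; rewrite dim_tens2 (dim_symtens (dim_sympow _)); congr ('C(_, _) * _)%N.
by lia.
Qed.

(** [filtration] gives the upper bound for all n', m', d', including d' < m'. All of these enter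
    [weyl_numbers], since the layers lead to Sym^k E with small k; its conclusion is the reverse
    inequality, which makes the embeddings onto. *)
Lemma weyl_filtration (F : fieldType) (n m d : nat) : (0 < m)%N -> (m <= n)%N ->
  \dim {:weyl [:: n; m] (sympow d 'cV[F]_2)} =
    (\sum_(i < minn m d) \dim {:tens2 (symtens (n + m) (sympow (d - i.+1)%N 'cV[F]_2))
    (weyl [:: (n - i.+1)%N; (m - i.+1)%N] (sympow i.+1 'cV[F]_2))})%N /\
  forall i (tau : 'Hom(tens2 (symtens (n + m) (sympow (d - i.+1)%N 'cV[F]_2))
    (weyl [:: (n - i.+1)%N; (m - i.+1)%N] (sympow i.+1 'cV[F]_2)), F^o)), (i < minn m d)%N ->
  exists lam : 'Hom(weyl [:: n; m] (sympow d 'cV[F]_2), F^o), vanishing i lam /\ layer lam tau.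
Proof.
pose w n m d := \dim {:weyl [:: n; m] (sympow d 'cV[F]_2)}.
pose T n m d i : vectType F := tens2 (symtens (n + m) (sympow (d - i.+1)%N 'cV[F]_2))
    (weyl [:: (n - i.+1)%N; (m - i.+1)%N] (sympow i.+1 'cV[F]_2)).
have main n' m' d' : (0 < m')%N -> (m' <= n')%N ->
    (w n' m' d' <= \sum_(i < minn m' d') \dim {:T n' m' d' i})%N /\
    ((\sum_(i < minn m' d') \dim {:T n' m' d' i} <= w n' m' d')%N ->
     forall i (tau : 'Hom(T n' m' d' i, F^o)), (i < minn m' d')%N ->
     exists lam : 'Hom(weyl [:: n'; m'] (sympow d' 'cV[F]_2), F^o), vanishing i lam /\ layer lam tau).
  move=> m0 le.
  have [||||||] := @filtration F 'Hom(weyl [:: n'; m'] (sympow d' 'cV[F]_2), F^o)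
    (@vanishing F n' m' d') (fun i => 'Hom(T n' m' d' i, F^o)) (@layer F n' m' d') (minn m' d').
  - exact: vanishing_linear.
  - exact: layer_linear.
  - exact: vanishing0.
  - exact: vanishing_min.
  - move=> i lam; rewrite leq_min => /andP[im id] van.
    have [z|[_ //]] := vanishing_step le id van.
    exists 0 => A io u f g su sf sg; rewrite tE0 mulr0.
    by apply: (z _ _ _ _ _ i.+1).
  - by move=> i lam _; apply: vanishing_layer0.
  rewrite dim_dual; under eq_bigr do rewrite dim_dual.
  by [].
have sumE n' m' d' : (\sum_(i < minn m' d') \dim {:T n' m' d' i} = \sum_(i < minn m' d')
    'C(n' + m' + d' - i.+1, n' + m') * w (n' - i.+1) (m' - i.+1) i.+1)%N.
  by apply: eq_bigr => i _; apply: dim_layer; have := ltn_ord i; lia.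
move=> m0 le_mn; have [le1 H] := main n m d m0 le_mn.
have ge : (\sum_(i < minn m d) \dim {:T n m d i} <= w n m d)%N.
  rewrite sumE; apply: (@weyl_numbers w) => // [n' d'|n' m' d' le|n' m' d' m0' le].
  - by have := dim_weyl_symt (dim_sympow (F := F) d') n' 0; rewrite bin0 muln1.
  - exact: (sym_weyl_dim (dim_sympow d') le).
  - by rewrite -sumE; have [] := main n' m' d' m0' le.
by split; [apply/eqP; rewrite eqn_leq le1 | apply: H].
Qed.

Lemma functional_eq0 (F : fieldType) (V : vectType F) (x : V) :
  (forall lam : 'Hom(V, F^o), lam x = 0) -> x = 0.
Proof.
move=> z; rewrite (coord_vbasis (memvf x)) big1 // => j _.
by rewrite -cfunE z scale0r.
Qed.

(** * From functionals back to submodules *)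

Section Annihilators.
Context {F : fieldType} {n m d : nat}.
Hypotheses (m_gt0 : (0 < m)%N) (le_mn : (m <= n)%N) (le_md : (m <= d)%N).
Local Notation W := (weyl [:: n; m] (sympow d 'cV[F]_2)).
Local Notation rW := (weyl_rep [:: n; m] (sympow_rep d (nat_rep F))).
Local Notation T i := (tens2 (symtens (n + m) (sympow (d - i.+1)%N 'cV[F]_2))
  (weyl [:: (n - i.+1)%N; (m - i.+1)%N] (sympow i.+1 'cV[F]_2))).
Local Notation rT i := (tens2_rep (symtens_rep (n + m) (sympow_rep (d - i.+1)%N (nat_rep F)))
  (weyl_rep [:: (n - i.+1)%N; (m - i.+1)%N] (sympow_rep i.+1 (nat_rep F)))).
Implicit Types (A : idomainType) (lam : 'Hom(W, F^o)).

Lemma vanishing_act i lam g : vanishing i lam -> vanishing i (lam \o rW g)%VF.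
Proof.
move=> van A io u f f' j ji jd su sf sf'.
have sM (p : {poly A}) : (size p <= j.+1)%N -> (size (u * p)%R <= d.+1)%N.
  by move=> sp; apply: leq_trans (size_polyMleq _ _) _; lia.
rewrite sw_act ?sM // -[d in gact d](subnK jd) !gactM //.
by apply: (van _ _ _ _ _ j) => //; apply: size_gact.
Qed.

(** Substitution is multiplicative for formal degrees and preserves the resultant, so the group acts
    on the cofactor chi alone. *)
Lemma layer_act i lam (tau : 'Hom(T i, F^o)) g : (i < d)%N ->
  layer lam tau -> layer (lam \o rW g)%VF (tau \o rT i g)%VF.
Proof.
move=> id lay A io u f f' su sf sf'.
have sM (p : {poly A}) : (size p <= i.+2)%N -> (size (u * p)%R <= d.+1)%N.
  by move=> sp; apply: leq_trans (size_polyMleq _ _) _; lia.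
rewrite sw_act ?sM // -[d in gact d](subnK id) !gactM // lay ?size_gact //.
by rewrite tE_act // (res_inv_SL2 io (eqP (SL2P g))).
Qed.

Definition ann i (x : W) := forall lam, vanishing i lam -> lam x = 0.

Lemma ann_linear i : linpred (ann i).
Proof.
split=> [|a x y Ax Ay] lam van; first exact: linear0.
by rewrite linearP /= (Ax lam van) (Ay lam van) scaler0 addr0.
Qed.

Definition ann_space i : {vspace W} := projT1 (boolp.cid (linpred_space (ann_linear i))).

Lemma ann_spaceP i x : x \in ann_space i <-> ann i x.
Proof. by rewrite /ann_space; case: boolp.cid. Qed.

Fact ann_stable i g x : x \in ann_space i -> rW g x \in ann_space i.
Proof.
move/ann_spaceP => Ax; apply/ann_spaceP => lam van.
by rewrite -comp_lfunE; apply/Ax/vanishing_act.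
Qed.

Definition ann_submodule i : submodule rW := Submodule (@ann_stable i).

Lemma ann_min : ann_space m = fullv.
Proof.
apply/vspaceP => x; rewrite memvf; apply/ann_spaceP => lam van.
by rewrite (vanishing_min m_gt0 le_mn (lam := lam)) ?(minn_idPl le_md) // zero_lfunE.
Qed.

Lemma ann0 : ann_space 0 = 0%VS.
Proof.
apply/vspaceP => x; rewrite memv0; apply/idP/eqP => [/ann_spaceP Ax | ->]; last exact: mem0v.
by apply: functional_eq0 => lam; apply/Ax/vanishing0.
Qed.

Lemma ann_mono i j : (i <= j)%N -> (ann_space i <= ann_space j)%VS.
Proof.
move=> ij; apply/subvP => x /ann_spaceP Ax; apply/ann_spaceP => lam van; apply: Ax.
by move=> A io u f g l li; apply: van; apply: leq_trans ij.
Qed.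

(* t is the image of x in the i-th layer when every functional of T i takes at
   t the value at x of the functionals lying over it *)
Definition layer_image i (x : W) (t : T i) := forall lam (tau : 'Hom(T i, F^o)),
  vanishing i lam -> layer lam tau -> lam x = tau t.

Lemma layer_image_linear i : linrel (@layer_image i).
Proof. by move=> a x y t s Rx Ry lam tau van lay; rewrite !linearP /= (Rx _ tau) // (Ry _ tau). Qed.

Lemma lt_minn i : (i < m)%N -> (i < minn m d)%N.
Proof. by move=> im; rewrite (minn_idPl le_md). Qed.

(** Every functional on the layer lifts, by the surjectivity in [weyl_filtration], so [x] determines
    the values of all functionals at its image. *)
Lemma layer_image_inj i x t t' : (i < m)%N ->
  layer_image x t -> layer_image x t' -> t = t' :> T i.
Proof.
move=> im Rt Rt'; apply/eqP; rewrite -subr_eq0; apply/eqP/functional_eq0 => tau.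
have [_ /(_ i tau (lt_minn im))[lam [van lay]]] := weyl_filtration F d m_gt0 le_mn.
by rewrite linearB /= -(Rt _ _ van lay) -(Rt' _ _ van lay) subrr.
Qed.

(** Two lifts of the same [tau] differ by an element of [vanishing i.+1], which is 0 at x. So tau ->
    lam x is a well-defined linear form on the dual of the layer, hence evaluation at a vector,
    whose coordinates come from lifts of the coordinate functionals. *)
Lemma layer_image_exists i x : (i < m)%N -> ann i.+1 x -> exists t : T i, layer_image x t.
Proof.
move=> im Ax; have [_ onto] := weyl_filtration F d m_gt0 le_mn.
pose lamj (j : 'I_(\dim {:T i})) := projT1 (boolp.cid (onto i (cfun j) (lt_minn im))).
have [vanj layj] : (forall j, vanishing i (lamj j)) /\ forall j, layer (lamj j) (cfun j).
  by split=> j; rewrite /lamj; case: boolp.cid => ? [].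
exists (\sum_j lamj j x *: (vbasis {:T i})`_j) => lam tau van lay.
pose a (j : 'I_(\dim {:T i})) : F := tau (vbasis {:T i})`_j.
pose lam' : 'Hom(W, F^o) := \sum_j a j *: lamj j.
have H (s : seq 'I_(\dim {:T i})) :
    vanishing i (\sum_(j <- s) a j *: lamj j : 'Hom(W, F^o)) /\
    layer (\sum_(j <- s) a j *: lamj j : 'Hom(W, F^o))
      (\sum_(j <- s) a j *: cfun j : 'Hom(T i, F^o)).
  elim: s => [|j s [IHv IHl]]; rewrite ?big_nil ?big_cons.
    split; first by case: (@vanishing_linear F n m d i).
    by move=> A io u f g _ _ _; rewrite sw0 tE0 mulr0.
  split; first by case: (@vanishing_linear F n m d i) => _; apply.
  exact: layer_linear.
have [van' lay'] := H (index_enum _).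
have tauE := functional_sum tau; rewrite -[X in layer _ X]tauE in lay'.
have vd : vanishing i.+1 ((-1) *: lam' + lam).
  apply: (@vanishing_layer0 _ _ _ _ i).
    by case: (@vanishing_linear F n m d i) => _; apply.
  have tau0 : (-1) *: tau + tau = 0 by rewrite scaleN1r addNr.
  by have := layer_linear (-1) lay' lay; rewrite tau0.
have := Ax _ vd; rewrite add_lfunE scale_lfunE scaleN1r addrC => /eqP; rewrite subr_eq0 => /eqP ->.
rewrite sum_lfunE linear_sum; apply: eq_bigr => j _.
by rewrite scale_lfunE linearZ; apply: mulrC.
Qed.

Lemma layer_image_ker i x : (i < m)%N -> ann i.+1 x -> layer_image x (0 : T i) -> ann i x.
Proof.
move=> im Ax R0 lam van.
have [/Ax //|[_ [tau lay]]] := vanishing_step le_mn (leq_trans im le_md) van.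
by rewrite (R0 _ _ van lay) linear0.
Qed.

Lemma layer_image_act i x (t : T i) g : (i < m)%N -> layer_image x t ->
  layer_image (rW g x) (rT i g t).
Proof.
move=> im R lam tau van lay; rewrite -comp_lfunE -[RHS]comp_lfunE.
by apply: R; [apply: vanishing_act | apply: layer_act => //; apply: leq_trans le_md].
Qed.

(** A second count, on the Weyl module itself: the subquotients of the annihilators embed in the
    layers, whose dimensions add up to that of the module. The index is reversed because
    annihilators grow with it. *)
Lemma layer_image_onto i (t : T i) : (i < m)%N -> exists x, ann i.+1 x /\ layer_image x t.
Proof.
have [dimW _] := weyl_filtration F d m_gt0 le_mn; rewrite (minn_idPl le_md) in dimW.
have [|||||| _ onto] := @filtration F W (fun i => ann (m - i)) (fun i => T (m - i.+1))
  (fun i => @layer_image (m - i.+1)) m.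
- by move=> j; apply: ann_linear.
- by move=> j; apply: layer_image_linear.
- by move=> x; apply/ann_spaceP; rewrite subn0 ann_min memvf.
- move=> x; rewrite subnn => /ann_spaceP; rewrite ann0 memv0; exact: eqP.
- move=> j x jm Ax; apply: layer_image_exists; first by lia.
  by rewrite subnSK.
- move=> j x jm Ax; apply: layer_image_ker; first by lia.
  by rewrite subnSK.
move=> im; have := onto _ (m - i.+1)%N; have e : (m - (m - i.+1).+1)%N = i by lia.
rewrite e (_ : (m - (m - i.+1))%N = i.+1); last by lia.
apply; last by lia.
rewrite dimW (reindex_inj rev_ord_inj) /=; apply: leq_sum => j _.
by have -> : (m - (m - j.+1).+1)%N = j by have := ltn_ord j; lia.
Qed.

Lemma ann_layer i : (i < m)%N ->
  rep_iso (subquot_rep (ann_submodule i.+1) (ann_submodule i)) (rT i).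
Proof.
move=> im.
have [|h hR] := @linrel_fun F W (T i) (ann_space i.+1) (@layer_image i) (@layer_image_linear i).
  by move=> x /ann_spaceP; apply: layer_image_exists.
apply: (rep_iso_subquot (h := h)) => [x xU|t|g x xU] /=.
- apply/eqP/idP => [hx | /ann_spaceP Ax].
    apply/ann_spaceP/layer_image_ker => //; first exact/ann_spaceP.
    by rewrite -hx; apply: hR.
  apply: (layer_image_inj im (hR _ xU)) => lam tau van lay.
  by rewrite Ax // linear0.
- have [x [/ann_spaceP xU Rt]] := layer_image_onto t im; exists x => //.
  exact: layer_image_inj im (hR _ xU) Rt.
apply: (layer_image_inj im (hR _ (ann_stable g xU))).
exact/layer_image_act/hR.
Qed.

End Annihilators.

Theorem theorem1p1 (F : fieldType) (m n d : nat)
    (m_gt0 : (0 < m)%N) (le_mn : (m <= n)%N) (le_md : (m <= d)%N) :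
  exists M : nat -> submodule (weyl_rep [:: n; m] (sympow_rep d (nat_rep F))),
    [/\ subm_space (M 0%N) = fullv,
        subm_space (M m) = 0%VS,
        forall i : nat, (i < m)%N ->
          (subm_space (M i.+1) <= subm_space (M i))%VS
      & forall i k : nat, (i < m)%N -> k = (m - i)%N ->
          rep_iso (subquot_rep (M i) (M i.+1))
            (tens2_rep
               (symtens_rep (n + m)%N (sympow_rep (d - k)%N (nat_rep F)))
               (weyl_rep [:: (n - k)%N; (m - k)%N]
                  (sympow_rep k (nat_rep F))))].
Proof.
(* As [vanishing j] is D_(j+1), the submodule M_i is the annihilator of D_(k+1) for k = m - i, and
   the layer k has index k - 1. *)
exists (fun i => ann_submodule m_gt0 le_mn le_md (m - i)); split=> [|||i k im].
- by rewrite /= subn0 ann_min.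
- by rewrite /= subnn ann0.
- by move=> i im; apply: ann_mono; apply: leq_sub2l.
case: k => [|k] e; first by move: im; rewrite -subn_gt0 -e.
have -> : (m - i.+1)%N = k by rewrite subnS -e.
rewrite -e; apply: ann_layer.
by apply: leq_trans (leq_subr i m); rewrite -e.
Qed.
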